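(* Let $n\ge1$, $\tau>0$, $T>0$, $P_0>0$, let $v(\lambda)$ and $u(\lambda)$ be given spectral densities, and let $a:[0,T]\to\mathbb C$ satisfy $\int_0^T|\mathbf D_T^\tau a(t)|dt<\infty$ and $\int_0^Tt|\mathbf D_T^\tau a(t)|^2dt<\infty$. Let $$\mathcal D_v^u=\Big\{f:\ v(\lambda)\le f(\lambda)\le u(\lambda),\ \int_{-\infty}^\infty f(\lambda)d\lambda=2\pi P_0\Big\}.$$ Consider, for functions $\varphi$ on $[0,T]$, the equations $$\mathbf D_T^\tau\mathbf A_T\mathbf W^\tau\varphi=\alpha\overline\varphi,\ \alpha\in\mathbb C,\quad(\mathrm E_1)\qquad \mathbf D_T^\tau\widehat{\mathbf A}_T\mathbf W^\tau\varphi=\beta\overline\varphi,\ \beta\in\mathbb C,\quad(\mathrm E_2)$$ and densities of the form $$f^0(\lambda)=\max\Big\{v(\lambda),\min\Big\{u(\lambda),\Big|c\int_0^T(\mathbf D_T^\tau\mathbf A_T\varphi^0_\tau)(t)e^{i\lambda t}dt\Big|^2\Big\}\Big\},\qquad(\mathrm F)$$ where $c$ is a constant, $\varphi^0$ (on $[0,T]$) is the function of the canonical factorization $f^0(\lambda)=|\int_0^T\varphi^0(t)e^{-i\lambda t}dt|^2$ and $\varphi^0_\tau=\mathbf W^\tau\varphi^0$. Let $\nu_{uv}^TP_0$ be the maximum of $\|\mathbf D_T^\tau\mathbf A_T\mathbf W^\tau\varphi\|^2=\|\mathbf D_T^\tau\widehat{\mathbf A}_T\mathbf W^\tau\varphi\|^2$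 over the set $S$ of solutions $\varphi$ of $(\mathrm E_1)$ or $(\mathrm E_2)$ such that $\|\varphi\|^2=P_0$, $v(\lambda)\le|\int_0^T\varphi(t)e^{-i\lambda t}dt|^2\le u(\lambda)$, and $\varphi$ defines the canonical factorization of the density $|\int_0^T\varphi(t)e^{-i\lambda t}dt|^2$. Let $\nu_{uv}^{T+}P_0$ be the maximum of $\|\mathbf D_T^\tau\mathbf A_T\mathbf W^\tau\varphi\|^2$ over those $\varphi$ with $\|\varphi\|^2=P_0$ which define the canonical factorization of a density $f^0$ of the form $(\mathrm F)$ (with $\varphi^0=\varphi$). (i) If there exists $\varphi^0\in S$ with $\nu_{uv}^TP_0=\nu_{uv}^{T+}P_0=\|\mathbf D_T^\tau\mathbf A_T\mathbf W^\tau\varphi^0\|^2$, then $f^0(\lambda)=|\int_0^T\varphi^0(t)e^{-i\lambda t}dt|^2$ is least favorable in $\mathcal D_v^u$ for the optimal estimation of the functional $A_T\xi=\int_0^Ta(t)\xi(t)dt$ of the unknown values $\xi(t)$, $t\in[0,T]$, of the random process $\xi(t)$ with stationary $n$th increments, and the corresponding increment $\xi^{(n)}(t,\tau)$ admits a one-sided moving average representation. (ii) If $\nu_{uv}^T<\nu_{uv}^{T+}$, then the density $f^0$ of the form $(\mathrm F)$ which admits the canonical factorization is least favorable in $\mathcal D_v^u$, where the function $c\varphi^0_\tau(t)$, $t\in[0,T]$, is determined by the equality $\varphi^0_\tau=\mathbf W^\tau\varphi^0$, by the condition that $\varphi^0$ is a solution of the extremum problem $\|\mathbf D_T^\tau\mathbf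 A_T\mathbf W^\tau\varphi\|^2\to\max$ subject to $|\int_0^T\varphi(t)e^{-i\lambda t}dt|^2\in\mathcal D_v^u$, and by the condition $\|\varphi^0\|^2=P_0$. (iii) In both cases, provided $h_{\tau,T}^{(a)}(f^0)\in H_{\mathcal D_v^u}$, the minimax-robust spectral characteristic is $h^0=h_{\tau,T}^{(a)}(f^0)$.
   Context: Process and density. The $n$th increment of $\xi$ with step $\tau>0$ is $\xi^{(n)}(t,\tau)=\sum_{l=0}^n(-1)^l\binom nl\xi(t-l\tau)$; $\xi$ has stationary $n$th increments if the first two moments $\mathsf E\xi^{(n)}(t_0,\tau)$ (assumed $0$) and $\mathsf E\xi^{(n)}(t_0+t,\tau_1)\overline{\xi^{(n)}(t_0,\tau_2)}$ do not depend on $t_0$. Then $\xi^{(n)}(t,\tau)=\int e^{it\lambda}\chi_\tau(\lambda)dZ(\lambda)$, $\chi_\tau(\lambda)=(1-e^{-i\lambda\tau})^n\frac{(1+i\lambda)^n}{(i\lambda)^n}$, with $Z$ an orthogonal random measure, $\mathsf E Z(A_1)\overline{Z(A_2)}=F(A_1\cap A_2)$; the spectral density $f\ge0$ is normalized by $dF=\frac1{2\pi}f\,d\lambda$. $H^t(\xi^{(n)})$ is the closed span of $\{\xi^{(n)}(u,\sigma):u\le t,\sigma>0\}$. A function $\varphi\in L_2([0,\infty))$ defines the canonical factorization $f=|\Phi|^2$, $\Phi(\lambda)=\int_0^\infty e^{-i\lambda t}\varphi(t)dt$, if for the increment process with density $f$ there is a process $\eta$ with orthogonal increments, $\mathsf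 E|\eta(t)-\eta(s)|^2=|t-s|$, $H^z(\xi^{(n)})=H^z(\eta)$ for all $z$ ($H^z(\eta)$ = closed span of increments of $\eta$ on $(-\infty,z]$), and $\xi^{(n)}(t,\sigma)=\int_{-\infty}^t\varphi_\sigma(t-s)d\eta(s)$ (one-sided moving average representation) for all $\sigma>0$, where $\varphi_\sigma\in L_2([0,\infty))$ has Fourier transform $\Phi_\sigma(\lambda)=\int_0^\infty e^{-i\lambda t}\varphi_\sigma(t)dt=\chi_\sigma(\lambda)\Phi(\lambda)$. Functions on $[0,T]$ are extended by $0$ to $[0,\infty)$. Operators. $\|\cdot\|$ is the $L_2$ norm, so $\|\varphi\|^2=\frac1{2\pi}\int|\Phi|^2d\lambda$. $\mathbf W^\tau$ is the operator $\varphi\mapsto\varphi_\tau$ (causal convolution operator with Fourier multiplier $\chi_\tau$), its values being used on $[0,T]$. $[x]$ is the integer part; $d(k)$ are defined by $\sum_{k\ge0}d(k)x^k=(\sum_{j\ge0}x^j)^n$; $\mathbf D_T^\tau a(t)=\sum_{k=0}^{[(T-t)/\tau]}a(t+\tau k)d(k)$, $t\in[0,T]$. For $t\in[0,T]$: $(\mathbf D_T^\tau\mathbf A_T\psi)(t)=\sum_{k=0}^{[(T-t)/\tau]}d(k)\int_0^{T-t-\tau k}a(u+t+\tau k)\psi(u)du$ and $(\mathbf D_T^\tau\widehat{\mathbf A}_T\psi)(t)=\sum_{k=0}^{[t/\tau]}d(k)\int_0^{t-\tau k}a(T-t+u+\tau k)\psi(u)du$. Estimation. With $b_{\tau,T}=\mathbf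 D_T^\tau a$ and $v_{\tau,T}(t)=\sum_{l=\lceil-t/\tau\rceil}^{\min\{[(T-t)/\tau],n\}}(-1)^l\binom nl b_{\tau,T}(t+l\tau)$, one has $A_T\xi=\int_0^Tb_{\tau,T}(t)\xi^{(n)}(t,\tau)dt-\int_{-\tau n}^0v_{\tau,T}(t)\xi(t)dt$. Given observations $\xi(t)$, $t<0$, linear estimates are $-\int_{-\tau n}^0v_{\tau,T}\xi\,dt+\int h\chi_\tau dZ$ with spectral characteristic $h$; under density $f$ the mean square error is $\Delta(h;f)=\frac1{2\pi}\int|A_{\tau,T}-h|^2|\chi_\tau|^2f\,d\lambda$, $A_{\tau,T}(\lambda)=\int_0^T\mathbf D_T^\tau a(t)e^{i\lambda t}dt$. For $f$ admitting the canonical factorization the optimal characteristic is $h_{\tau,T}^{(a)}(f)=A_{\tau,T}-r_{\tau,T}^{(a)}\Phi_\tau^{-1}$, $r_{\tau,T}^{(a)}(\lambda)=\int_0^T(\mathbf D_T^\tau\mathbf A_T\varphi_\tau)(t)e^{i\lambda t}dt$, and $\Delta(h_{\tau,T}^{(a)}(f);f)=\|\mathbf D_T^\tau\mathbf A_T\varphi_\tau\|^2$. Minimax notions. For a class $\mathcal D$ of spectral densities, $f^0\in\mathcal D$ is least favorable if $\Delta(h_{\tau,T}^{(a)}(f^0);f^0)=\max_{f\in\mathcal D}\Delta(h_{\tau,T}^{(a)}(f);f)$ (over densities admitting the canonical factorization). $L_2^{0-}(f)$ is the closed subspace of $L_2(f)$ generated by functions $\chi_\tau(\lambda)\int_0^\infty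 g(t)e^{-i\lambda t}dt$; a characteristic $h$ is said to belong to it if $h\chi_\tau$ does. $H_{\mathcal D}=\bigcap_{f\in\mathcal D}L_2^{0-}(f)$. $h^0\in H_{\mathcal D}$ is minimax-robust if $\min_{h\in H_{\mathcal D}}\sup_{f\in\mathcal D}\Delta(h;f)=\sup_{f\in\mathcal D}\Delta(h^0;f)$. *)

(* Defs.v *)
From HB Require Import structures.
From mathcomp Require Import all_boot all_order all_algebra.
From mathcomp Require Import all_classical all_reals all_analysis.
From mathcomp Require Import complex.

Set Implicit Arguments.
Unset Strict Implicit.
Unset Printing Implicit Defensive.

Import Order.TTheory GRing.Theory Num.Theory.
Import numFieldNormedType.Exports.

Local Open Scope classical_set_scope.
Local Open Scope ring_scope.
Local Open Scope complex_scope.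

(* Integration is available for real and extended-real functions only, so
   measurability and integrals of R[i]-valued functions go through real and
   imaginary parts.  Functions on [0, T] (or [0, +oo[) are functions on R that
   vanish outside, cf. L2on. *)

Definition sqnormc (R : realType) (z : R[i]) : R := ComplexField.Normc.normc z ^+ 2.

Definition expi (R : realType) (x : R) : R[i] := cos x +i* sin x.

Definition cmeasurable (R : realType) d (X : measurableType d) (D : set X)
    (g : X -> R[i]) : Prop :=
  measurable_fun D (fun x => complex.Re (g x)) /\
  measurable_fun D (fun x => complex.Im (g x)).

Definition cintegral (R : realType) d (X : measurableType d)
    (m : {measure set X -> \bar R}) (D : set X) (g : X -> R[i]) : R[i] :=
  (\int[m]_(x in D) complex.Re (g x)) +i* (\int[m]_(x in D) complex.Im (g x)).

Definition cintegrable (R : realType) d (X : measurableType d)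
    (m : {measure set X -> \bar R}) (D : set X) (g : X -> R[i]) : Prop :=
  m.-integrable D (fun x => (complex.Re (g x))%:E) /\
  m.-integrable D (fun x => (complex.Im (g x))%:E).

Definition L2sq (R : realType) d (X : measurableType d)
    (m : {measure set X -> \bar R}) (D : set X) (g : X -> R[i]) : \bar R :=
  (\int[m]_(x in D) (sqnormc (g x))%:E)%E.

Definition leb (R : realType) : {measure set (measurableTypeR R) -> \bar R} :=
  lebesgue_measure.

Definition L2on (R : realType) (D : set R) (phi : R -> R[i]) : Prop :=
  [/\ cmeasurable (X := measurableTypeR R) setT phi,
      (L2sq (leb R) D phi < +oo)%E &
      forall t, ~ D t -> phi t = 0].

(* Phi is the L2-limit, as N -> oo, of \int_0^N e^{-i l t} phi(t) dt. *)
Definition is_fourier (R : realType) (phi Phi : R -> R[i]) : Prop :=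
  [/\ cmeasurable (X := measurableTypeR R) setT Phi,
      (L2sq (leb R) setT Phi < +oo)%E &
      (fun N : nat => L2sq (leb R) setT (fun l => Phi l -
         cintegral (leb R) `[0, N%:R] (fun t => expi (- (l * t)) * phi t)))
      @ \oo --> 0%E].

(* For phi in L2([0, +oo[) the transform exists and is unique up to a null
   set; a representative is picked. *)
Definition fourier (R : realType) (phi : R -> R[i]) : R -> R[i] :=
  xget (fun=> 0) [set Phi | is_fourier phi Phi].

Definition fourierT (R : realType) (T : R) (phi : R -> R[i]) (l : R) : R[i] :=
  cintegral (leb R) `[0, T] (fun t => phi t * expi (- (l * t))).

(* At l = 0, as at every zero of a denominator below, division is total; this
   affects a null set only. *)
Definition chi (R : realType) (n : nat) (tau l : R) : R[i] :=
  (1 - expi (- (l * tau))) ^+ n * (1 +i* l) ^+ n / (0 +i* l) ^+ n.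

Definition is_convolved (R : realType) (n : nat) (tau : R)
    (phi phit : R -> R[i]) : Prop :=
  L2on `[0, +oo[ phit /\
  \forall l \ae leb R, fourier phit l = chi n tau l * fourier phi l.

(* The operator W^tau, phi |-> phi_tau; the value is unique up to a null set. *)
Definition Wop (R : realType) (n : nat) (tau : R) (phi : R -> R[i]) : R -> R[i] :=
  xget (fun=> 0) [set phit | is_convolved n tau phi phit].

(* k-th coefficient of (\sum_(j >= 0) x^j)^n, which only depends on the series
   up to order k. *)
Definition dcoef (R : realType) (n k : nat) : R :=
  ((\sum_(j < k.+1) 'X^j : {poly R}) ^+ n)`_k.

Definition Dop (R : realType) (n : nat) (tau T : R) (a : R -> R[i]) (t : R) : R[i] :=
  \sum_(k < (Num.truncn ((T - t) / tau)).+1)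
     a (t + tau * k%:R) * (dcoef R n k)%:C.

Definition DAop (R : realType) (n : nat) (tau T : R) (a : R -> R[i])
    (psi : R -> R[i]) (t : R) : R[i] :=
  \sum_(k < (Num.truncn ((T - t) / tau)).+1) (dcoef R n k)%:C *
     cintegral (leb R) `[0, T - t - tau * k%:R]
       (fun u => a (u + t + tau * k%:R) * psi u).

Definition DAhatop (R : realType) (n : nat) (tau T : R) (a : R -> R[i])
    (psi : R -> R[i]) (t : R) : R[i] :=
  \sum_(k < (Num.truncn (t / tau)).+1) (dcoef R n k)%:C *
     cintegral (leb R) `[0, t - tau * k%:R]
       (fun u => a (T - t + u + tau * k%:R) * psi u).

Definition DAWnorm2 (R : realType) (n : nat) (tau T : R) (a phi : R -> R[i]) : \bar R :=
  L2sq (leb R) `[0, T] (DAop n tau T a (Wop n tau phi)).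

Definition DAhatWnorm2 (R : realType) (n : nat) (tau T : R) (a phi : R -> R[i]) : \bar R :=
  L2sq (leb R) `[0, T] (DAhatop n tau T a (Wop n tau phi)).

Definition rchar (R : realType) (n : nat) (tau T : R) (a phi : R -> R[i])
    (l : R) : R[i] :=
  cintegral (leb R) `[0, T]
    (fun t => DAop n tau T a (Wop n tau phi) t * expi (t * l)).

Definition Achar (R : realType) (n : nat) (tau T : R) (a : R -> R[i]) (l : R) : R[i] :=
  cintegral (leb R) `[0, T] (fun t => Dop n tau T a t * expi (t * l)).

Definition spectral_density (R : realType) (f : R -> R) : Prop :=
  [/\ measurable_fun (setT : set (measurableTypeR R)) f,
      forall l, 0 <= f l &
      (leb R).-integrable setT (fun l => (f l)%:E)].

(* Squared norm of L2 with respect to the spectral measure (2 pi)^-1 f(l) dl. *)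
Definition spnorm2 (R : realType) (f : R -> R) (g : R -> R[i]) : \bar R :=
  (\int[leb R]_l ((pi *+ 2)^-1 * f l * sqnormc (g l))%:E)%E.

Definition closed_span (R : realType) d (X : measurableType d)
    (q : (X -> R[i]) -> \bar R) (S : set (X -> R[i])) : set (X -> R[i]) :=
  [set Y | cmeasurable setT Y /\
     forall e : R, 0 < e ->
       exists m (c : 'I_m -> R[i]) (s : 'I_m -> X -> R[i]),
         (forall i, S (s i)) /\
         (q (fun x => Y x - \sum_(i < m) c i * s i x)%R < e%:E)%E].

(* Y is the stochastic integral of g: simultaneous L2-limit of linear
   combinations over pairs (integrand, value) taken in G, where the
   deterministic side is measured by q. *)
Definition is_stoch_integral (R : realType) d (X : measurableType d)
    (P : probability X R) (q : (R -> R[i]) -> \bar R)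
    (G : set ((R -> R[i]) * (X -> R[i])))
    (g : R -> R[i]) (Y : X -> R[i]) : Prop :=
  [/\ cmeasurable (X := measurableTypeR R) setT g, cmeasurable setT Y &
      forall e : R, 0 < e ->
        exists m (c : 'I_m -> R[i]) (p : 'I_m -> (R -> R[i]) * (X -> R[i])),
          [/\ forall i, G (p i),
              (q (fun x => g x - \sum_(i < m) c i * (p i).1 x)%R < e%:E)%E &
              (L2sq P setT
                 (fun w => Y w - \sum_(i < m) c i * (p i).2 w)%R < e%:E)%E]].

Definition incr (R : realType) (X : Type) (n : nat) (xi : R -> X -> R[i])
    (t tau : R) (w : X) : R[i] :=
  \sum_(l < n.+1) (-1) ^+ l * 'C(n, l)%:R * xi (t - l%:R * tau) w.

Definition stationary_increments (R : realType) d (X : measurableType d)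
    (P : probability X R) (n : nat) (xi : R -> X -> R[i]) : Prop :=
  [/\ forall t, cmeasurable setT (xi t),
      forall t tau, 0 < tau -> (L2sq P setT (incr n xi t tau) < +oo)%E,
      forall t tau, 0 < tau -> cintegral P setT (incr n xi t tau) = 0 &
      forall t tau1 tau2 t0 t0', 0 < tau1 -> 0 < tau2 ->
        cintegral P setT
          (fun w => incr n xi (t0 + t) tau1 w * (incr n xi t0 tau2 w)^*) =
        cintegral P setT
          (fun w => incr n xi (t0' + t) tau1 w * (incr n xi t0' tau2 w)^*)].

(* Orthogonal random measure whose structure measure is (2 pi)^-1 f(l) dl. *)
Definition orthogonal_measure (R : realType) d (X : measurableType d)
    (P : probability X R) (f : R -> R) (Z : set R -> X -> R[i]) : Prop :=
  [/\ forall A : set (measurableTypeR R), measurable A -> cmeasurable setT (Z A),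
      forall A : set (measurableTypeR R), measurable A ->
        (L2sq P setT (Z A) < +oo)%E &
      forall A B : set (measurableTypeR R), measurable A -> measurable B ->
        cintegral P setT (fun w => Z A w * (Z B w)^*) =
        ((pi *+ 2)^-1 * \int[leb R]_(l in A `&` B) f l)%:C].

Definition has_spectral_density (R : realType) d (X : measurableType d)
    (P : probability X R) (n : nat) (xi : R -> X -> R[i]) (f : R -> R) : Prop :=
  stationary_increments P n xi /\
  exists2 Z : set R -> X -> R[i], orthogonal_measure P f Z &
    forall t tau, 0 < tau ->
      is_stoch_integral P (spnorm2 f)
        [set p | exists2 A : set (measurableTypeR R), measurable A &
                   p = ((fun x => (\1_A x)%:C), Z A)]
        (fun l => expi (t * l) * chi n tau l) (incr n xi t tau).

Definition Hxi (R : realType) d (X : measurableType d) (P : probability X R)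
    (n : nat) (xi : R -> X -> R[i]) (z : R) : set (X -> R[i]) :=
  closed_span (L2sq P setT)
    [set Y | exists t tau, [/\ t <= z, 0 < tau & Y = incr n xi t tau]].

Definition Heta (R : realType) d (X : measurableType d) (P : probability X R)
    (eta : R -> X -> R[i]) (z : R) : set (X -> R[i]) :=
  closed_span (L2sq P setT)
    [set Y | exists s t, [/\ s <= t, t <= z & Y = (fun w => eta t w - eta s w)]].

Definition orthogonal_increments (R : realType) d (X : measurableType d)
    (P : probability X R) (eta : R -> X -> R[i]) : Prop :=
  [/\ forall t, cmeasurable setT (eta t),
      forall s t, L2sq P setT (fun w => eta t w - eta s w) = (`|t - s|)%:E &
      forall s1 t1 s2 t2, s1 <= t1 -> t1 <= s2 -> s2 <= t2 ->
        cintegral P setT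
          (fun w => (eta t2 w - eta s2 w) * (eta t1 w - eta s1 w)^*) = 0].

(* incr n xi t sigma = \int_(-oo, t] phi_sigma(t - s) d eta(s), for all t and
   all sigma > 0; phi_sigma vanishes on the negative half-line. *)
Definition moving_average (R : realType) d (X : measurableType d)
    (P : probability X R) (n : nat) (xi eta : R -> X -> R[i])
    (phi : R -> R[i]) : Prop :=
  forall t sigma, 0 < sigma ->
    is_stoch_integral P (L2sq (leb R) setT)
      [set p | exists x y, x <= y /\
         p = ((fun s => (\1_(`]x, y]%classic : set R) s)%:C),
              (fun w => eta y w - eta x w))]
      (fun s => Wop n sigma phi (t - s)) (incr n xi t sigma).

Definition one_sided_moving_average (R : realType) (n : nat) (f : R -> R)
    (phi : R -> R[i]) : Prop :=
  forall (d : measure_display) (X : measurableType d) (P : probability X R)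
         (xi : R -> X -> R[i]),
    has_spectral_density P n xi f ->
    exists eta : R -> X -> R[i],
      orthogonal_increments P eta /\ moving_average P n xi eta phi.

Definition canonical_factorization (R : realType) (n : nat) (f : R -> R)
    (phi : R -> R[i]) : Prop :=
  [/\ spectral_density f, L2on `[0, +oo[ phi,
      (\forall l \ae leb R, f l = sqnormc (fourier phi l)) &
      forall (d : measure_display) (X : measurableType d) (P : probability X R)
             (xi : R -> X -> R[i]),
        has_spectral_density P n xi f ->
        exists eta : R -> X -> R[i],
          [/\ orthogonal_increments P eta,
              forall z, Hxi P n xi z = Heta P eta z &
              moving_average P n xi eta phi]].

Definition admits_canonical (R : realType) (n : nat) (f : R -> R) : Prop :=
  exists phi, canonical_factorization n f phi.

Definition mse (R : realType) (n : nat) (tau T : R) (a : R -> R[i])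
    (h : R -> R[i]) (f : R -> R) : \bar R :=
  (\int[leb R]_l ((pi *+ 2)^-1 * (sqnormc (Achar n tau T a l - h l) *
                   sqnormc (chi n tau l) * f l))%:E)%E.

Definition canon (R : realType) (n : nat) (f : R -> R) : R -> R[i] :=
  xget (fun=> 0) [set phi | canonical_factorization n f phi].

(* The canonical function of f is unique up to a unimodular constant factor,
   and the characteristic does not depend on that factor. *)
Definition hopt (R : realType) (n : nat) (tau T : R) (a : R -> R[i])
    (f : R -> R) (l : R) : R[i] :=
  Achar n tau T a l -
  rchar n tau T a (canon n f) l / (chi n tau l * fourier (canon n f) l).

Definition least_favorable (R : realType) (n : nat) (tau T : R) (a : R -> R[i])
    (D : set (R -> R)) (f0 : R -> R) : Prop :=
  [/\ D f0, admits_canonical n f0 &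
      forall f, D f -> admits_canonical n f ->
        (mse n tau T a (hopt n tau T a f) f <=
         mse n tau T a (hopt n tau T a f0) f0)%E].

Definition L20minus (R : realType) (n : nat) (tau : R) (f : R -> R) :
    set (R -> R[i]) :=
  closed_span (X := measurableTypeR R) (spnorm2 f)
    [set y | exists2 g : R -> R[i], cintegrable (leb R) `[0, +oo[ g &
       y = (fun l => chi n tau l *
              cintegral (leb R) `[0, +oo[ (fun t => g t * expi (- (l * t))))].

Definition Hclass (R : realType) (n : nat) (tau : R) (D : set (R -> R)) :
    set (R -> R[i]) :=
  [set h | forall f, D f -> L20minus n tau f (fun l => h l * chi n tau l)].

Definition worst_mse (R : realType) (n : nat) (tau T : R) (a : R -> R[i])
    (D : set (R -> R)) (h : R -> R[i]) : \bar R :=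
  ereal_sup [set mse n tau T a h f | f in D].

Definition minimax_robust (R : realType) (n : nat) (tau T : R) (a : R -> R[i])
    (D : set (R -> R)) (h0 : R -> R[i]) : Prop :=
  Hclass n tau D h0 /\
  forall h, Hclass n tau D h ->
    (worst_mse n tau T a D h0 <= worst_mse n tau T a D h)%E.

Definition Dvu (R : realType) (v u : R -> R) (P0 : R) : set (R -> R) :=
  [set f | [/\ spectral_density f,
               (\forall l \ae leb R, v l <= f l <= u l) &
               (\int[leb R]_l (f l)%:E = (2 * pi * P0)%:E)%E]].

Definition densT (R : realType) (T : R) (phi : R -> R[i]) (l : R) : R :=
  sqnormc (fourierT T phi l).

Definition solves_E1 (R : realType) (n : nat) (tau T : R) (a phi : R -> R[i]) : Prop :=
  exists alpha : R[i], \forall t \ae leb R, `[0, T]%classic t ->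
    DAop n tau T a (Wop n tau phi) t = alpha * (phi t)^*.

Definition solves_E2 (R : realType) (n : nat) (tau T : R) (a phi : R -> R[i]) : Prop :=
  exists beta : R[i], \forall t \ae leb R, `[0, T]%classic t ->
    DAhatop n tau T a (Wop n tau phi) t = beta * (phi t)^*.

Definition formF (R : realType) (n : nat) (tau T : R) (a : R -> R[i])
    (v u : R -> R) (c : R[i]) (phi : R -> R[i]) (l : R) : R :=
  Num.max (v l) (Num.min (u l) (sqnormc (c * rchar n tau T a phi l))).

Definition Sset (R : realType) (n : nat) (tau T : R) (a : R -> R[i])
    (v u : R -> R) (P0 : R) : set (R -> R[i]) :=
  [set phi | [/\ L2on `[0, T] phi,
                 solves_E1 n tau T a phi \/ solves_E2 n tau T a phi,
                 L2sq (leb R) `[0, T] phi = P0%:E,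
                 (\forall l \ae leb R, v l <= densT T phi l <= u l) &
                 canonical_factorization n (densT T phi) phi]].

Definition SFset (R : realType) (n : nat) (tau T : R) (a : R -> R[i])
    (v u : R -> R) (P0 : R) : set (R -> R[i]) :=
  [set phi | [/\ L2on `[0, T] phi, L2sq (leb R) `[0, T] phi = P0%:E &
                 exists c, canonical_factorization n (formF n tau T a v u c phi) phi]].

(* nu * P0 and nup * P0 are the suprema of the squared norm over the two sets,
   that is, the maxima when these are attained; -oo for an empty set. *)
Definition nu (R : realType) (n : nat) (tau T : R) (a : R -> R[i])
    (v u : R -> R) (P0 : R) : \bar R :=
  ((P0^-1)%:E * ereal_sup [set DAWnorm2 n tau T a phi
                          | phi in Sset n tau T a v u P0])%E.

Definition nup (R : realType) (n : nat) (tau T : R) (a : R -> R[i])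
    (v u : R -> R) (P0 : R) : \bar R :=
  ((P0^-1)%:E * ereal_sup [set DAWnorm2 n tau T a phi
                          | phi in SFset n tau T a v u P0])%E.

Definition extremal (R : realType) (n : nat) (tau T : R) (a : R -> R[i])
    (D : set (R -> R)) (phi0 : R -> R[i]) : Prop :=
  [/\ L2on `[0, T] phi0, D (densT T phi0) &
      forall phi, L2on `[0, T] phi -> D (densT T phi) ->
        (DAWnorm2 n tau T a phi <= DAWnorm2 n tau T a phi0)%E].

Definition determined (R : realType) (n : nat) (tau T : R) (a : R -> R[i])
    (v u : R -> R) (P0 : R) (c : R[i]) (phi0 : R -> R[i]) : Prop :=
  [/\ canonical_factorization n (formF n tau T a v u c phi0) phi0,
      extremal n tau T a (Dvu v u P0) phi0 &
      L2sq (leb R) `[0, T] phi0 = P0%:E].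

(* Main.v *)
Require Import Defs.
From HB Require Import structures.
From mathcomp Require Import all_boot all_order all_algebra.
From mathcomp Require Import all_classical all_reals all_analysis.
From mathcomp Require Import complex.
From mathcomp Require Import measurable_realfun.
From mathcomp Require Import ring lra.

(** Write Phi for the Fourier transform of a canonical function phi of f and r for the characteristic
    of D A W phi. Since e^{itl} chi_s Phi, t <= 0 < s, spans the Hardy space H^2 (this is the equality
    of the pasts of xi and eta), Phi has no zeros up to a null set. For any phi' with |Phi'|^2 = f' and
    characteristic r', the error A chi Phi' - r Phi' / Phi of the prediction optimal for f, computed
    under f', is orthogonal to r'; hence int |r / Phi|^2 f' >= int |r'|^2, with equality only if
    r Phi' / Phi = r'. In particular the optimal characteristic does not depend on the choice of phi.
    Conversely, if f is of the clipped form (F), then |r / Phi|^2 is constant where v < f < u, larger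
    where f = u and smaller where f = v, so that int |r / Phi|^2 f' <= int |r|^2 for every f' in the
    class. Thus every density of the form (F) is a saddle point, hence least favorable, and in case (i)
    the equality case identifies the characteristic of phi0 with that of a density of the form (F). *)

Set Implicit Arguments.
Unset Strict Implicit.
Unset Printing Implicit Defensive.

Import Order.TTheory GRing.Theory Num.Theory.
Import numFieldNormedType.Exports.

Local Open Scope classical_set_scope.
Local Open Scope ring_scope.
Local Open Scope complex_scope.
(* Reopened so that _^* denotes Num.conj, as in the definitions it is compared with. *)
Local Open Scope ring_scope.

(** [fourier], [Wop] and [canon] are choices with default value [0], so nothing can be read off them
    before the default is excluded. Positive total power does it for [fourier]. For [Wop], a process
    with the given density and nonvanishing increments is constructed: its moving average cannot
    have the kernel [0]. The quotient [Phi' / Phi] is not known to be causal. The prediction error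
    is therefore tested only against functions carrying a factor [Phi], which cancels the
    denominator and leaves products of causal transforms; [wH1] records just the vanishing of their
    integrals. Plancherel's theorem and the isometry of the stochastic integral are one argument: a
    Gram identity on intervals, extended by simultaneous approximation. On the Fourier side that
    identity is the integral of [(1 - cos (l x)) / l^2]. The two conditions on [D a] enter
    separately: integrability makes [Achar] bounded, and the weight [t] makes [D A psi]
    square-integrable, by Tonelli's theorem on a triangle. The competitors in the extremum problem
    of (ii) are arbitrary factors of densities of the class, so the comparison is proved for factors
    that need not be canonical. *)

(** * Squared modulus, conjugation and phases of complex numbers *)

Section ComplexNumbers.
Context {R : realType}.
Implicit Types z w : R[i].

Lemma sqnormcE z : sqnormc z = complex.Re z ^+ 2 + complex.Im z ^+ 2.
Proof.
case: z => x y; rewrite /sqnormc /= sqr_sqrtr // addr_ge0 ?sqr_ge0 //.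
Qed.

Lemma sqnormc_ge0 z : 0 <= sqnormc z. Proof. exact: sqr_ge0. Qed.

Lemma sqnormc0 : sqnormc (0 : R[i]) = 0.
Proof. by rewrite sqnormcE /= expr0n addr0. Qed.

Lemma sqnormc1 : sqnormc (1 : R[i]) = 1.
Proof. by rewrite sqnormcE /= expr0n expr1n addr0. Qed.

Lemma sqnormc_eq0 z : (sqnormc z == 0) = (z == 0).
Proof.
case: z => x y; rewrite sqnormcE /= paddr_eq0 ?sqr_ge0 // !sqrf_eq0.
by rewrite eq_complex.
Qed.

Lemma sqnormcM z w : sqnormc (z * w) = sqnormc z * sqnormc w.
Proof. by rewrite !sqnormcE; case: z w => a b [c d] /=; ring. Qed.

Lemma sqnormc_conj z : sqnormc z^* = sqnormc z.
Proof. by rewrite !sqnormcE; case: z => a b /=; ring. Qed.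

Lemma sqnormcN z : sqnormc (- z) = sqnormc z.
Proof. by rewrite !sqnormcE; case: z => a b /=; ring. Qed.

Lemma sqnormc_real (x : R) : sqnormc x%:C = x ^+ 2.
Proof. by rewrite sqnormcE /= expr0n addr0. Qed.

Lemma sqnormcX z n : sqnormc (z ^+ n) = sqnormc z ^+ n.
Proof. by elim: n => [|n IH]; rewrite ?expr0 ?sqnormc1 // !exprS sqnormcM IH. Qed.

Lemma sqnormcV z : sqnormc z^-1 = (sqnormc z)^-1.
Proof.
have [->|z0] := eqVneq z 0; first by rewrite invr0 sqnormc0 invr0.
have sz : sqnormc z != 0 by rewrite sqnormc_eq0.
by apply: (mulfI sz); rewrite -sqnormcM !mulfV // sqnormc1.
Qed.

Lemma sqnormcD_le z w : sqnormc (z + w) <= 2 * sqnormc z + 2 * sqnormc w.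
Proof.
rewrite !sqnormcE; case: z w => a b [c d] /=.
have := sqr_ge0 (a - c); have := sqr_ge0 (b - d); rewrite !expr2; lra.
Qed.

Lemma mulc_conj z : z * z^* = (sqnormc z)%:C.
Proof.
rewrite sqnormcE; case: z => a b; apply/eqP; rewrite eq_complex /=.
by apply/andP; split; apply/eqP => /=; ring.
Qed.

Lemma conjcM z w : (z * w)^* = z^* * w^*.
Proof. exact: rmorphM. Qed.

Lemma conjcB z w : (z - w)^* = z^* - w^*.
Proof. exact: rmorphB. Qed.

Lemma conjcV z : (z^-1)^* = (z^*)^-1.
Proof. exact: fmorphV. Qed.

Lemma complex_ext z w :
  complex.Re z = complex.Re w -> complex.Im z = complex.Im w -> z = w.
Proof. by case: z w => a b [c d] /= -> ->. Qed.

Lemma cReM z w : complex.Re (z * w) =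
  complex.Re z * complex.Re w - complex.Im z * complex.Im w.
Proof. by case: z w => a b [c d]. Qed.

Lemma cImM z w : complex.Im (z * w) =
  complex.Re z * complex.Im w + complex.Im z * complex.Re w.
Proof. by case: z w => a b [c d]. Qed.

Lemma cReD z w : complex.Re (z + w) = complex.Re z + complex.Re w.
Proof. by case: z w => a b [c d]. Qed.

Lemma cImD z w : complex.Im (z + w) = complex.Im z + complex.Im w.
Proof. by case: z w => a b [c d]. Qed.

Lemma cRe_conj z : complex.Re z^* = complex.Re z. Proof. by case: z. Qed.

Lemma cIm_conj z : complex.Im z^* = - complex.Im z. Proof. by case: z. Qed.

Lemma cReN z : complex.Re (- z) = - complex.Re z. Proof. by case: z. Qed.

Lemma cImN z : complex.Im (- z) = - complex.Im z. Proof. by case: z. Qed.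

Lemma conjc_ofreal (x : R) : (x%:C)^* = x%:C :> R[i].
Proof. by apply: complex_ext => //=; rewrite oppr0. Qed.

Lemma Re_sq_le z : complex.Re z ^+ 2 <= sqnormc z.
Proof. by rewrite sqnormcE lerDl sqr_ge0. Qed.

Lemma Im_sq_le z : complex.Im z ^+ 2 <= sqnormc z.
Proof. by rewrite sqnormcE lerDr sqr_ge0. Qed.

Lemma normc_sqrt z : ComplexField.Normc.normc z = Num.sqrt (sqnormc z).
Proof. by rewrite /sqnormc sqrtr_sqr ger0_norm //; case: z => a b /=; rewrite sqrtr_ge0. Qed.

Lemma Re_le_normc z : `|complex.Re z| <= ComplexField.Normc.normc z.
Proof. by rewrite normc_sqrt -sqrtr_sqr ler_sqrt ?sqnormc_ge0 ?Re_sq_le. Qed.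

Lemma Im_le_normc z : `|complex.Im z| <= ComplexField.Normc.normc z.
Proof. by rewrite normc_sqrt -sqrtr_sqr ler_sqrt ?sqnormc_ge0 ?Im_sq_le. Qed.

Lemma normc_le_add z :
  ComplexField.Normc.normc z <= `|complex.Re z| + `|complex.Im z|.
Proof.
rewrite normc_sqrt -[leRHS]ger0_norm ?addr_ge0 // -sqrtr_sqr ler_sqrt ?sqr_ge0 //.
rewrite sqnormcE -(real_normK (num_real (complex.Re z))) -(real_normK (num_real (complex.Im z))).
by rewrite sqrrD lerD2r lerDl mulrn_wge0 // mulr_ge0.
Qed.

Lemma normcM z w : ComplexField.Normc.normc (z * w) =
  ComplexField.Normc.normc z * ComplexField.Normc.normc w.
Proof. by rewrite !normc_sqrt sqnormcM sqrtrM ?sqnormc_ge0. Qed.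

Lemma normc_ge0 z : 0 <= ComplexField.Normc.normc z.
Proof. by rewrite normc_sqrt sqrtr_ge0. Qed.

Lemma expi0 : expi (0 : R) = 1.
Proof. by rewrite /expi cos0 sin0. Qed.

Lemma expiD (x y : R) : expi (x + y) = expi x * expi y.
Proof.
apply: complex_ext; rewrite ?cReM ?cImM /expi /= ?cosD ?sinD //; ring.
Qed.

Lemma expiN (x : R) : expi (- x) = (expi x)^*.
Proof. by rewrite /expi cosN sinN. Qed.

Lemma sqnormc_expi (x : R) : sqnormc (expi x) = 1.
Proof. by rewrite sqnormcE /= cos2Dsin2. Qed.

Lemma normc_expi (x : R) : ComplexField.Normc.normc (expi x) = 1.
Proof. by rewrite normc_sqrt sqnormc_expi sqrtr1. Qed.

Lemma expi_neq0 (x : R) : expi x != 0.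
Proof. by rewrite -sqnormc_eq0 sqnormc_expi oner_neq0. Qed.

Lemma expiX (x : R) k : expi x ^+ k = expi (x * k%:R).
Proof.
elim: k => [|k IH]; first by rewrite mulr0 expi0.
by rewrite exprS IH -expiD; congr expi; rewrite mulrS mulrDr mulr1.
Qed.

End ComplexNumbers.

(** * Measurability of complex functions and null sets *)

Section ComplexMeasurability.
Context {R : realType} d {X : measurableType d}.
Implicit Types (g h : X -> R[i]) (D : set X).

Local Notation cm D g := (cmeasurable D g).

Lemma cmeasurable_cst D (z : R[i]) : cm D (fun=> z).
Proof. by split; exact: measurable_cst. Qed.

Lemma cmeasurableD D g h : cm D g -> cm D h -> cm D (fun x => g x + h x).
Proof.
move=> [g1 g2] [h1 h2]; split.
- by under eq_fun do rewrite cReD; exact: measurable_funD.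
- by under eq_fun do rewrite cImD; exact: measurable_funD.
Qed.

Lemma measurable_funN_real D (f : X -> R) : measurable_fun D f -> measurable_fun D (fun x => - f x).
Proof. by move=> mf; apply: measurableT_comp => //; exact: measurable_oppr. Qed.

Lemma cmeasurableN D g : cm D g -> cm D (fun x => - g x).
Proof.
move=> [g1 g2]; split.
- by under eq_fun do rewrite cReN; exact: measurable_funN_real.
- by under eq_fun do rewrite cImN; exact: measurable_funN_real.
Qed.

Lemma cmeasurableB D g h : cm D g -> cm D h -> cm D (fun x => g x - h x).
Proof. by move=> mg mh; apply: cmeasurableD => //; exact: cmeasurableN. Qed.

Lemma cmeasurableM D g h : cm D g -> cm D h -> cm D (fun x => g x * h x).
Proof.
move=> [g1 g2] [h1 h2]; split.
- by under eq_fun do rewrite cReM; apply: measurable_funB; exact: measurable_funM.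
- by under eq_fun do rewrite cImM; apply: measurable_funD; exact: measurable_funM.
Qed.

Lemma cmeasurable_conj D g : cm D g -> cm D (fun x => (g x)^*).
Proof.
move=> [g1 g2]; split.
- by under eq_fun do rewrite cRe_conj.
- by under eq_fun do rewrite cIm_conj; exact: measurable_funN_real.
Qed.

Lemma cmeasurable_sum D m (g : 'I_m -> X -> R[i]) : (forall i, cm D (g i)) ->
  cm D (fun x => \sum_(i < m) g i x).
Proof.
elim: m g => [|m IH] g mg.
  by under eq_fun do rewrite big_ord0; exact: cmeasurable_cst.
under eq_fun do rewrite big_ord_recr /=.
by apply: cmeasurableD => //; apply: IH => i.
Qed.

Lemma cmeasurableX D g k : cm D g -> cm D (fun x => g x ^+ k).
Proof.
move=> mg; elim: k => [|k IH].
  by under eq_fun do rewrite expr0; exact: cmeasurable_cst.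
by under eq_fun do rewrite exprS; exact: cmeasurableM.
Qed.

Lemma cmeasurable_real D (f : X -> R) : measurable_fun D f -> cm D (fun x => (f x)%:C).
Proof. by move=> mf; split => //=; exact: measurable_cst. Qed.

Lemma measurable_sqnormc D g : cm D g -> measurable_fun D (fun x => sqnormc (g x)).
Proof.
move=> [g1 g2]; under eq_fun do rewrite sqnormcE.
by apply: measurable_funD; exact: measurable_funX.
Qed.

Lemma measurable_normc D g : cm D g ->
  measurable_fun D (fun x => ComplexField.Normc.normc (g x)).
Proof.
move=> mg; under eq_fun do rewrite normc_sqrt.
apply: measurableT_comp; last exact: measurable_sqnormc.
by apply: continuous_measurable_fun; exact: sqrt_continuous.
Qed.

Lemma cmeasurable_comp d' (Y : measurableType d') (u : Y -> X) g :
  measurable_fun setT u -> cm setT g -> cm setT (fun y => g (u y)).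
Proof.
by move=> mu [g1 g2]; split; [exact: (measurableT_comp g1)|exact: (measurableT_comp g2)].
Qed.

Lemma cmeasurable_expi D (f : X -> R) : measurable_fun D f ->
  cm D (fun x => expi (f x)).
Proof.
move=> mf; split => /=; apply: measurableT_comp => //;
apply: continuous_measurable_fun.
  exact: continuous_cos.
exact: continuous_sin.
Qed.

Lemma cmeasurable_if (b : X -> bool) g h : measurable_fun setT b ->
  cm setT g -> cm setT h -> cm setT (fun x => if b x then g x else h x).
Proof.
move=> mb [g1 g2] [h1 h2]; split.
- by under eq_fun do rewrite fun_if; apply: measurable_fun_ifT.
- by under eq_fun do rewrite fun_if; apply: measurable_fun_ifT.
Qed.

End ComplexMeasurability.

Section AlmostEverywhere.
Context {R : realType} d {X : measurableType d} (m : {measure set X -> \bar R}).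
Implicit Types P Q S : set X.

Lemma ae_mono P Q : (forall x, P x -> Q x) ->
  (\forall x \ae m, P x) -> \forall x \ae m, Q x.
Proof. by move=> H; apply: filterS. Qed.

Lemma ae_mono2 P Q S : (forall x, P x -> Q x -> S x) ->
  (\forall x \ae m, P x) -> (\forall x \ae m, Q x) -> \forall x \ae m, S x.
Proof. by move=> H; exact: filterS2. Qed.

End AlmostEverywhere.

(** * Integrals and L2 spaces of complex functions *)

Section ComplexIntegral.
Context {R : realType} d {X : measurableType d}.
Variable m : {measure set X -> \bar R}.
Implicit Types (g h : X -> R[i]).

Local Notation cm := (cmeasurable setT).
Local Notation ci := (cintegral m setT).
Local Notation cig := (cintegrable m setT).

Lemma cintegrable_cmeasurable g : cig g -> cm g.
Proof.
by move=> [/measurable_int /measurable_EFinP ? /measurable_int /measurable_EFinP ?].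
Qed.

Lemma cintegrable_le g (h : X -> R) : cm g -> m.-integrable setT (fun x => (h x)%:E) ->
  (forall x, ComplexField.Normc.normc (g x) <= h x) -> cig g.
Proof.
move=> [g1 g2] ih gh; split; apply: (le_integrable _ _ _ ih) => //.
- exact/measurable_EFinP.
- move=> x _ /=; rewrite lee_fin (le_trans (Re_le_normc _)) // (le_trans (gh x)) //.
  exact: ler_norm.
- exact/measurable_EFinP.
- move=> x _ /=; rewrite lee_fin (le_trans (Im_le_normc _)) // (le_trans (gh x)) //.
  exact: ler_norm.
Qed.

Lemma cintegrable_normc g : cig g ->
  m.-integrable setT (fun x => (ComplexField.Normc.normc (g x))%:E).
Proof.
move=> ig; have mg := cintegrable_cmeasurable ig; case: ig => i1 i2.
apply: (le_integrable _ _ _ (integrableD _ (integrable_abse i1) (integrable_abse i2))) => //.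
  by apply/measurable_EFinP; exact: measurable_normc.
move=> x _ /=; rewrite lee_fin ger0_norm ?normc_ge0 // (le_trans (normc_le_add _)) //.
exact: ler_norm.
Qed.

Lemma cintegrableP g : cm g ->
  (\int[m]_x (ComplexField.Normc.normc (g x))%:E < +oo)%E -> cig g.
Proof.
move=> mg ig; apply: (cintegrable_le (h := fun x => ComplexField.Normc.normc (g x))) => //.
apply/integrableP; split; first by apply/measurable_EFinP; exact: measurable_normc.
by under eq_integral do rewrite gee0_abs ?lee_fin ?normc_ge0 //.
Qed.

Lemma cintegrableD g h : cig g -> cig h -> cig (fun x => g x + h x).
Proof.
move=> [g1 g2] [h1 h2]; split.
- by under eq_fun do rewrite cReD EFinD; exact: integrableD.
- by under eq_fun do rewrite cImD EFinD; exact: integrableD.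
Qed.

Lemma cintegrableZ (z : R[i]) g : cig g -> cig (fun x => z * g x).
Proof.
move=> ig; apply: (cintegrable_le (h := fun x => ComplexField.Normc.normc z *
  ComplexField.Normc.normc (g x))).
- by apply: cmeasurableM; [exact: cmeasurable_cst|exact: cintegrable_cmeasurable].
- by under eq_fun do rewrite EFinM; apply: integrableZl => //; exact: cintegrable_normc.
- by move=> x; rewrite normcM.
Qed.

Lemma cintegrableN g : cig g -> cig (fun x => - g x).
Proof. by move=> /(cintegrableZ (-1)); under eq_fun do rewrite mulN1r. Qed.

Lemma cintegrable0 : cig (fun=> 0).
Proof. by split => /=; exact: integrable0. Qed.

Lemma cintegrable_sum k (g : 'I_k -> X -> R[i]) : (forall i, cig (g i)) ->
  cig (fun x => \sum_(i < k) g i x).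
Proof.
elim: k g => [|k IH] g ig.
  by under eq_fun do rewrite big_ord0; exact: cintegrable0.
by under eq_fun do rewrite big_ord_recr /=; apply: cintegrableD => //; apply: IH.
Qed.

Lemma cintegral0 : ci (fun=> 0) = 0.
Proof. by rewrite /cintegral /= !Rintegral_cst // !mul0r. Qed.

Lemma cintegralD g h : cig g -> cig h -> ci (fun x => g x + h x) = ci g + ci h.
Proof.
move=> [g1 g2] [h1 h2]; apply: complex_ext; rewrite ?[RHS]cReD ?[RHS]cImD /cintegral /=.
- by under eq_Rintegral do rewrite cReD; rewrite RintegralD.
- by under eq_Rintegral do rewrite cImD; rewrite RintegralD.
Qed.

Lemma cintegralZ (z : R[i]) g : cig g -> ci (fun x => z * g x) = z * ci g.
Proof.
move=> [g1 g2]; apply: complex_ext; rewrite ?[RHS]cReM ?[RHS]cImM /cintegral /=.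
- under eq_Rintegral do rewrite cReM; rewrite RintegralB ?RintegralZl //.
    exact: (integrableZl _ (complex.Re z) g1).
  exact: (integrableZl _ (complex.Im z) g2).
- under eq_Rintegral do rewrite cImM; rewrite RintegralD ?RintegralZl //.
    exact: (integrableZl _ (complex.Re z) g2).
  exact: (integrableZl _ (complex.Im z) g1).
Qed.

Lemma cintegralN g : cig g -> ci (fun x => - g x) = - ci g.
Proof.
move=> ig; rewrite -mulN1r -cintegralZ //.
by congr cintegral; apply/funext => x; rewrite mulN1r.
Qed.

Lemma cintegralB g h : cig g -> cig h -> ci (fun x => g x - h x) = ci g - ci h.
Proof. by move=> ig ih; rewrite cintegralD ?cintegralN //; exact: cintegrableN. Qed.

Lemma cintegral_sum k (g : 'I_k -> X -> R[i]) : (forall i, cig (g i)) ->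
  ci (fun x => \sum_(i < k) g i x) = \sum_(i < k) ci (g i).
Proof.
elim: k g => [|k IH] g ig.
  rewrite big_ord0; transitivity (ci (fun=> 0)); last exact: cintegral0.
  by congr cintegral; apply/funext => x; rewrite big_ord0.
rewrite big_ord_recr /= -IH // -cintegralD //; last exact: cintegrable_sum.
by congr cintegral; apply/funext => x; rewrite big_ord_recr.
Qed.

Lemma cintegral_conj g : cig g -> ci (fun x => (g x)^*) = (ci g)^*.
Proof.
move=> [g1 g2]; apply: complex_ext; rewrite ?[RHS]cRe_conj ?[RHS]cIm_conj /cintegral /=.
  by under eq_Rintegral do rewrite cRe_conj.
under eq_Rintegral do rewrite cIm_conj -mulN1r.
by rewrite RintegralZl // mulN1r.
Qed.

Lemma ae_eq_cintegral g h : cm g -> cm h -> {ae m, forall x, g x = h x} -> ci g = ci h.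
Proof.
move=> [g1 g2] [h1 h2] gh; apply: complex_ext; rewrite /cintegral /= /Rintegral.
- congr fine; apply: ae_eq_integral => //; try exact/measurable_EFinP.
  by apply: filterS gh => x -> _.
- congr fine; apply: ae_eq_integral => //; try exact/measurable_EFinP.
  by apply: filterS gh => x -> _.
Qed.

Lemma ae_eq_cintegrable g h : cm h -> {ae m, forall x, g x = h x} -> cig g -> cig h.
Proof.
move=> mh gh ig; apply: cintegrableP => //.
have mg := cintegrable_cmeasurable ig.
have /integrableP[_] := cintegrable_normc ig.
rewrite (_ : integral _ _ _ = \int[m]_x (ComplexField.Normc.normc (h x))%:E)%E //.
apply: ge0_ae_eq_integral => //.
- by apply: measurableT_comp => //; apply/measurable_EFinP; exact: measurable_normc.
- by apply/measurable_EFinP; exact: measurable_normc.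
- by move=> x _; rewrite lee_fin normc_ge0.
- by apply: filterS gh => x -> _ /=; rewrite ger0_norm ?normc_ge0.
Qed.

Definition L2 g := cm g /\ (L2sq m setT g < +oo)%E.
(** The squared norm; it is faithful only under [L2], since [fine] sends an infinite value to [0].
    Square roots never enter: the triangle inequality is replaced by the bounds with factor two in
    [nrmD_le] and [nrmB_le], which is why errors are later split into quarters. *)
Definition nrm g : R := fine (L2sq m setT g).
Definition ip g h : R[i] := ci (fun x => g x * (h x)^*).

Lemma L2sq_ge0 D g : (0 <= L2sq m D g)%E.
Proof. by apply: integral_ge0 => x _; rewrite lee_fin sqnormc_ge0. Qed.

Lemma nrm_ge0 g : 0 <= nrm g.
Proof. exact/fine_ge0/L2sq_ge0. Qed.

Lemma L2sqE g : L2 g -> L2sq m setT g = (nrm g)%:E.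
Proof. by move=> [_ g2]; rewrite /nrm fineK // ge0_fin_numE ?L2sq_ge0. Qed.

Lemma L2_int g : L2 g -> m.-integrable setT (fun x => (sqnormc (g x))%:E).
Proof.
move=> [mg g2]; apply/integrableP; split.
  by apply/measurable_EFinP; exact: measurable_sqnormc.
by under eq_integral do rewrite gee0_abs ?lee_fin ?sqnormc_ge0 //.
Qed.

Lemma int_L2 g (h : X -> R) : cm g -> m.-integrable setT (fun x => (h x)%:E) ->
  (forall x, sqnormc (g x) <= h x) -> L2 g.
Proof.
move=> mg ih gh; split=> //.
have /integrableP[mh] := ih; apply: le_lt_trans.
apply: ge0_le_integral => //.
- by move=> x _; rewrite lee_fin sqnormc_ge0.
- by apply/measurable_EFinP; exact: measurable_sqnormc.
- exact: measurableT_comp.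
- by move=> x _ /=; rewrite lee_fin (le_trans (gh x)) // ler_norm.
Qed.

Lemma L2D g h : L2 g -> L2 h -> L2 (fun x => g x + h x).
Proof.
move=> g2 h2.
apply: (int_L2 (h := fun x => 2 * sqnormc (g x) + 2 * sqnormc (h x))).
- by apply: cmeasurableD; [case: g2|case: h2].
- under eq_fun do rewrite EFinD !EFinM.
  by apply: integrableD => //; apply: integrableZl => //; exact: L2_int.
- by move=> x; exact: sqnormcD_le.
Qed.

Lemma L2_mul_bounded (b : X -> R[i]) (B : R) g : cm b -> (forall x, sqnormc (b x) <= B) ->
  L2 g -> L2 (fun x => b x * g x).
Proof.
move=> mb bB g2; apply: (int_L2 (h := fun x => B * sqnormc (g x))).
- by apply: cmeasurableM => //; case: g2.
- by under eq_fun do rewrite EFinM; apply: integrableZl => //; exact: L2_int.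
- by move=> x; rewrite sqnormcM ler_wpM2r ?sqnormc_ge0.
Qed.

Lemma L2Z (z : R[i]) g : L2 g -> L2 (fun x => z * g x).
Proof. by apply: (@L2_mul_bounded (fun=> z) (sqnormc z)) => //; exact: cmeasurable_cst. Qed.

Lemma L2N g : L2 g -> L2 (fun x => - g x).
Proof. by move=> /(L2Z (-1)); under eq_fun do rewrite mulN1r. Qed.

Lemma L2B g h : L2 g -> L2 h -> L2 (fun x => g x - h x).
Proof. by move=> g2 h2; apply: L2D => //; exact: L2N. Qed.

Lemma L20 : L2 (fun=> 0).
Proof.
split; first exact: cmeasurable_cst.
by rewrite /L2sq; under eq_integral do rewrite sqnormc0; rewrite integral0.
Qed.

Lemma L2_sum k (g : 'I_k -> X -> R[i]) : (forall i, L2 (g i)) ->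
  L2 (fun x => \sum_(i < k) g i x).
Proof.
elim: k g => [|k IH] g ig.
  by under eq_fun do rewrite big_ord0; exact: L20.
by under eq_fun do rewrite big_ord_recr /=; apply: L2D => //; apply: IH.
Qed.

Lemma L2_conj g : L2 g -> L2 (fun x => (g x)^*).
Proof.
move=> [mg g2]; split; first exact: cmeasurable_conj.
by rewrite /L2sq; under eq_integral do rewrite sqnormc_conj.
Qed.

Lemma L2M_cintegrable g h : L2 g -> L2 h -> cig (fun x => g x * h x).
Proof.
move=> g2 h2.
apply: (cintegrable_le (h := fun x => sqnormc (g x) + sqnormc (h x))).
- by apply: cmeasurableM; [case: g2|case: h2].
- by under eq_fun do rewrite EFinD; apply: integrableD => //; exact: L2_int.
- move=> x; rewrite normcM /sqnormc.
  have := sqr_ge0 (ComplexField.Normc.normc (g x) - ComplexField.Normc.normc (h x)).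
  have := normc_ge0 (g x); have := normc_ge0 (h x); nra.
Qed.

Lemma ip_cintegrable g h : L2 g -> L2 h -> cig (fun x => g x * (h x)^*).
Proof. by move=> g2 h2; apply: L2M_cintegrable => //; exact: L2_conj. Qed.

Lemma ipDl g1 g2 h : L2 g1 -> L2 g2 -> L2 h ->
  ip (fun x => g1 x + g2 x) h = ip g1 h + ip g2 h.
Proof.
move=> ? ? ?; rewrite /ip -cintegralD; try exact: ip_cintegrable.
by congr cintegral; apply/funext => x; rewrite mulrDl.
Qed.

Lemma ipZl (z : R[i]) g h : L2 g -> L2 h -> ip (fun x => z * g x) h = z * ip g h.
Proof.
move=> ? ?; rewrite /ip -cintegralZ; last exact: ip_cintegrable.
by congr cintegral; apply/funext => x; rewrite mulrA.
Qed.

Lemma ip_sym g h : L2 g -> L2 h -> ip h g = (ip g h)^*.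
Proof.
move=> ? ?; rewrite /ip -cintegral_conj; last exact: ip_cintegrable.
by congr cintegral; apply/funext => x; rewrite conjcM conjCK mulrC.
Qed.

Lemma ipZr (z : R[i]) g h : L2 g -> L2 h -> ip g (fun x => z * h x) = z^* * ip g h.
Proof.
move=> g2 h2; rewrite ip_sym ?ipZl // ?conjcM; last exact: L2Z.
by rewrite -ip_sym.
Qed.

Lemma ipBl g1 g2 h : L2 g1 -> L2 g2 -> L2 h ->
  ip (fun x => g1 x - g2 x) h = ip g1 h - ip g2 h.
Proof.
move=> ? ? ?; rewrite /ip -cintegralB; try exact: ip_cintegrable.
by congr cintegral; apply/funext => x; rewrite mulrBl.
Qed.

Lemma ipBr g h1 h2 : L2 g -> L2 h1 -> L2 h2 ->
  ip g (fun x => h1 x - h2 x) = ip g h1 - ip g h2.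
Proof.
move=> ? ? ?; rewrite /ip -cintegralB; try exact: ip_cintegrable.
by congr cintegral; apply/funext => x; rewrite conjcB mulrBr.
Qed.

Lemma ip_suml k (g : 'I_k -> X -> R[i]) h : (forall i, L2 (g i)) -> L2 h ->
  ip (fun x => \sum_(i < k) g i x) h = \sum_(i < k) ip (g i) h.
Proof.
move=> ? ?; rewrite /ip -cintegral_sum => [|i]; last exact: ip_cintegrable.
by congr cintegral; apply/funext => x; rewrite mulr_suml.
Qed.

Lemma ip_sumr k g (h : 'I_k -> X -> R[i]) : L2 g -> (forall i, L2 (h i)) ->
  ip g (fun x => \sum_(i < k) h i x) = \sum_(i < k) ip g (h i).
Proof.
move=> ? ?; rewrite /ip -cintegral_sum => [|i]; last exact: ip_cintegrable.
by congr cintegral; apply/funext => x; rewrite rmorph_sum mulr_sumr.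
Qed.

Lemma ipgg g : ip g g = (nrm g)%:C.
Proof.
rewrite /ip; under [in cintegral _ _ _]eq_fun do rewrite mulc_conj.
by rewrite /cintegral /= Rintegral_cst // mul0r.
Qed.

Lemma nrm_conj g : nrm (fun x => (g x)^*) = nrm g.
Proof. by rewrite /nrm /L2sq; under eq_integral do rewrite sqnormc_conj. Qed.

Lemma nrmZ (z : R[i]) g : L2 g -> nrm (fun x => z * g x) = sqnormc z * nrm g.
Proof.
move=> g2; suff : (nrm (fun x => z * g x))%:C = (sqnormc z * nrm g)%:C by case.
rewrite -ipgg ipZl ?ipZr //; last exact: L2Z.
by rewrite mulrA mulc_conj ipgg -rmorphM.
Qed.

Lemma nrmB g h : L2 g -> L2 h ->
  nrm (fun x => g x - h x) = nrm g + nrm h - 2 * complex.Re (ip g h).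
Proof.
move=> g2 h2; have gh2 := L2B g2 h2.
suff -> : nrm (fun x => g x - h x) = complex.Re (ip (fun x => g x - h x) (fun x => g x - h x)).
  rewrite ipBl // !ipBr // (ip_sym g2 h2) !ipgg; case: (ip g h) => a b /=; ring.
by rewrite ipgg.
Qed.

Lemma nrmD_le g h : L2 g -> L2 h ->
  nrm (fun x => g x + h x) <= 2 * nrm g + 2 * nrm h.
Proof.
move=> g2 h2; have gh2 := L2D g2 h2.
have ig := L2_int g2; have ih := L2_int h2.
have ig2 : m.-integrable setT (EFin \o (fun x => 2 * sqnormc (g x))).
  by exact: (integrableZl _ 2 ig).
have ih2 : m.-integrable setT (EFin \o (fun x => 2 * sqnormc (h x))).
  by exact: (integrableZl _ 2 ih).
rewrite /nrm -!RintegralZl // -RintegralD //.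
apply: le_Rintegral => //; first exact: L2_int.
  by apply: eq_integrable (integrableD _ ig2 ih2).
by move=> x _; exact: sqnormcD_le.
Qed.

Lemma nrmB_le g h : L2 g -> L2 h ->
  nrm (fun x => g x - h x) <= 2 * nrm g + 2 * nrm h.
Proof.
move=> g2 h2; apply: le_trans (nrmD_le g2 (L2N h2)) _.
rewrite (_ : nrm (fun x => - h x) = nrm h) //.
by rewrite /nrm /L2sq; under eq_integral do rewrite sqnormcN.
Qed.

Lemma ip_CauchySchwarz g h : L2 g -> L2 h -> sqnormc (ip g h) <= nrm g * nrm h.
Proof.
move=> g2 h2.
have key (z : R[i]) : 0 <= nrm g + sqnormc z * nrm h - 2 * complex.Re (z^* * ip g h).
  have h2z := L2Z z h2.
  by have := nrm_ge0 (fun x => g x - z * h x); rewrite nrmB // nrmZ // ipZr.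
have h0 := nrm_ge0 h; have g0 := nrm_ge0 g.
have sq0 := sqnormc_ge0 (ip g h).
(* Among the multipliers [z] of [h] only the real multiples of [ip g h] matter; they leave a real
   quadratic polynomial in [t]. *)
have keyr (t : R) : 0 <= nrm g + t ^+ 2 * sqnormc (ip g h) * nrm h - 2 * t * sqnormc (ip g h).
  have := key (t%:C * ip g h); rewrite sqnormcM sqnormc_real conjcM.
  rewrite [X in complex.Re X](_ : _ = (t * sqnormc (ip g h))%:C) /=; first by lra.
  by rewrite conjc_ofreal rmorphM /= -mulc_conj; ring.
have [h00|hn0] := eqVneq (nrm h) 0.
  rewrite h00 mulr0 leNgt; apply/negP => sgt.
  (* For [nrm h = 0] the polynomial is affine in [t]; at this [t] it takes the value [-1]. Otherwise
     its minimizer [(nrm h)^-1] is used below. *)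
  have := keyr ((nrm g + 1) / (2 * sqnormc (ip g h))); rewrite h00 mulr0 addr0.
  rewrite [X in _ - X](_ : _ = nrm g + 1); first by lra.
  by field; rewrite gt_eqF.
have hp : 0 < nrm h by rewrite lt_def hn0.
have := keyr (nrm h)^-1.
rewrite [X in 0 <= X](_ : _ = (nrm g * nrm h - sqnormc (ip g h)) / nrm h); last by field.
by rewrite pmulr_lge0 ?invr_gt0 // subr_ge0.
Qed.

(** By Cauchy-Schwarz, [ip g h] differs from [ip k h = 0] by as little as [g] from [k]. This is how
    orthogonality, checked on a generating family, reaches the closed span. *)
Lemma ip_approx0 g h : L2 g -> L2 h ->
  (forall e : R, 0 < e -> exists2 k, L2 k & nrm (fun x => g x - k x) < e /\ ip k h = 0) ->
  ip g h = 0.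
Proof.
move=> g2 h2 H; apply/eqP; rewrite -sqnormc_eq0 eq_le sqnormc_ge0 andbT leNgt.
apply/negP => sgt.
have h0 := nrm_ge0 h; have hp : 0 < nrm h + 1 by lra.
have [k k2 [ke k0]] := H (sqnormc (ip g h) / (nrm h + 1)) (divr_gt0 sgt hp).
have := ip_CauchySchwarz (L2B g2 k2) h2.
rewrite ipBl // k0 subr0; apply/negP; rewrite -ltNge.
rewrite ltr_pdivlMr // in ke.
have := nrm_ge0 (fun x => g x - k x); nra.
Qed.

Lemma nrm_eq0_ae g : L2 g -> nrm g = 0 -> {ae m, forall x, g x = 0}.
Proof.
move=> g2 g0; have [mg _] := g2.
have mg2 : measurable_fun setT (fun x => (sqnormc (g x))%:E).
  by apply/measurable_EFinP; exact: measurable_sqnormc.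
have : (\int[m]_x `|(sqnormc (g x))%:E| = 0)%E.
  under eq_integral do rewrite gee0_abs ?lee_fin ?sqnormc_ge0 //.
  by have := L2sqE g2; rewrite /L2sq g0.
move=> /(ae_eq_integral_abs m measurableT mg2); apply: filterS => x /(_ I) [] /eqP.
by rewrite sqnormc_eq0 => /eqP.
Qed.

Lemma nrm_ext g h : (forall x, sqnormc (g x) = sqnormc (h x)) -> nrm g = nrm h.
Proof. by move=> gh; congr fine; apply: eq_integral => x _; rewrite gh. Qed.

Lemma ae_eq_L2sq g h : cm g -> cm h -> {ae m, forall x, g x = h x} ->
  L2sq m setT g = L2sq m setT h.
Proof.
move=> mg mh gh; apply: ge0_ae_eq_integral => //; try by move=> x _; rewrite lee_fin sqnormc_ge0.
- by apply/measurable_EFinP; exact: measurable_sqnormc.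
- by apply/measurable_EFinP; exact: measurable_sqnormc.
- by apply: filterS gh => x -> _.
Qed.

Lemma ae_eq_L2 g h : cm h -> {ae m, forall x, g x = h x} -> L2 g -> L2 h.
Proof. by move=> mh gh [mg g2]; split=> //; rewrite -(ae_eq_L2sq mg mh gh). Qed.

End ComplexIntegral.
Arguments L2 {R d X} m g.
Arguments nrm {R d X} m g.
Arguments ip {R d X} m g h.

(** * Isometries obtained by simultaneous approximation of pairs *)

Section SimultaneousApproximation.
Context {R : realType} d {X : measurableType d} d' {Y : measurableType d'}.
Variables (m1 : {measure set X -> \bar R}) (m2 : {measure set Y -> \bar R}).
Variables (G : set ((X -> R[i]) * (Y -> R[i]))) (C : R).

(** The same shape as [is_stoch_integral] for the [L2] norm on the line, so a moving average is a
    [simul_approx] by conversion. The constant [C] of the section is [1] for increments of [eta] and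
    [2 * pi] for Fourier pairs. *)
Definition simul_approx (g : X -> R[i]) (h : Y -> R[i]) : Prop :=
  [/\ cmeasurable setT g, cmeasurable setT h &
      forall e : R, 0 < e ->
        exists k (c : 'I_k -> R[i]) (p : 'I_k -> (X -> R[i]) * (Y -> R[i])),
          [/\ forall i, G (p i),
              (L2sq m1 setT (fun x => g x - \sum_(i < k) c i * (p i).1 x)%R < e%:E)%E &
              (L2sq m2 setT (fun w => h w - \sum_(i < k) c i * (p i).2 w)%R < e%:E)%E]].

Hypothesis G1 : forall p, G p -> L2 m1 p.1.
Hypothesis G2 : forall p, G p -> L2 m2 p.2.

Lemma simul_approx_L2 g h : simul_approx g h -> L2 m1 g /\ L2 m2 h.
Proof.
move=> [mg mh /(_ 1 ltr01)[k [c [p [Gp e1 e2]]]]].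
have s1 : L2 m1 (fun x => \sum_(i < k) c i * (p i).1 x).
  by apply: L2_sum => i; apply: L2Z; exact: G1.
have s2 : L2 m2 (fun x => \sum_(i < k) c i * (p i).2 x).
  by apply: L2_sum => i; apply: L2Z; exact: G2.
split.
- have d1 : L2 m1 (fun x => g x - \sum_(i < k) c i * (p i).1 x).
    by split; [apply: cmeasurableB => //; case: s1|exact: lt_trans e1 (ltry _)].
  by have := L2D d1 s1; under eq_fun do rewrite subrK.
- have d2 : L2 m2 (fun x => h x - \sum_(i < k) c i * (p i).2 x).
    by split; [apply: cmeasurableB => //; case: s2|exact: lt_trans e2 (ltry _)].
  by have := L2D d2 s2; under eq_fun do rewrite subrK.
Qed.

Hypothesis gramG : forall p q, G p -> G q -> ip m2 p.2 q.2 = C%:C * ip m1 p.1 q.1.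

(** The difference splits as [ip (g - s) g' + ip s (g' - s')], and Cauchy-Schwarz applies to both
    terms. The constant comes from [nrm s <= 2 * nrm g + 2 * e], with [e <= 1] absorbing
    [e ^+ 2]. *)
Let ip_diff_le d0 (Z : measurableType d0) (m : {measure set Z -> \bar R})
    (g g' s s' : Z -> R[i]) (e : R) : 0 < e -> e <= 1 ->
  L2 m g -> L2 m g' -> L2 m s -> L2 m s' ->
  nrm m (fun x => g x - s x) < e -> nrm m (fun x => g' x - s' x) < e ->
  sqnormc (ip m g g' - ip m s s') <= (2 * nrm m g' + 4 * nrm m g + 4) * e.
Proof.
move=> e0 e1 g2 g2' s2 s2' ge ge'.
have -> : ip m g g' - ip m s s' =
  ip m (fun x => g x - s x) g' + ip m s (fun x => g' x - s' x).
  by rewrite ipBl // ipBr // addrA subrK.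
have c1 := ip_CauchySchwarz (L2B g2 s2) g2'.
have c2 := ip_CauchySchwarz s2 (L2B g2' s2').
have c3 : nrm m s <= 2 * nrm m g + 2 * e.
  have : nrm m (fun x => g x - (g x - s x)) <= _ := nrmB_le g2 (L2B g2 s2).
  by under [in nrm _ _]eq_fun do rewrite subKr; lra.
have n0 := nrm_ge0 m g'; have n1 := nrm_ge0 m g; have n2 := nrm_ge0 m s.
have n3 := nrm_ge0 m (fun x => g x - s x); have n4 := nrm_ge0 m (fun x => g' x - s' x).
apply: le_trans (sqnormcD_le _ _) _.
have h1 : nrm m (fun x => g x - s x) * nrm m g' <= e * nrm m g' by apply: ler_wpM2r => //; lra.
have h2 : nrm m s * nrm m (fun x => g' x - s' x) <= (2 * nrm m g + 2 * e) * e.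
  by apply: ler_pM => //; lra.
have h3 : e * e <= e by nra.
nra.
Qed.

(** Sesquilinearity carries the Gram identity of the generators to finite combinations. As both
    members of a pair are approximated with the same coefficients, [ip_diff_le] carries it to the
    limit on both sides at once. *)
Lemma simul_approx_ip g h g' h' : simul_approx g h -> simul_approx g' h' ->
  ip m2 h h' = C%:C * ip m1 g g'.
Proof.
move=> gh gh'; have [g2 h2] := simul_approx_L2 gh; have [g2' h2'] := simul_approx_L2 gh'.
pose K1 := 2 * nrm m1 g' + 4 * nrm m1 g + 4.
pose K2 := 2 * nrm m2 h' + 4 * nrm m2 h + 4.
pose K := 2 * K2 + 2 * (C ^+ 2 * K1).
have K1p : 0 < K1 by have := nrm_ge0 m1 g; have := nrm_ge0 m1 g'; rewrite /K1; lra.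
have K2p : 0 < K2 by have := nrm_ge0 m2 h; have := nrm_ge0 m2 h'; rewrite /K2; lra.
have Kp : 0 < K by have := mulr_ge0 (sqr_ge0 C) (ltW K1p); rewrite /K; lra.
have key e : 0 < e -> e <= 1 -> sqnormc (ip m2 h h' - C%:C * ip m1 g g') <= K * e.
  move=> e0 e1.
  have [mg mh /(_ e e0)[k [c [p [Gp a1 a2]]]]] := gh.
  have [mg' mh' /(_ e e0)[k' [c' [p' [Gp' a1' a2']]]]] := gh'.
  have s1 : L2 m1 (fun x => \sum_(i < k) c i * (p i).1 x).
    by apply: L2_sum => i; apply: L2Z; exact: G1.
  have s2 : L2 m2 (fun x => \sum_(i < k) c i * (p i).2 x).
    by apply: L2_sum => i; apply: L2Z; exact: G2.
  have s1' : L2 m1 (fun x => \sum_(i < k') c' i * (p' i).1 x).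
    by apply: L2_sum => i; apply: L2Z; exact: G1.
  have s2' : L2 m2 (fun x => \sum_(i < k') c' i * (p' i).2 x).
    by apply: L2_sum => i; apply: L2Z; exact: G2.
  rewrite L2sqE in a1; last exact: L2B. rewrite L2sqE in a2; last exact: L2B.
  rewrite L2sqE in a1'; last exact: L2B. rewrite L2sqE in a2'; last exact: L2B.
  have d1 := ip_diff_le e0 e1 g2 g2' s1 s1' a1 a1'.
  have d2 := ip_diff_le e0 e1 h2 h2' s2 s2' a2 a2'.
  have E : ip m2 (fun x => \sum_(i < k) c i * (p i).2 x)
      (fun x => \sum_(i < k') c' i * (p' i).2 x) =
      C%:C * ip m1 (fun x => \sum_(i < k) c i * (p i).1 x)
      (fun x => \sum_(i < k') c' i * (p' i).1 x).
    rewrite !ip_suml //; try by move=> i; apply: L2Z; first [exact: G1|exact: G2].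
    rewrite mulr_sumr; apply: eq_bigr => i _.
    have := G1 (Gp i); have := G2 (Gp i) => ? ?.
    rewrite !ip_sumr //; try by [exact: L2Z|move=> j; apply: L2Z; exact: G1|move=> j; apply: L2Z; exact: G2].
    rewrite mulr_sumr; apply: eq_bigr => j _.
    have := G1 (Gp' j); have := G2 (Gp' j) => ? ?.
    rewrite ![ip _ (fun x => c i * _) _]ipZl ?ipZr //; try exact: L2Z.
    by rewrite gramG //; ring.
  have -> : ip m2 h h' - C%:C * ip m1 g g' =
    (ip m2 h h' - ip m2 (fun x => \sum_(i < k) c i * (p i).2 x)
      (fun x => \sum_(i < k') c' i * (p' i).2 x)) -
    C%:C * (ip m1 g g' - ip m1 (fun x => \sum_(i < k) c i * (p i).1 x)
      (fun x => \sum_(i < k') c' i * (p' i).1 x)) by rewrite E; ring.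
  apply: le_trans (sqnormcD_le _ _) _; rewrite sqnormcN sqnormcM sqnormc_real.
  have := ler_wpM2l (sqr_ge0 C) d1; rewrite -/K1 -/K2 in d2 *; rewrite /K.
  move: (sqnormc _) (sqnormc _) (K1) (K2) d2 => S1 S2 k1 k2; lra.
apply/eqP; rewrite -subr_eq0 -sqnormc_eq0 eq_le sqnormc_ge0 andbT leNgt; apply/negP => sp.
set S := sqnormc _ in sp key *.
(* The bound [1] is required by [ip_diff_le]; the other bound gives [S <= K * e <= S / 2],
   impossible for [S > 0]. *)
have e0 : 0 < Num.min 1 (S / (2 * K)) by rewrite lt_min ltr01 divr_gt0 // mulr_gt0.
have := key _ e0; rewrite ge_min lexx => /(_ isT).
have : K * Num.min 1 (S / (2 * K)) <= S / 2.
  have -> : S / 2 = K * (S / (2 * K)) by field; rewrite gt_eqF.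
  by apply: ler_wpM2l; [exact: ltW|rewrite ge_min lexx orbT].
lra.
Qed.

Lemma simul_approx_nrm g h : simul_approx g h -> nrm m2 h = C * nrm m1 g.
Proof.
move=> gh; have := simul_approx_ip gh gh; rewrite !ipgg -rmorphM /=.
by case.
Qed.

End SimultaneousApproximation.

(** * Measurability of parameter integrals and Fubini's theorem for complex functions *)

Section ComplexFubini.
Context {R : realType} d d' {X : measurableType d} {Y : measurableType d'}.
Variables (m1 : {sigma_finite_measure set X -> \bar R}).
Variables (m2 : {sigma_finite_measure set Y -> \bar R}).

(** Tonelli's theorem handles the positive and the negative part, and [fine] is measurable on all
    extended reals, including where the inner integral is infinite. *)
Lemma measurable_Rintegral_param (f : X * Y -> R) : measurable_fun setT f ->
  measurable_fun setT (fun x => \int[m2]_y f (x, y)).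
Proof.
move=> mf; rewrite /Rintegral.
apply: (measurableT_comp (f := fine)) => //.
have mE : measurable_fun setT (EFin \o f) by exact/measurable_EFinP.
rewrite (_ : (fun x => _) = (fun x => \int[m2]_y (EFin \o f)^\+ (x, y))%E \-
  (fun x => \int[m2]_y (EFin \o f)^\- (x, y))%E)%E.
  apply: emeasurable_funB.
    by apply: measurable_fun_fubini_tonelli_F => //; exact: measurable_funepos.
  by apply: measurable_fun_fubini_tonelli_F => //; exact: measurable_funeneg.
apply/funext => x; rewrite [LHS]integralE.
by congr (_ - _)%E; apply: eq_integral => y _; rewrite ?funeposE ?funenegE.
Qed.

Lemma cmeasurable_param (F : X * Y -> R[i]) : cmeasurable setT F ->
  cmeasurable setT (fun x => cintegral m2 setT (fun y => F (x, y))).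
Proof.
move=> [F1 F2]; split; rewrite /cintegral /=.
- exact: (@measurable_Rintegral_param (fun p => complex.Re (F p))).
- exact: (@measurable_Rintegral_param (fun p => complex.Im (F p))).
Qed.

End ComplexFubini.

Section ComplexFubini.
Context {R : realType} d d' {X : measurableType d} {Y : measurableType d'}.
Variables (m1 : {sigma_finite_measure set X -> \bar R}).
Variables (m2 : {sigma_finite_measure set Y -> \bar R}).

Lemma cmeasurable_param2 (F : X * Y -> R[i]) : cmeasurable setT F ->
  cmeasurable setT (fun y => cintegral m1 setT (fun x => F (x, y))).
Proof.
move=> mF; apply: (@cmeasurable_param _ _ _ _ _ m1 (fun p => F (p.2, p.1))).
by apply: (cmeasurable_comp (u := fun p : Y * X => (p.2, p.1))) => //; exact: measurable_swap.
Qed.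

Let Rintegral_iter (f : X * Y -> R) : (m1 \x m2)%E.-integrable setT (EFin \o f) ->
  \int[m1]_x \int[m2]_y f (x, y) = fine (\int[m1 \x m2]_p (f p)%:E)%E /\
  m1.-integrable setT (fun x => (\int[m2]_y f (x, y))%:E).
Proof.
move=> fi; have mf : measurable_fun setT f.
  by apply/measurable_EFinP; exact: measurable_int fi.
have iF := integrable_fubini_F fi; have mF := measurable_int _ iF.
have mR : measurable_fun setT (fun x => (\int[m2]_y f (x, y))%:E).
  by apply/measurable_EFinP; exact: measurable_Rintegral_param.
split; last first.
  apply: (le_integrable _ _ _ iF) => // x _.
  rewrite /fubini_F /Rintegral /=.
  by case: (\int[m2]_y _)%E => [r| |] /=; rewrite ?lexx ?normr0 ?leey.
rewrite -(integral12_prod_meas1 fi) /Rintegral; congr fine.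
apply: ae_eq_integral => //.
(* [fine] alters the inner integral only where it is infinite, which is a null set of [x]. *)
have := integrable_ae measurableT iF; apply: filterS => x /(_ I) xfin _.
by rewrite -[RHS]fineK.
Qed.

Let Rintegral_iter2 (f : X * Y -> R) : (m1 \x m2)%E.-integrable setT (EFin \o f) ->
  measurable_fun setT (fun y => \int[m1]_x f (x, y)) ->
  \int[m2]_y \int[m1]_x f (x, y) = fine (\int[m1 \x m2]_p (f p)%:E)%E.
Proof.
move=> fi mR; have mf := measurable_int _ fi.
have fis : (m2 \x m1)%E.-integrable setT (fun p => (f (p.2, p.1))%:E).
  apply/integrable12ltyP.
    by apply: (measurableT_comp (f := EFin \o f)) => //; exact: measurable_swap.
  exact/(integrable21ltyP m1 m2 mf).
have iF : m2.-integrable setT (fubini_G m1 (EFin \o f)) by exact: (integrable_fubini_F fis).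
have mF := measurable_int _ iF.
rewrite -(integral21_prod_meas1 fi) /Rintegral; congr fine.
apply: ae_eq_integral => //; first exact/measurable_EFinP.
have := integrable_ae measurableT iF; apply: filterS => x /(_ I) xfin _.
by rewrite -[RHS]fineK.
Qed.

Lemma cintegrable_param (F : X * Y -> R[i]) : cmeasurable setT F ->
  (\int[m1]_x \int[m2]_y (ComplexField.Normc.normc (F (x, y)))%:E < +oo)%E ->
  cintegrable m1 setT (fun x => cintegral m2 setT (fun y => F (x, y))) /\
  cintegral m1 setT (fun x => cintegral m2 setT (fun y => F (x, y))) =
  cintegral m2 setT (fun y => cintegral m1 setT (fun x => F (x, y))).
Proof.
move=> mF Foo; have [mF1 mF2] := mF.
have iN : (m1 \x m2)%E.-integrable setT (fun p => (ComplexField.Normc.normc (F p))%:E).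
  apply/integrable12ltyP; first by apply/measurable_EFinP; exact: measurable_normc.
  by under eq_integral do under eq_integral do rewrite gee0_abs ?lee_fin ?normc_ge0 //.
have iR : (m1 \x m2)%E.-integrable setT (EFin \o (fun p => complex.Re (F p))).
  apply: (le_integrable _ _ _ iN) => //; first exact/measurable_EFinP.
  move=> p _ /=; rewrite lee_fin (le_trans (Re_le_normc _)) //; exact: ler_norm.
have iI : (m1 \x m2)%E.-integrable setT (EFin \o (fun p => complex.Im (F p))).
  apply: (le_integrable _ _ _ iN) => //; first exact/measurable_EFinP.
  move=> p _ /=; rewrite lee_fin (le_trans (Im_le_normc _)) //; exact: ler_norm.
have [E1 I1] := Rintegral_iter iR; have [E2 I2] := Rintegral_iter iI.
have [M1 M2] := cmeasurable_param2 mF.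
split; first by split.
apply: complex_ext; rewrite /cintegral /=.
  by rewrite E1 (Rintegral_iter2 iR).
by rewrite E2 (Rintegral_iter2 iI).
Qed.

End ComplexFubini.

(** * Measure-preserving maps: translations and reflections of the line, later also a sign flip *)

Definition preserving {R : realType} d {X : measurableType d} (m : {measure set X -> \bar R})
    (u : X -> X) : Prop :=
  measurable_fun setT u /\ forall A, measurable A -> m (u @^-1` A) = m A.

Section MeasurePreserving.
Context {R : realType} d {X : measurableType d} (m : {measure set X -> \bar R}).

Lemma preserving_comp u w : preserving m u -> preserving m w -> preserving m (u \o w).
Proof.
move=> [mu u1] [mw w1]; split; first exact: measurableT_comp.
move=> A mA; rewrite comp_preimage w1 ?u1 //.
by rewrite -[Y in measurable Y]setTI; exact: mu.
Qed.

Variable u : X -> X.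
Hypothesis up : preserving m u.

Lemma ge0_integral_preserving (f : X -> \bar R) : measurable_fun setT f ->
  (forall x, (0 <= f x)%E) -> (\int[m]_x f (u x) = \int[m]_x f x)%E.
Proof.
move=> mf f0; have [mu u1] := up.
have := @ge0_integral_pushforward _ _ _ _ R u mu m setT f measurableT mf (fun y _ => f0 y).
rewrite preimage_setT => /esym => -> ; apply: eq_measure_integral => A mA _.
exact: u1.
Qed.

Lemma Rintegral_preserving (f : X -> R) : measurable_fun setT f ->
  \int[m]_x f (u x) = \int[m]_x f x.
Proof.
move=> mf; have mE : measurable_fun setT (EFin \o f) by exact/measurable_EFinP.
rewrite /Rintegral integralE [in RHS]integralE; congr (fine (_ - _)%E).
- rewrite -(ge0_integral_preserving (measurable_funepos mE)) //.
  by apply: eq_integral => x _; rewrite !funeposE.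
- rewrite -(ge0_integral_preserving (measurable_funeneg mE)) //.
  by apply: eq_integral => x _; rewrite !funenegE.
Qed.

Lemma cintegral_preserving (g : X -> R[i]) : cmeasurable setT g ->
  cintegral m setT (fun x => g (u x)) = cintegral m setT g.
Proof.
move=> [g1 g2]; rewrite /cintegral.
rewrite (Rintegral_preserving (f := fun x => complex.Re (g x))) //.
by rewrite (Rintegral_preserving (f := fun x => complex.Im (g x))).
Qed.

Lemma L2sq_preserving (g : X -> R[i]) : cmeasurable setT g ->
  L2sq m setT (fun x => g (u x)) = L2sq m setT g.
Proof.
move=> mg; rewrite /L2sq (ge0_integral_preserving (f := fun x => (sqnormc (g x))%:E)) //.
  by apply/measurable_EFinP; exact: measurable_sqnormc.
by move=> x; rewrite lee_fin sqnormc_ge0.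
Qed.

Lemma L2_preserving (g : X -> R[i]) : L2 m g -> L2 m (fun x => g (u x)).
Proof.
move=> [mg g2]; split; first by apply: cmeasurable_comp => //; case: up.
by rewrite L2sq_preserving.
Qed.

Lemma ae_preserving (P : set X) : (\forall x \ae m, P x) -> \forall x \ae m, P (u x).
Proof.
move=> [N [mN N0 PN]]; exists (u @^-1` N); have [mu u1] := up; split.
- by rewrite -[Y in measurable Y]setTI; exact: mu.
- by rewrite u1.
- by move=> x /= nP; exact: PN.
Qed.

End MeasurePreserving.

Section LebesguePreserving.
Context {R : realType}.
Local Notation RR := (measurableTypeR R).

Lemma leb_preserving_opp : preserving (leb R) ((fun x => - x) : RR -> RR).
Proof. by split; [exact: oppr_measurable|move=> A mA; exact: lebesgue_measureN]. Qed.

(** The pushforward under the translation gives half-open intervals their length, so uniqueness of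
    Lebesgue measure identifies it. *)
Lemma leb_preserving_shift c : preserving (leb R) ((fun x => x + c) : RR -> RR).
Proof.
have ms : measurable_fun (setT : set RR) (fun x : RR => x + c : RR).
  by apply: measurable_funD => //; exact: measurable_cst.
split=> // A mA; apply/esym.
pose mu := pushforward (leb R) (fun x : RR => x + c : RR).
have := @lebesgue_measure_unique R (pushforward (leb R) (fun x : RR => x + c : RR)).
apply=> // B /ocitvP[->|[[a b] /= ab ->]].
  by rewrite !measure0.
rewrite /pushforward /= (_ : _ @^-1` _ = `]a - c, b - c]%classic).
  rewrite /leb !lebesgue_measure_itv /= !lte_fin ltrD2r ab -!EFinB.
  by congr (_%:E); ring.
by apply/seteqP; split => x /=; rewrite !in_itv /= ltrBlDr lerBrDr.
Qed.

Lemma leb_preserving_reflect c : preserving (leb R) ((fun x => c - x) : RR -> RR).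
Proof.
have := preserving_comp (leb_preserving_shift c) leb_preserving_opp.
by congr preserving; apply/funext => x /=; rewrite addrC.
Qed.

End LebesguePreserving.

(** * Derivatives and the fundamental theorem of calculus *)

Section RealCalculus.
Context {R : realType}.
Implicit Types f g F : R -> R.

Lemma der_cst (c x : R) : is_derive x 1 (fun _ : R => c) 0.
Proof. exact: is_derive_cst. Qed.

Lemma der_id (x : R) : is_derive x 1 (fun t : R => t) 1.
Proof. exact: is_derive_id. Qed.

Lemma der_add f g (x df dg : R) : is_derive x 1 f df -> is_derive x 1 g dg ->
  is_derive x 1 (fun t => f t + g t) (df + dg).
Proof. by move=> ? ?; exact: is_deriveD. Qed.

Lemma der_opp f (x df : R) : is_derive x 1 f df -> is_derive x 1 (fun t => - f t) (- df).
Proof. by move=> ?; exact: is_deriveN. Qed.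

Lemma der_mul f g (x df dg : R) : is_derive x 1 f df -> is_derive x 1 g dg ->
  is_derive x 1 (fun t => f t * g t) (df * g x + f x * dg).
Proof.
move=> ? ?; apply: (is_derive_eq (is_deriveM _ _)).
by rewrite addrC /GRing.scale /=; congr (_ + _); rewrite mulrC.
Qed.

Lemma der_comp (h : R -> R) f (x df dh : R) : is_derive (f x) 1 h dh -> is_derive x 1 f df ->
  is_derive x 1 (fun t => h (f t)) (df * dh).
Proof. by move=> ? ?; apply: (is_derive_eq (is_derive1_comp _ _)); rewrite mulrC. Qed.

Lemma der_exp f (x df : R) : is_derive x 1 f df ->
  is_derive x 1 (fun t => expR (f t)) (df * expR (f x)).
Proof. by move=> ?; apply: der_comp => //; exact: is_derive_expR. Qed.

Lemma der_cos f (x df : R) : is_derive x 1 f df ->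
  is_derive x 1 (fun t => cos (f t)) (df * - sin (f x)).
Proof. by move=> ?; apply: der_comp => //; exact: is_derive_cos. Qed.

Lemma der_sin f (x df : R) : is_derive x 1 f df ->
  is_derive x 1 (fun t => sin (f t)) (df * cos (f x)).
Proof. by move=> ?; apply: der_comp => //; exact: is_derive_sin. Qed.

Lemma der_atan f (x df : R) : is_derive x 1 f df ->
  is_derive x 1 (fun t => atan (f t)) (df * (1 + f x ^+ 2)^-1).
Proof. by move=> ?; apply: der_comp => //; exact: is_derive1_atan. Qed.

Lemma der_cts f (x d : R) : is_derive x 1 f d -> {for x, continuous f}.
Proof.
by case=> /derivable1_diffP /differentiable_continuous.
Qed.

Lemma FTC_halfline f F (l : R) : (forall x : R, is_derive x 1 F (f x)) -> continuous f ->
  (forall x, 0 <= x -> 0 <= f x) -> F x @[x --> +oo] --> l ->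
  (\int[leb R]_(x in `[0%R, +oo[) (f x)%:E = (l - F 0)%:E)%E.
Proof.
move=> dF cf f0 Fl; have cF : continuous F.
  by move=> x; exact: der_cts (dF x).
rewrite (ge0_continuous_FTC2y f0 _ Fl) //.
- apply/continuous_within_itvcyP; split; first by move=> x _; exact: cf.
  by apply: cvg_at_right_filter; exact: cf.
- by apply: cvg_at_right_filter; exact: cF.
- by move=> x _; rewrite derive1E; case: (dF x).
Qed.

Lemma FTC_segment f F (a b : R) : (forall x : R, is_derive x 1 F (f x)) -> continuous f ->
  a <= b -> \int[leb R]_(x in `]a, b]) f x = F b - F a.
Proof.
move=> dF cf; have cF : continuous F.
  by move=> x; exact: der_cts (dF x).
have cw (D : set R) : {within D, continuous f} by exact: continuous_subspaceT.
rewrite le_eqVlt => /predU1P[->|ab]; first by rewrite set_itvxx Rintegral_set0 subrr.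
rewrite Rintegral_itv_obnd_cbnd; last first.
  have ib : lebesgue_measure.-integrable `[a, b] (EFin \o f).
    by apply: continuous_compact_integrable; [exact: segment_compact|exact: cw].
  by apply: (integrableS _ _ _ ib) => //; exact: subset_itv_oc_cc.
rewrite /Rintegral (@continuous_FTC2 _ f F) // ?fineD //.
- split; first by move=> x _; case: (dF x).
  + by apply: cvg_at_right_filter; exact: cF.
  + by apply: cvg_at_left_filter; exact: cF.
- by move=> x _; rewrite derive1E; case: (dF x).
Qed.

Lemma der_continuous f : (forall x : R, exists d : R, is_derive x 1 f d) -> continuous f.
Proof.
move=> df x; have [d dfx] := df x.
exact: der_cts dfx.
Qed.

End RealCalculus.

Lemma der_eq {R : realType} (f : R -> R) (x d d' : R) :
  is_derive x 1 f d -> d = d' -> is_derive x 1 f d'.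
Proof. by move=> ? <-. Qed.

Ltac deriv := repeat first
  [ eapply der_id | eapply der_cst | eapply der_add | eapply der_opp | eapply der_mul
  | eapply der_exp | eapply der_cos | eapply der_sin | eapply der_atan ].
Ltac contin := apply: der_continuous; let z := fresh "z" in intro z; eexists; deriv.

(** * The integral of the Fejer kernel *)

Section FejerIntegral.
Context {R : realType}.
Local Notation RR := (measurableTypeR R).

Lemma cvgy0_inv (G : R -> R) (K : R) : (forall y, 0 < y -> `|G y| <= K / y) ->
  G y @[y --> +oo] --> 0.
Proof.
move=> GK; apply/cvgrPdist_le => e e0; near=> y.
have y0 : 0 < y by near: y; apply: nbhs_pinfty_gt; exact: num_real.
have y1 : K / e < y by near: y; apply: nbhs_pinfty_gt; exact: num_real.
rewrite sub0r normrN (le_trans (GK _ y0)) // ler_pdivrMr //.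
by rewrite ltr_pdivrMr // in y1; rewrite mulrC ltW.
Unshelve. all: by end_near.
Qed.

Lemma expRN_le_inv (t : R) : 0 < t -> expR (- t) <= t^-1.
Proof.
move=> t0; rewrite expRN lef_pV2 ?posrE ?expR_gt0 //.
by have := expR_ge1Dx t; lra.
Qed.

Lemma expRN_le_inv2 (t : R) : 0 < t -> t * expR (- t) <= 2 * t^-1.
Proof.
move=> t0; rewrite expRN ler_pdivrMr ?expR_gt0 // mulrAC ler_pdivlMr //.
have : 1 + t ^+ 2 / 2 <= expR t := expR_ge1Dxn 1 (ltW t0).
by rewrite expr2; lra.
Qed.

Lemma integral_yexp (l : R) : 0 < l ->
  (\int[leb R]_(y in `[0%R, +oo[) (y * expR (- (l * y)))%:E = (l ^- 2)%:E)%E.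
Proof.
move=> l0; have ln : l != 0 by rewrite gt_eqF.
pose F (y : R) : R := - ((y * l^-1 + l ^- 2) * expR (- (l * y))).
have dF (y : R) : is_derive y 1 F (y * expR (- (l * y))).
  rewrite /F; eapply der_eq; [by deriv|cbv beta].
  by field.
have Fl : F y @[y --> +oo] --> 0.
  apply: (@cvgy0_inv _ (3 * l ^- 3)) => y y0.
  have ly : 0 < l * y by rewrite mulr_gt0.
  rewrite /F normrN ger0_norm; last first.
    by rewrite mulr_ge0 ?expR_ge0 // addr_ge0 ?mulr_ge0 ?invr_ge0 ?exprn_ge0 // ltW.
  have -> : (y * l^-1 + l ^- 2) * expR (- (l * y)) =
     l ^- 2 * ((l * y) * expR (- (l * y)) + expR (- (l * y))) by field.
  have -> : 3 * l ^- 3 / y = l ^- 2 * (2 * (l * y)^-1 + (l * y)^-1).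
    by field; rewrite ln gt_eqF.
  by rewrite ler_wpM2l ?lerD ?expRN_le_inv2 ?expRN_le_inv // invr_ge0 exprn_ge0 // ltW.
rewrite (FTC_halfline dF _ _ Fl).
- by rewrite /F mulr0 oppr0 expR0 mul0r mulr1 !add0r opprK.
- by contin.
- by move=> y y0; rewrite mulr_ge0 ?expR_ge0.
Qed.

Lemma integral_expcos (x y : R) : 0 < x -> 0 < y ->
  (\int[leb R]_(l in `[0%R, +oo[) (expR (- (l * y)) * (1 - cos (l * x)))%:E =
   (x ^+ 2 / (y * (x ^+ 2 + y ^+ 2)))%:E)%E.
Proof.
move=> x0 y0; have yn : y != 0 by rewrite gt_eqF.
have sp : 0 < x ^+ 2 + y ^+ 2 by rewrite addr_gt0 ?exprn_gt0.
have sn : x ^+ 2 + y ^+ 2 != 0 by rewrite gt_eqF.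
pose F (l : R) : R := expR (- (l * y)) *
  (- y^-1 + (y * cos (l * x) - x * sin (l * x)) * (x ^+ 2 + y ^+ 2)^-1).
have dF (l : R) : is_derive l 1 F (expR (- (l * y)) * (1 - cos (l * x))).
  rewrite /F; eapply der_eq; [by deriv|cbv beta].
  by field; rewrite sn yn.
have Fl : F l @[l --> +oo] --> 0.
  apply: (@cvgy0_inv _ (y^-1 * (y^-1 + (y + x) * (x ^+ 2 + y ^+ 2)^-1))) => l l0.
  rewrite /F normrM ger0_norm ?expR_ge0 // mulrAC; apply: ler_pM => //.
    by rewrite (le_trans (expRN_le_inv _)) ?mulr_gt0 // invfM mulrC.
  have n1 : `|- y^-1| = y^-1 by rewrite normrN gtr0_norm ?invr_gt0.
  apply: le_trans (ler_normD _ _) _; rewrite n1 lerD2l.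
  rewrite normrM (gtr0_norm (x := _^-1)) ?invr_gt0 //. rewrite ler_pM2r ?invr_gt0 //.
  apply: le_trans (ler_normB _ _) _; rewrite !normrM (gtr0_norm x0) (gtr0_norm y0).
  by apply: lerD; rewrite ger_pMr // ler_norml ?cos_geN1 ?cos_le1 ?sin_geN1 ?sin_le1.
rewrite (FTC_halfline dF _ _ Fl).
- rewrite /F !mul0r oppr0 expR0 cos0 sin0; congr (_%:E); field; rewrite sn yn //.
- by contin.
- by move=> l l0; rewrite mulr_ge0 ?expR_ge0 // subr_ge0 cos_le1.
Qed.

Lemma integral_poisson (x : R) : 0 < x ->
  (\int[leb R]_(y in `[0%R, +oo[) (x ^+ 2 / (x ^+ 2 + y ^+ 2))%:E = (x * (pi / 2))%:E)%E.
Proof.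
move=> x0; have xn : x != 0 by rewrite gt_eqF.
have sp (y : R) : 0 < x ^+ 2 + y ^+ 2 by rewrite ltr_wpDr ?sqr_ge0 ?exprn_gt0.
have sn y : x ^+ 2 + y ^+ 2 != 0 by rewrite gt_eqF.
pose F (y : R) : R := x * atan (y * x^-1).
have dF (y : R) : is_derive y 1 F (x ^+ 2 / (x ^+ 2 + y ^+ 2)).
  rewrite /F; eapply der_eq; [by deriv|cbv beta].
  have h : 1 + (y * x^-1) ^+ 2 = (x ^+ 2 + y ^+ 2) / x ^+ 2 by field.
  by rewrite h invf_div; field; rewrite sn xn.
have Fl : F y @[y --> +oo] --> x * (pi / 2).
  apply: cvgMr; apply: (cvg_comp _ _ _ (@cvgy_atan R)).
  by apply: gt0_cvgMly; [rewrite invr_gt0|exact: cvg_id].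
rewrite (FTC_halfline dF _ _ Fl).
- by rewrite /F mul0r atan0 mulr0 subr0.
- move=> y; apply: (@cvgMr _ _ _ _ (fun y : R => (x ^+ 2 + y ^+ 2)^-1)).
  apply: cvgV => //; suff : continuous (fun y : R => x ^+ 2 + y ^+ 2) by apply.
  under eq_fun do rewrite expr2; under eq_fun do rewrite expr2; contin.
- by move=> y _; rewrite mulr_ge0 ?sqr_ge0 // invr_ge0 ltW.
Qed.

Lemma measurable_invr : measurable_fun setT (fun x : R => x^-1).
Proof.
rewrite (_ : (fun x => _) = (fun x : R => if x == 0 then 0 else x^-1)); last first.
  by apply/funext => x; case: eqVneq => [->|//]; rewrite invr0.
apply: measurable_fun_if => //.
- by apply: measurable_fun_eqr; [exact: measurable_id|exact: measurable_cst].
- rewrite (_ : _ `&` _ = [set x : R | x != 0]); last first.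
    by apply/seteqP; split => x /=; [move=> [_ ->]|case: (x == 0)].
  apply: open_continuous_measurable_fun; first exact: open_neq.
  by move=> x; rewrite inE /= => x0; apply: inv_continuous.
Qed.

Lemma integral_indicM (D : set RR) (g : RR -> R) : 
  (\int[leb R]_x (\1_D x * g x)%:E = \int[leb R]_(x in D) (g x)%:E)%E.
Proof.
rewrite [RHS]integral_mkcond; apply: eq_integral => x _; rewrite patchE indicE.
by case: (x \in D); rewrite ?mul1r ?mul0r.
Qed.

End FejerIntegral.

Section FejerIntegral.
Context {R : realType}.
Local Notation RR := (measurableTypeR R).
Local Notation pos := (`]0%R, +oo[%classic : set R).

Let measurable_pos2 (f : R * R -> R) : measurable_fun setT f ->
  measurable_fun setT (fun p : RR * RR => (\1_pos p.1 * (\1_pos p.2 * f p))%:E).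
Proof.
move=> mf; have mi : measurable_fun (setT : set RR) (\1_pos : RR -> R).
  exact: measurable_indic.
apply/measurable_EFinP; apply: measurable_funM.
  exact: (measurableT_comp mi measurable_fst).
by apply: measurable_funM => //; exact: (measurableT_comp mi measurable_snd).
Qed.

(** The Fejer kernel up to normalization, with value [0] at [l = 0] by total division. Products of
    transforms of intervals are combinations of such kernels, see [fhat_itvf_prod]. *)
Definition fejer (x l : R) : R := (1 - cos (l * x)) / l ^+ 2.

Lemma fejer_ge0 x l : 0 <= fejer x l.
Proof. by rewrite mulr_ge0 ?invr_ge0 ?sqr_ge0 // subr_ge0 cos_le1. Qed.

Lemma measurable_fejer x : measurable_fun (setT : set RR) (fejer x).
Proof.
apply: measurable_funM.
  by apply: continuous_measurable_fun; contin.
apply: (measurableT_comp measurable_invr).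
by apply: measurable_funX; exact: measurable_id.
Qed.

(** [l ^- 2] is written as the integral of [y * expR (- (l * y))] over [y > 0], and Tonelli's
    theorem exchanges the integrals. The integral in [l] is then rational in [y], with an arctangent
    as primitive. The indicators extend the integrand by [0] outside the open quadrant, which makes
    it nonnegative on the whole plane. *)
Lemma integral_fejer_halfline (x : R) : 0 < x ->
  (\int[leb R]_(l in pos) (fejer x l)%:E = (x * (pi / 2))%:E)%E.
Proof.
move=> x0.
pose f (p : R * R) : R := p.2 * expR (- (p.1 * p.2)) * (1 - cos (p.1 * x)).
have mf : measurable_fun (setT : set (RR * RR)) f.
  apply: measurable_funM; first apply: measurable_funM => //.
    apply: (measurableT_comp (f := expR)) => //.
    by apply: measurableT_comp => //; apply: measurable_funM.
  apply: measurable_funB; first exact: measurable_cst.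
  apply: (measurableT_comp (f := cos)).
    by apply: continuous_measurable_fun; exact: continuous_cos.
  by apply: measurable_funM => //; exact: measurable_cst.
have f0 (p : R * R) : (0 <= (\1_pos p.1 * (\1_pos p.2 * f p))%:E)%E.
  rewrite lee_fin !indicE; case: (boolP (p.2 \in pos)); rewrite ?mul0r ?mulr0 // mul1r.
  rewrite inE /= in_itv /= andbT => p0; rewrite mulr_ge0 // /f mulr_ge0 ?subr_ge0 ?cos_le1 //.
  by rewrite mulr_ge0 ?expR_ge0 ?ltW.
have T := fubini_tonelli (m1 := lebesgue_measure) (m2 := lebesgue_measure) _ (measurable_pos2 mf) f0.
have mE (g : R -> R) : continuous g -> measurable_fun pos (fun y : RR => (g y)%:E).
  by move=> cg; apply/measurable_EFinP; apply: measurable_funTS; exact: continuous_measurable_fun.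
have posE (g : R -> R) : continuous g ->
    (\int[leb R]_(y in pos) (g y)%:E = \int[leb R]_(y in `[0%R, +oo[) (g y)%:E)%E.
  by move=> /mE; exact: (@integral_itv_obnd_cbnd R 0 _ (fun y => (g y)%:E)).
have mpos : measurable (pos : set RR) by exact: measurable_itv.
transitivity (\int[leb R]_l \int[leb R]_y (\1_pos l * (\1_pos y * f (l, y)))%:E)%E.
  rewrite -integral_indicM; apply: eq_integral => l _; rewrite indicE.
  case: (boolP (l \in pos)) => [|_]; last first.
    by rewrite mul0r; under eq_integral do rewrite mul0r; rewrite integral0.
  rewrite inE /= in_itv /= andbT => l0.
  under eq_integral do rewrite mul1r.
  rewrite mul1r (integral_indicM _ (fun y => f (l, y))) /f /=.
  have c1 : continuous (fun y : R => y * expR (- (l * y))) by contin.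
  have e0 (y : RR) : pos y -> (0 <= (y * expR (- (l * y)))%:E)%E.
    by rewrite /= in_itv /= andbT => y0; rewrite lee_fin mulr_ge0 ?expR_ge0 ?ltW.
  have k0 : 0 <= 1 - cos (l * x) by rewrite subr_ge0 cos_le1.
  under eq_integral do rewrite mulrC EFinM.
  by rewrite (ge0_integralZl_EFin (leb R) mpos e0 (mE _ c1) k0) (posE _ c1) (integral_yexp l0).
transitivity (\int[leb R]_y \int[leb R]_l (\1_pos l * (\1_pos y * f (l, y)))%:E)%E; first exact: T.
transitivity (\int[leb R]_(y in pos) (x ^+ 2 / (x ^+ 2 + y ^+ 2))%:E)%E; last first.
  have c3 : continuous (fun y : R => x ^+ 2 / (x ^+ 2 + y ^+ 2)).
    move=> y; apply: (@cvgMr _ _ _ _ (fun y : R => (x ^+ 2 + y ^+ 2)^-1)).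
    apply: cvgV; first by rewrite gt_eqF // ltr_wpDr ?sqr_ge0 ?exprn_gt0.
    suff : continuous (fun y : R => x ^+ 2 + y ^+ 2) by apply.
    by under eq_fun do rewrite expr2; under eq_fun do rewrite expr2; contin.
  by rewrite (posE _ c3) (integral_poisson x0).
rewrite -integral_indicM; apply: eq_integral => y _; rewrite indicE.
case: (boolP (y \in pos)) => [|_]; last first.
  by rewrite mul0r; under eq_integral do rewrite mul0r mulr0; rewrite integral0.
rewrite inE /= in_itv /= andbT => y0.
under eq_integral do rewrite mul1r.
rewrite mul1r (integral_indicM _ (fun l => f (l, y))) /f /=.
have c2 : continuous (fun l : R => expR (- (l * y)) * (1 - cos (l * x))) by contin.
have e0 (l : RR) : pos l -> (0 <= (expR (- (l * y)) * (1 - cos (l * x)))%:E)%E.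
  by move=> _; rewrite lee_fin mulr_ge0 ?expR_ge0 // subr_ge0 cos_le1.
have sn : x ^+ 2 + y ^+ 2 != 0 by rewrite gt_eqF // addr_gt0 ?exprn_gt0.
under eq_integral do rewrite -mulrA EFinM.
rewrite (ge0_integralZl_EFin (leb R) mpos e0 (mE _ c2) (ltW y0)) (posE _ c2).
rewrite (integral_expcos x0 y0) -EFinM; congr (_%:E); field.
by rewrite sn gt_eqF.
Qed.

Lemma integral_fejer (x : R) : (\int[leb R]_l (fejer x l)%:E = (pi * `|x|)%:E)%E.
Proof.
wlog x0 : x / 0 < x => [H|].
  have [x0|x0|->] := ltgtP x 0.
  - rewrite -normrN -H ?oppr_gt0 //; apply: eq_integral => l _.
    by rewrite /fejer mulrN cosN.
  - exact: H.
  - rewrite normr0 mulr0 /fejer; under eq_integral do rewrite mulr0 cos0 subrr mul0r.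
    by rewrite integral0.
have mE (D : set RR) : measurable_fun D (fun l => (fejer x l)%:E).
  by apply: measurable_funTS; apply/measurable_EFinP; exact: measurable_fejer.
have fE (l : RR) : (0 <= (fejer x l)%:E)%E by rewrite lee_fin fejer_ge0.
have H0 := integral_fejer_halfline x0.
have H1 : (\int[leb R]_(l in `]-oo, 0%R[) (fejer x l)%:E = (x * (pi / 2))%:E)%E.
  rewrite -H0 -[LHS]integral_indicM -[RHS]integral_indicM.
  rewrite -[RHS](ge0_integral_preserving (@leb_preserving_opp R)); last 2 first.
  - apply/measurable_EFinP; apply: measurable_funM; first exact: measurable_indic.
    exact: measurable_fejer.
  - by move=> l; rewrite lee_fin mulr_ge0 ?fejer_ge0.
  apply: eq_integral => l _; rewrite !indicE !mem_setE !in_itv /= andbT oppr_gt0; congr ((_ * _)%:E).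
  by rewrite /fejer mulNr cosN sqrrN.
have D1 : [set: RR] = `]-oo, 0%R[ `|` `[0%R, +oo[.
  apply/seteqP; split => l //= _; rewrite !in_itv /= andbT.
  by case: (ltP l 0); [left|right].
rewrite D1 ge0_integral_setU //; last first.
  rewrite disj_set2E; apply/eqP/seteqP; split => l //=; rewrite !in_itv /= andbT => -[a b].
  by move: (lt_le_trans a b); rewrite ltxx.
have H2 : (\int[leb R]_(l in `[0%R, +oo[) (fejer x l)%:E = (x * (pi / 2))%:E)%E.
  by rewrite -H0; apply/esym; exact: (@integral_itv_obnd_cbnd R 0 _ (fun l => (fejer x l)%:E) (mE _)).
rewrite H1 H2 -EFinD.
by congr (_%:E); rewrite gtr0_norm //; field.
Qed.

Lemma integrable_fejer x : (leb R).-integrable setT (fun l => (fejer x l)%:E).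
Proof.
apply/integrableP; split; first by apply/measurable_EFinP; exact: measurable_fejer.
under eq_integral do rewrite gee0_abs ?lee_fin ?fejer_ge0 //.
by rewrite integral_fejer ltry.
Qed.

End FejerIntegral.

(** * Fourier transforms of indicators of intervals and their Gram matrix *)

Section IntervalTransforms.
Context {R : realType}.
Local Notation RR := (measurableTypeR R).
Implicit Types k : R -> R[i].

Definition itvf (x y : R) : R -> R[i] := fun t => (\1_(`]x, y]%classic : set R) t)%:C.

Definition fhat k (l : R) : R[i] :=
  cintegral (leb R) setT (fun t => k t * expi (- (l * t))).

(** The length of the intersection of []x, y]] and []x', y']]. *)
Definition overlap (x y x' y' : R) : R := Num.max 0 (Num.min y y' - Num.max x x').

(** The left side is the combination of end points in which the kernels occur in [fhat_itvf_prod],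
    each integrating to [pi] times an absolute value. The same combination arises from the
    covariance of a process with orthogonal increments. *)
Lemma overlapE (x y x' y' : R) : x <= y -> x' <= y' ->
  `|x - y'| + `|y - x'| - `|x - x'| - `|y - y'| = 2 * overlap x y x' y'.
Proof.
move=> xy xy'; rewrite /overlap.
case: (lerP y y') => ?; case: (lerP x x') => ?; case: (lerP x y') => ?;
  case: (lerP y x') => ?; try (by case: lerP => ?; lra); lra.
Qed.

Lemma cintegral_indic (D : set RR) (g : RR -> R[i]) :
  cintegral (leb R) D g = cintegral (leb R) setT (fun x => (\1_D x)%:C * g x).
Proof.
rewrite /cintegral !(Rintegral_mkcond _ D); congr (_ +i* _); apply: eq_Rintegral => x _;
  rewrite patchE indicE; case: (x \in D); rewrite ?mul1r ?mul0r //.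
Qed.

Lemma cmeasurable_itvf x y : cmeasurable (setT : set RR) (itvf x y).
Proof. by apply: cmeasurable_real; exact: measurable_indic. Qed.

Lemma itvf_conj x y t : (itvf x y t)^* = itvf x y t.
Proof. exact: conjc_ofreal. Qed.

Lemma sqnormc_itvf x y t : sqnormc (itvf x y t) = \1_(`]x, y]%classic : set R) t.
Proof. by rewrite sqnormc_real indicE; case: (_ \in _); rewrite ?expr1n ?expr0n. Qed.

Lemma L2_itvf x y : L2 (leb R) (itvf x y).
Proof.
split; first exact: cmeasurable_itvf.
rewrite /L2sq; under eq_integral do rewrite sqnormc_itvf.
rewrite integral_indic // setIT /= lebesgue_measure_itv /=.
by case: ifP => _; rewrite ?ltry.
Qed.

Lemma ip_itvf (x y x' y' : R) : ip (leb R) (itvf x y) (itvf x' y') = (overlap x y x' y')%:C.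
Proof.
rewrite /ip (_ : (fun t => _) = itvf (Num.max x x') (Num.min y y')).
  rewrite /cintegral /itvf /= Rintegral_cst // mul0r; congr (_ +i* _).
  rewrite /Rintegral integral_indic // setIT /= lebesgue_measure_itv /= lte_fin /overlap.
  by case: (ltP (Num.max x x')) => h /=; case: (leP 0) => h' //; lra.
apply/funext => t; rewrite itvf_conj -rmorphM /=; congr (_%:C).
rewrite !indicE !mem_setE !in_itv /= gt_max le_min.
by case: (x < t); case: (x' < t); case: (t <= y); case: (t <= y') => /=; rewrite ?mul1r ?mul0r ?mulr0.
Qed.

Lemma measurable_phase : cmeasurable (setT : set (RR * RR)) (fun p => expi (- (p.1 * p.2)) : R[i]).
Proof. by apply: cmeasurable_expi; apply: measurable_funN_real; apply: measurable_funM. Qed.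

Lemma cmeasurable_fhat k : cmeasurable (setT : set RR) k -> cmeasurable (setT : set RR) (fhat k).
Proof.
move=> mk; apply: (@cmeasurable_param _ _ _ _ _ (lebesgue_measure : {sigma_finite_measure set RR -> \bar R})
  (fun p : RR * RR => k p.2 * expi (- (p.1 * p.2)))).
apply: cmeasurableM; last exact: measurable_phase.
by apply: (cmeasurable_comp (u := snd)).
Qed.

Lemma fhat_itvf (x y l : R) : x <= y -> l != 0 ->
  fhat (itvf x y) l = (expi (- (l * x)) - expi (- (l * y))) / (0 +i* l).
Proof.
move=> xy l0; have il : (0 +i* l : R[i]) != 0 by rewrite eq_complex negb_and l0 orbT.
apply: (mulIf il); rewrite divfK // /fhat -cintegral_indic /cintegral /expi /=.
have dF1 (t : R) : is_derive t 1 (fun t => sin (l * t) * l^-1) (cos (- (l * t))).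
  by eapply der_eq; [by deriv|cbv beta]; rewrite cosN; field.
have dF2 (t : R) : is_derive t 1 (fun t => cos (l * t) * l^-1) (sin (- (l * t))).
  by eapply der_eq; [by deriv|cbv beta]; rewrite sinN; field.
have cF1 : continuous (fun t : R => cos (- (l * t))) by contin.
have cF2 : continuous (fun t : R => sin (- (l * t))) by contin.
rewrite (FTC_segment dF1 cF1 xy) (FTC_segment dF2 cF2 xy).
by rewrite !cosN !sinN; apply: complex_ext => /=; field.
Qed.

Lemma fhat_itvf_opp (x y l : R) : x <= y -> l != 0 ->
  fhat (itvf x y) (- l) = (fhat (itvf x y) l)^*.
Proof.
move=> xy l0; rewrite !fhat_itvf ?oppr_eq0 // conjcM conjcV conjcB -!expiN !opprK !mulNr !opprK.
congr (_ / _); apply: complex_ext => //=; by rewrite oppr0.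
Qed.

Lemma ae_neq0 : \forall l \ae leb R, l != 0 :> R.
Proof.
exists [set 0]; split => //; first exact: lebesgue_measure_set1.
by move=> l /= /negP; rewrite negbK => /eqP.
Qed.

Lemma ae_eq_off0 (f g : RR -> \bar R) : (forall l : R, l != 0 -> f l = g l) ->
  ae_eq (leb R) setT f g.
Proof. by move=> H; apply: (ae_mono _ ae_neq0) => l l0 _; exact: H. Qed.

Lemma fhat_itvf_prod (x y x' y' l : R) : x <= y -> x' <= y' -> l != 0 ->
  complex.Re (fhat (itvf x y) l * (fhat (itvf x' y') l)^*) =
  fejer (x - y') l + fejer (y - x') l - fejer (x - x') l - fejer (y - y') l.
Proof.
move=> xy xy' l0; have il : (0 +i* l : R[i]) != 0 by rewrite eq_complex negb_and l0 orbT.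
have sl : sqnormc (0 +i* l : R[i]) = l ^+ 2 by rewrite sqnormcE /= expr0n add0r.
rewrite !fhat_itvf // conjcM conjcV.
have -> (z w : R[i]) : z / (0 +i* l) * (w / (0 +i* l)^*) = (l ^- 2)%:C * (z * w).
  have -> : (l ^- 2)%:C = ((0 +i* l) * (0 +i* l)^*)^-1 by rewrite mulc_conj sl rmorphV ?unitfE ?expf_neq0.
  by rewrite invfM; ring.
rewrite cReM [complex.Re _%:C]/= [complex.Im _%:C]/= mul0r subr0 cReM /fejer !mulrBr !cosB /expi /= !cosN !sinN.
by field.
Qed.

Lemma L2_fhat_itvf x y : x <= y -> L2 (leb R) (fhat (itvf x y)).
Proof.
move=> xy; have mf := cmeasurable_fhat (cmeasurable_itvf x y).
split=> //; rewrite (_ : L2sq _ _ _ = \int[leb R]_l (2%:E * (fejer (x - y) l)%:E))%E.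
  rewrite ge0_integralZl_EFin //; first by rewrite integral_fejer -EFinM ltry.
    by move=> l _; rewrite lee_fin fejer_ge0.
  by apply/measurable_EFinP; exact: measurable_fejer.
apply: ge0_ae_eq_integral => //.
- by apply/measurable_EFinP; exact: measurable_sqnormc.
- by apply/measurable_EFinP; apply: measurable_funM => //; exact: measurable_fejer.
- by move=> l _; rewrite lee_fin sqnormc_ge0.
- by move=> l _; rewrite -EFinM lee_fin mulr_ge0 ?fejer_ge0.
apply: ae_eq_off0 => l l0; rewrite -EFinM; congr (_%:E).
have := fhat_itvf_prod xy xy l0; rewrite mulc_conj /= => ->.
rewrite !subrr /fejer !mulr0 cos0 subrr mul0r !subr0 -[y - x]opprB mulrN cosN; ring.
Qed.

(** Plancherel's identity on the generators. The real part reduces to four Fejer integrals; the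
    imaginary part vanishes by symmetry, without being computed. *)
Lemma ip_fhat_itvf (x y x' y' : R) : x <= y -> x' <= y' ->
  ip (leb R) (fhat (itvf x y)) (fhat (itvf x' y')) = (2 * pi)%:C * ip (leb R) (itvf x y) (itvf x' y').
Proof.
move=> xy xy'; have L1 := L2_fhat_itvf xy; have L1' := L2_fhat_itvf xy'.
have [i1 i2] := ip_cintegrable L1 L1'.
rewrite ip_itvf -rmorphM /=; apply: complex_ext => /=.
  pose g (l : R) := fejer (x - y') l + fejer (y - x') l - fejer (x - x') l - fejer (y - y') l.
  have mf z := @measurable_fejer R z.
  rewrite /ip /cintegral /=; transitivity (\int[leb R]_l g l).
    congr fine; apply: ae_eq_integral => //; first exact: measurable_int i1.
      apply/measurable_EFinP; apply: measurable_funB => //; apply: measurable_funB => //.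
      exact: measurable_funD.
    by apply: ae_eq_off0 => l l0; congr (_%:E); exact: fhat_itvf_prod.
  have If z : (leb R).-integrable setT (EFin \o fejer z) by exact: integrable_fejer.
  have IfD z z' : (leb R).-integrable setT (EFin \o (fun l => fejer z l + fejer z' l)).
    exact: (integrableD measurableT (If z) (If z')).
  have Ifv z : \int[leb R]_l fejer z l = pi * `|z| by rewrite /Rintegral integral_fejer.
  rewrite /g RintegralB ?RintegralB ?RintegralD ?Ifv //; last first.
    exact: (integrableB measurableT (IfD _ _) (If _)).
  by rewrite mulrAC -overlapE //; ring.
(* The reflection [l |-> - l] conjugates the transforms of real functions, so the inner product
   equals its own conjugate. *)
have : ip (leb R) (fhat (itvf x y)) (fhat (itvf x' y')) =
   (ip (leb R) (fhat (itvf x y)) (fhat (itvf x' y')))^*.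
  have mg : cmeasurable (setT : set RR) (fun l => fhat (itvf x y) l * (fhat (itvf x' y') l)^*).
    by apply: cintegrable_cmeasurable (leb R) _ _; exact: ip_cintegrable.
  rewrite -(ip_sym L1 L1').
  transitivity (cintegral (leb R) setT
      (fun l : RR => fhat (itvf x y) (- l) * (fhat (itvf x' y') (- l))^*)).
    exact: esym (cintegral_preserving (@leb_preserving_opp R) mg).
  apply: ae_eq_cintegral.
  - exact: (cmeasurable_comp (u := (fun l => - l) : RR -> RR) (@oppr_measurable R setT) mg).
  - by apply: cmeasurableM; [case: L1'|apply: cmeasurable_conj; case: L1].
  - by apply: (ae_mono _ ae_neq0) => l l0; rewrite !fhat_itvf_opp // conjCK mulrC.
by move=> /(congr1 (@complex.Im _)); rewrite cIm_conj /= => h; lra.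
Qed.

End IntervalTransforms.

(** * Linear combinations, simple functions and closed spans *)

Section OfReal.
Context {R : realType}.

Lemma ofrealB (x y : R) : (x - y)%:C = x%:C - y%:C :> R[i].
Proof. by apply: complex_ext => //=; rewrite subrr. Qed.

Lemma ofrealM (x y : R) : (x * y)%:C = x%:C * y%:C :> R[i].
Proof. by apply: complex_ext; rewrite ?cReM ?cImM /=; ring. Qed.

Lemma ofreal_sum k (f : 'I_k -> R) : (\sum_(i < k) f i)%:C = \sum_(i < k) (f i)%:C :> R[i].
Proof.
elim: k f => [|k IH] f; first by rewrite !big_ord0.
by rewrite !big_ord_recr /= -IH; apply: complex_ext => //=; rewrite addr0.
Qed.

End OfReal.

Definition cind {R : realType} {X : Type} (A : set X) (x : X) : R[i] := (\1_A x)%:C.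

Lemma add_quarters {R : realType} (a b e : R) : a < e / 4 -> b < e / 4 -> 2 * a + 2 * b < e.
Proof. by move=> *; lra. Qed.

Section LinearCombinations.
Context {R : realType} {X : Type}.
Variable S : set (X -> R[i]).

Definition comb : set (X -> R[i]) := [set f | exists k (c : 'I_k -> R[i]) (p : 'I_k -> X -> R[i]),
  (forall i, S (p i)) /\ f = fun x => \sum_(i < k) c i * p i x].

Lemma comb_gen f : S f -> comb f.
Proof.
move=> Sf; exists 1%N, (fun=> 1), (fun=> f); split=> //.
by apply/funext => x; rewrite big_ord1 mul1r.
Qed.

Lemma comb0 : comb (fun=> 0).
Proof.
exists 0%N, (fun=> 1), (fun=> fun=> 0); split; first by case.
by apply/funext => x; rewrite big_ord0.
Qed.

Lemma combZ z f : comb f -> comb (fun x => z * f x).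
Proof.
move=> [k [c [p [Sp ->]]]]; exists k, (fun i => z * c i), p; split=> //.
by apply/funext => x; rewrite mulr_sumr; apply: eq_bigr => i _; rewrite mulrA.
Qed.

Lemma combD f g : comb f -> comb g -> comb (fun x => f x + g x).
Proof.
move=> [k [c [p [Sp ->]]]] [k' [c' [p' [Sp' ->]]]].
exists (k + k')%N, (fun i => match fintype.split i with inl j => c j | inr j => c' j end).
exists (fun i => match fintype.split i with inl j => p j | inr j => p' j end).
split=> [i|]; first by case: (fintype.split i).
apply/funext => x; rewrite big_split_ord /=; congr (_ + _); apply: eq_bigr => i _.
  by rewrite (unsplitK (inl i)).
by rewrite (unsplitK (inr i)).
Qed.

Lemma comb_sum k (f : 'I_k -> X -> R[i]) : (forall i, comb (f i)) ->
  comb (fun x => \sum_(i < k) f i x).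
Proof.
elim: k f => [|k IH] f cf.
  by under eq_fun do rewrite big_ord0; exact: comb0.
by under eq_fun do rewrite big_ord_recr /=; apply: combD => //; exact: IH.
Qed.

Lemma combB f g : comb f -> comb g -> comb (fun x => f x - g x).
Proof.
move=> cf cg; have := combD cf (combZ (-1) cg).
by under eq_fun do rewrite mulN1r.
Qed.

End LinearCombinations.

Section SimpleApproximation.
Context {R : realType} d {X : measurableType d}.

(** Rounds a nonnegative [y] down to a multiple of [e], at most [N * e]. In this form each summand
    is a multiple of the indicator of a level set. *)
Let stair (e : R) N (y : R) : R := \sum_(j < N) (if j.+1%:R * e <= y then e else 0).

Let stairP (e : R) N (y : R) : 0 < e -> 0 <= y -> y <= N.+1%:R * e ->
  0 <= y - stair e N y <= e.
Proof.
move=> e0; elim: N y => [|N IH] y y0; first by rewrite /stair big_ord0 mul1r subr0 y0.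
move=> yN; rewrite /stair big_ord_recl /= mul1r; case: (lerP e y) => [ey|ye].
  have := IH (y - e); rewrite subr_ge0 ey lerBlDr => /(_ isT).
  have -> : N.+1%:R * e + e = N.+2%:R * e by rewrite [N.+2%:R]mulrSr; ring.
  move=> /(_ yN) H; set S2 := \sum_(i < N) _.
  have -> : S2 = stair e N (y - e); last by rewrite opprD addrA.
  apply: eq_bigr => j _; rewrite lerBrDr.
  by rewrite /bump /= [j.+2%:R]mulrSr mulrDl mul1r.
rewrite big1 => [|j _]; first by rewrite ?addr0 ?add0r ?subr0 y0 ltW.
case: ifP => // jy; have : (j.+2)%:R * e <= y by [].
by rewrite [j.+2%:R]mulrS mulrDl mul1r; have := mulr_ge0 (ler0n R j.+1) (ltW e0); lra.
Qed.

Let real_simple (f : X -> R) (B e : R) : measurable_fun setT f -> 0 < e ->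
  (forall x, `|f x| <= B) ->
  exists2 s : X -> R[i], comb [set f | exists2 A : set X, measurable A & f = cind A] s &
   forall x, exists2 r, s x = r%:C & `|f x - r| <= e.
Proof.
move=> mf e0 fB.
have [N BN] : exists N : nat, 2 * B <= N%:R * e.
  exists (Num.truncn (2 * B / e)).+1; rewrite -ler_pdivrMr //.
  by apply: ltW; rewrite truncnS_gt.
(* The shift by [B] moves the range of [f] into [[0, 2 * B]], which [N] steps of height [e]
   cover. *)
pose s x : R[i] := (stair e N (f x + B) - B)%:C.
exists s => [|x]; last first.
  exists (stair e N (f x + B) - B) => //.
  have := fB x; rewrite ler_norml => /andP[f1 f2].
  have /andP[] : 0 <= f x + B - stair e N (f x + B) <= e.
    apply: stairP => //; first by lra.
    rewrite mulrSr mulrDl mul1r; lra.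
  by move=> ? ?; rewrite ger0_norm; lra.
pose SX := [set f : X -> R[i] | exists2 A, measurable A & f = cind A].
rewrite (_ : s = fun x => (stair e N (f x + B))%:C - B%:C); last first.
  by apply/funext => x; rewrite /s ofrealB.
apply: combB; last first.
  rewrite (_ : (fun _ => _) = (fun x : X => B%:C * cind setT x)).
    by apply: combZ; apply: comb_gen; exists setT.
  by apply/funext => x; rewrite /cind indicT mulr1.
rewrite /stair (_ : (fun x => _) = (fun x => \sum_(j < N)
   (if j.+1%:R * e <= f x + B then e else 0)%:C)); last first.
  by apply/funext => x; rewrite ofreal_sum.
apply: comb_sum => j.
pose A := [set x | j.+1%:R * e <= f x + B].
have mA : measurable A.
  have mfB : measurable_fun setT (fun x => f x + B).
    by apply: measurable_funD => //; exact: measurable_cst.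
  have := mfB measurableT `[j.+1%:R * e, +oo[%classic (measurable_itv _).
  by rewrite setTI; congr measurable; apply/seteqP; split => x; rewrite /A /= in_itv /= andbT.
rewrite (_ : (fun x => _) = (fun x : X => e%:C * cind A x)).
  by apply: combZ; apply: comb_gen; exists A.
apply/funext => x; rewrite /cind indicE /A mem_setE.
by rewrite -[_ \in _]/(j.+1%:R * e <= f x + B); case: ifP => _; rewrite ?mulr1 ?mulr0.
Qed.

Lemma simple_uniform (g : X -> R[i]) (B e : R) : cmeasurable setT g -> 0 < e ->
  (forall x, sqnormc (g x) <= B) ->
  exists2 s, comb [set f | exists2 A : set X, measurable A & f = cind A] s &
    forall x, sqnormc (g x - s x) <= e.
Proof.
move=> [g1 g2] e0 gB.
(* Real and imaginary part will each be within [dl]. The squared error is then at most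
   [2 * dl ^+ 2], and [dl <= 1] bounds this by [2 * dl <= e]. *)
pose dl := Num.min 1 (e / 2).
have d0 : 0 < dl by rewrite lt_min ltr01 divr_gt0.
have d2 : 2 * dl ^+ 2 <= e.
  have d1 : dl <= 1 by rewrite /dl ge_min lexx.
  have dh : dl <= e / 2 by rewrite /dl ge_min lexx orbT.
  have : dl ^+ 2 <= dl by rewrite expr2 ler_piMl // ltW.
  lra.
have sqB x (t : R) : t ^+ 2 <= sqnormc (g x) -> `|t| <= B + 1.
  move=> tg; have Bx : 0 <= B := le_trans (sqnormc_ge0 _) (gB x).
  have := le_trans tg (gB x); rewrite -real_normK ?num_real // => h.
  by have := normr_ge0 t; move: h; rewrite expr2; nra.
have [s1 c1 S1] := real_simple g1 d0 (fun x => sqB x _ (Re_sq_le _)).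
have [s2 c2 S2] := real_simple g2 d0 (fun x => sqB x _ (Im_sq_le _)).
exists (fun x => s1 x + (0 +i* 1) * s2 x); first by apply: combD => //; exact: combZ.
move=> x; have [r1 -> R1] := S1 x; have [r2 -> R2] := S2 x.
apply: (le_trans _ d2); rewrite sqnormcE !(cReD, cImD, cReN, cImN, cReM, cImM) /=.
rewrite !(mul0r, mul1r, mulr0, subr0, addr0, add0r, sub0r).
have sq (t : R) : `|t| <= dl -> t ^+ 2 <= dl ^+ 2.
  by move=> td; rewrite -real_normK ?num_real // ler_sqr ?nnegrE // ltW.
have -> : 2 * dl ^+ 2 = dl ^+ 2 + dl ^+ 2 by ring.
by apply: lerD; apply: sq => //; rewrite oppr0 addr0.
Qed.

Lemma L2_cind (m : {measure set X -> \bar R}) (A : set X) (g : X -> R[i]) :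
  measurable A -> L2 m g -> L2 m (fun x => cind A x * g x).
Proof.
move=> mA; apply: (L2_mul_bounded (b := cind A) (B := 1)).
  by apply: cmeasurable_real; exact: measurable_indic.
by move=> x; rewrite sqnormc_real indicE; case: (_ \in _); rewrite ?expr1n ?expr0n.
Qed.

(** Dominated convergence with majorant [|g|^2]. It serves truncation in time, truncation in size
    and the passage to countable unions. *)
Lemma nrm_cut (m : {measure set X -> \bar R}) (g : X -> R[i]) (A : nat -> set X) (e : R) :
  L2 m g -> (forall n, measurable (A n)) -> (forall x, \forall n \near \oo, A n x) -> 0 < e ->
  \forall n \near \oo, nrm m (fun x => g x - cind (A n) x * g x) < e.
Proof.
move=> g2 mA Ax e0; have [mg _] := g2.
pose f_ n x := (sqnormc (g x - cind (A n) x * g x))%:E.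
have fE n x : f_ n x = if x \in A n then 0%E else (sqnormc (g x))%:E.
  rewrite /f_ /cind indicE; case: (x \in A n); first by rewrite mul1r subrr sqnormc0.
  by rewrite mul0r subr0.
have mf n : measurable_fun setT (f_ n).
  apply/measurable_EFinP; apply: measurable_sqnormc; apply: cmeasurableB => //.
  by apply: cmeasurableM => //; apply: cmeasurable_real; exact: measurable_indic.
have f0 x : setT x -> f_ ^~ x @ \oo --> 0%E.
  move=> _; apply: cvg_near_cst; apply: filterS (Ax x) => n Anx.
  by rewrite fE mem_set.
have := @dominated_cvg _ _ _ m setT measurableT f_ (cst 0%E) (fun x => (sqnormc (g x))%:E)
  mf f0 (fun x _ => erefl) (L2_int g2).
rewrite integral0 => H.
have : (fun n => (\int[m]_x f_ n x)%E) @ \oo --> 0%E.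
  apply: H => n x _; rewrite fE; case: ifP => _; first by rewrite abse0 lee_fin sqnormc_ge0.
  by rewrite gee0_abs ?lee_fin ?sqnormc_ge0.
have e0E : (0 < e%:E)%E by rewrite lte_fin.
move=> /(_ _ (open_ereal_lt' e0E)) [n0 _ Hn0]; exists n0 => // n /Hn0 /= He.
rewrite -lte_fin /nrm fineK // ge0_fin_numE ?L2sq_ge0 //.
exact: lt_trans He (ltry _).
Qed.

End SimpleApproximation.

Section SpanLimits.
Context {R : realType} d {X : measurableType d} (m : {measure set X -> \bar R}).
Variable S : set (X -> R[i]).

Definition span_limit (f : X -> R[i]) : Prop := L2 m f /\
  forall e : R, 0 < e -> exists2 s, comb S s & nrm m (fun t => f t - s t) < e.

Hypothesis S2 : forall f, S f -> L2 m f.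

Lemma L2_comb s : comb S s -> L2 m s.
Proof. by move=> [k [c [p [Sp ->]]]]; apply: L2_sum => i; apply: L2Z; exact: S2. Qed.

Lemma span_limit_comb s : comb S s -> span_limit s.
Proof.
move=> cs; have s2 := L2_comb cs; split=> // e e0; exists s => //.
rewrite (_ : (fun t => _) = (fun=> 0)); last by apply/funext => t; rewrite subrr.
by rewrite /nrm /L2sq; under eq_integral do rewrite sqnormc0; rewrite integral0.
Qed.

Lemma span_limit_closed f : L2 m f ->
  (forall e : R, 0 < e -> exists2 g, span_limit g & nrm m (fun t => f t - g t) < e) ->
  span_limit f.
Proof.
move=> f2 H; split=> // e e0; have e4 : 0 < e / 4 by lra.
have [g [g2 gs] fg] := H _ e4; have [s cs gse] := gs _ e4; exists s => //.
have s2 := L2_comb cs.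
rewrite (_ : (fun t => _) = (fun t => (f t - g t) + (g t - s t))).
  by apply: (le_lt_trans (nrmD_le (L2B f2 g2) (L2B g2 s2))); exact: add_quarters.
by apply/funext => t; rewrite addrA subrK.
Qed.

Lemma span_limitD f g : span_limit f -> span_limit g -> span_limit (fun t => f t + g t).
Proof.
move=> [f2 fs] [g2 gs]; split; first exact: L2D.
move=> e e0; have e4 : 0 < e / 4 by lra.
have [s cs fse] := fs _ e4; have [s' cs' gse] := gs _ e4.
exists (fun t => s t + s' t); first exact: combD.
rewrite (_ : (fun t => _) = (fun t => (f t - s t) + (g t - s' t))).
  apply: (le_lt_trans (nrmD_le (L2B f2 (L2_comb cs)) (L2B g2 (L2_comb cs')))).
  exact: add_quarters.
by apply/funext => t; rewrite opprD addrACA.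
Qed.

Lemma span_limitZ z f : span_limit f -> span_limit (fun t => z * f t).
Proof.
move=> [f2 fs]; split; first exact: L2Z.
move=> e e0; have z0 := sqnormc_ge0 z.
have ez : 0 < e / (sqnormc z + 1) by rewrite divr_gt0 //; lra.
have [s cs fse] := fs _ ez; exists (fun t => z * s t); first exact: combZ.
rewrite (_ : (fun t => _) = (fun t => z * (f t - s t))); last first.
  by apply/funext => t; rewrite mulrBr.
rewrite nrmZ; last exact: L2B (L2_comb cs).
rewrite ltr_pdivlMr in fse; last by lra.
by have := nrm_ge0 m (fun t => f t - s t); nra.
Qed.

Lemma span_limitB f g : span_limit f -> span_limit g -> span_limit (fun t => f t - g t).
Proof.
move=> fs gs; have := span_limitD fs (span_limitZ (-1) gs).
by under [X in span_limit X -> _]eq_fun do rewrite mulN1r.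
Qed.

Lemma span_limit_sum k (f : 'I_k -> X -> R[i]) : (forall i, span_limit (f i)) ->
  span_limit (fun t => \sum_(i < k) f i t).
Proof.
elim: k f => [|k IH] f cf.
  by under eq_fun do rewrite big_ord0; apply: span_limit_comb; exact: comb0.
by under eq_fun do rewrite big_ord_recr /=; apply: span_limitD => //; exact: IH.
Qed.

End SpanLimits.
Arguments span_limit {R d X} m S f.

(** * Density of step functions and the Plancherel theorem *)

Section StepDensity.
Context {R : realType}.
Local Notation RR := (measurableTypeR R).
Variables (al be : R).
Hypothesis ab : al <= be.
Local Notation I := (`]al, be]%classic : set RR).

Definition steps : set (R -> R[i]) :=
  [set f | exists x y, [/\ al <= x, x <= y, y <= be & f = itvf x y]].

Local Notation step_limit := (span_limit (leb R) steps).

Lemma L2_steps s : steps s -> L2 (leb R) s.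
Proof. by move=> [x [y [_ _ _ ->]]]; exact: L2_itvf. Qed.

Lemma L2_comb_steps s : comb steps s -> L2 (leb R) s.
Proof. by move=> cs; exact: (L2_comb (X := RR) (S := steps) L2_steps cs). Qed.

Lemma integrable_cind_itv : (leb R).-integrable setT (fun t : RR => (\1_I t)%:E).
Proof. by have := L2_int (L2_itvf al be); under eq_fun do rewrite sqnormc_itvf. Qed.

Lemma L2_cind_itv (A : set RR) : measurable A -> L2 (leb R) (cind (A `&` I)).
Proof.
move=> mA; apply: (int_L2 (h := \1_I)).
- by apply: cmeasurable_real; apply: measurable_indic; exact: measurableI.
- exact: integrable_cind_itv.
- move=> t; rewrite sqnormc_real !indicE in_setI.
  by case: (t \in A) => /=; case: (t \in I) => /=; rewrite ?expr1n ?expr0n.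
Qed.

Let cindI (x y : R) : al <= be -> step_limit (cind (`]x, y]%classic `&` I)).
Proof.
move=> _; have [xy|xy] := leP (Num.max x al) (Num.min y be).
  apply: (span_limit_comb (X := RR) L2_steps); apply: comb_gen; exists (Num.max x al), (Num.min y be).
  split=> //; [by rewrite le_max lexx orbT|by rewrite ge_min lexx orbT|].
  apply/funext => t; rewrite /cind /itvf !indicE in_setI !mem_setE !in_itv /= gt_max le_min.
  by case: (x < t); case: (al < t); case: (t <= y); case: (t <= be).
rewrite (_ : cind _ = (fun=> 0)); first by apply: (span_limit_comb (X := RR) L2_steps); exact: comb0.
apply/funext => t; rewrite /cind indicE memNset //= !in_itv /= => -[/andP[t1 t2] /andP[t3 t4]].
have : Num.max x al < Num.min y be by rewrite lt_min !gt_max; move: t1 t2 t3 t4 xy => *; lra.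
by rewrite ltNge ltW.
Qed.

(** The sets whose trace on []al, be]] has an indicator approximable by steps form a Dynkin system,
    and it contains the half-open intervals, which are stable under intersection and generate the
    Borel sets. *)
Lemma step_limit_cind (A : set RR) : measurable A -> step_limit (cind (A `&` I)).
Proof.
move=> mA; move: A mA; apply: (@dynkin_induction _ RR (@ocitv R) (fun A => step_limit (cind (A `&` I)))) => //.
- exact: ocitvI.
- rewrite setTI; apply: (span_limit_comb (X := RR) L2_steps); apply: comb_gen; exists al, be; split=> //.
- move=> A /ocitvP[->|[[x y] _ ->]]; last exact: cindI.
  rewrite set0I (_ : cind _ = (fun=> 0)); first by apply: (span_limit_comb (X := RR) L2_steps); exact: comb0.
  by apply/funext => t; rewrite /cind indic0.
- move=> A mA HA; have HI : step_limit (itvf al be).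
    by apply: (span_limit_comb (X := RR) L2_steps); apply: comb_gen; exists al, be.
  have := span_limitB (X := RR) L2_steps HI HA; congr step_limit; apply/funext => t.
  rewrite /itvf /cind !indicE !in_setI in_setC -ofrealB; congr (_%:C).
  by case: (t \in A); case: (t \in I) => /=; rewrite ?subr0 ?subrr.
- move=> F mF tF HF; set U := \bigcup_k F k.
  have mU : measurable U by exact: bigcup_measurable.
  pose V n := \big[setU/set0]_(k < n) F k.
  have mV n : measurable (V n) by exact: bigsetU_measurable.
  have HV n : step_limit (cind (V n `&` I)).
    elim: n => [|n IH].
      rewrite /V big_ord0 set0I (_ : cind _ = (fun=> 0)); first by apply: (span_limit_comb (X := RR) L2_steps); exact: comb0.
      by apply/funext => t; rewrite /cind indic0.
    have := span_limitD (X := RR) L2_steps IH (HF n); congr step_limit; apply/funext => t.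
    rewrite /V big_ord_recr /= -/(V n) /cind !indicE setIUl in_setU.
    have [tV|tV] := boolP (t \in V n `&` I); have [tn|tn] := boolP (t \in F n `&` I) => //=; rewrite ?addr0 ?add0r //.
    move: tV tn; rewrite !inE /V -bigcup_mkord => -[[k /= kn Fk] _] [Fn _].
    have E := tF k n Logic.I Logic.I (ex_intro _ t (conj Fk Fn)).
    by move: kn; rewrite E ltnn.
  have U2 := L2_cind_itv mU.
  apply: (span_limit_closed (X := RR) L2_steps) => // e e0.
  (* [nrm_cut] needs sets that eventually contain every point. Adjoining the complement of [U]
     achieves this and changes nothing, since the function vanishes there. *)
  have mC n : measurable (V n `|` ~` U) by apply: measurableU => //; exact: measurableC.
  have Cx (t : RR) : \forall n \near \oo, (V n `|` ~` U) t.
    have [[k _ Fk]|Ut] := pselect (U t); last by near=> n; right.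
    exists k.+1 => // n /= kn; left; rewrite /V -bigcup_mkord; exists k => //.
  have [n _ /(_ n (leqnn n)) Hn] := nrm_cut U2 mC Cx e0.
  exists (cind (V n `&` I)) => //; apply: le_lt_trans Hn; rewrite le_eqVlt; apply/orP; left.
  apply/eqP; congr (nrm _ _); apply/funext => t; congr (_ - _).
  rewrite /cind !indicE !in_setI in_setU in_setC -ofrealM; congr (_%:C).
  have VU : t \in V n -> t \in U.
    by rewrite !inE /V -bigcup_mkord => -[k _ Fk]; exists k.
  case: (t \in V n) VU => [/(_ isT) ->|_] /=; case: (t \in U); case: (t \in I) => /=; rewrite ?mulr0 ?mulr1 ?mul0r //.
Unshelve. all: by end_near.
Qed.

(** Large values are cut off, the bounded remainder is approximated uniformly by a simple function,
    and the finite length of []al, be]] turns the uniform error into an [L2] error. *)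
Lemma step_dense f : L2 (leb R) f -> (forall t, ~ I t -> f t = 0) -> step_limit f.
Proof.
move=> f2 f0; apply: (span_limit_closed (X := RR) L2_steps) => // e e0; have [mf _] := f2.
pose A (n : nat) : set RR := [set t | sqnormc (f t) <= n%:R].
have mA n : measurable (A n).
  have mq := measurable_sqnormc mf; have := mq measurableT `]-oo, n%:R]%classic (measurable_itv _).
  by rewrite setTI; congr measurable; apply/seteqP; split => x; rewrite /A /= in_itv.
have Ax (t : RR) : \forall n \near \oo, A n t.
  exists (Num.truncn (sqnormc (f t))).+1 => // n /= tn; apply: ltW.
  by apply: (lt_le_trans (truncnS_gt _)); rewrite ler_nat.
have [n _ /(_ n (leqnn n)) Hn] := nrm_cut f2 mA Ax e0.
have mI : measurable I by exact: measurable_itv.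
have fn2 : L2 (leb R) (fun x => cind (A n) x * f x).
  exact: L2_cind.
exists (fun x => cind (A n) x * f x) => //; apply: (span_limit_closed (X := RR) L2_steps) => // d d0.
(* The [1] keeps the denominator positive when [al = be] and makes the final inequality strict. *)
pose d' := d / (be - al + 1).
have ba : 0 < be - al + 1 by move: ab; lra.
have d'0 : 0 < d' by exact: divr_gt0.
have fB x : sqnormc (cind (A n) x * f x) <= n%:R.
  rewrite /cind indicE; have [xA|xA] := boolP (x \in A n).
    by rewrite mul1r; rewrite inE in xA.
  by rewrite mul0r sqnormc0.
have [s [k [c [p [Sp ->]]]] sE] := simple_uniform fn2.1 d'0 fB.
have [B HB] : exists B : 'I_k -> set RR, forall i, measurable (B i) /\ p i = cind (B i).
  have /choice[B HB] : forall i, exists B : set RR, measurable B /\ p i = cind B.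
    by move=> i; have [B mB pB] := Sp i; exists B.
  by exists B.
exists (fun x => \sum_(i < k) c i * cind (B i `&` I) x).
  apply: (span_limit_sum (X := RR) L2_steps) => i; apply: (span_limitZ (X := RR) L2_steps); apply: step_limit_cind.
  by case: (HB i).
have g2 : L2 (leb R) (fun x => cind (A n) x * f x - \sum_(i < k) c i * cind (B i `&` I) x).
  apply: L2B => //; apply: L2_sum => i; apply: L2Z; apply: L2_cind_itv.
  by case: (HB i).
have Iint : (leb R).-integrable setT (fun x : RR => (d' * \1_I x)%:E).
  exact: (integrableZl measurableT d' integrable_cind_itv).
have le1 : nrm (leb R) (fun x => cind (A n) x * f x - \sum_(i < k) c i * cind (B i `&` I) x)
    <= \int[leb R]_x (d' * \1_I x).
  apply: le_Rintegral => //; first exact: L2_int.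
  move=> x _; rewrite indicE; have [xI|xI] := boolP (x \in I).
    rewrite mulr1; have := sE x; rewrite (eq_bigr (fun i => c i * cind (B i `&` I) x)) //.
    by move=> i _; rewrite (HB i).2 /cind !indicE in_setI xI andbT.
  rewrite mulr0 f0 ?mulr0; last by move=> h; move/negP: xI; apply; rewrite inE.
  rewrite big1 ?subr0 ?sqnormc0 // => i _.
  by rewrite /cind indicE in_setI (negbTE xI) andbF mulr0.
apply: (le_lt_trans le1).
have -> : \int[leb R]_x (d' * \1_I x) = d' * (be - al).
  rewrite RintegralZl //; last exact: integrable_cind_itv.
  rewrite /Rintegral integral_indic // setIT /= lebesgue_measure_itv /= lte_fin.
  case: ltP => //= h; have -> : be = al by apply/eqP; rewrite eq_le h ab.
  by rewrite subrr.
by rewrite /d' mulrAC ltr_pdivrMr // ltr_pM2l // ltrDl.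
Qed.

End StepDensity.

Lemma cvg_sq {R : realType} (u : nat -> R) (x C : R) :
  (forall n, (x - u n) ^+ 2 <= C / n.+1%:R) -> u @ \oo --> x.
Proof.
move=> H; apply/cvgrPdist_le => e e0.
exists (Num.truncn (C / e ^+ 2)).+1 => // n /= hn.
rewrite -ler_sqr ?nnegrE ?(ltW e0) // real_normK ?num_real //.
apply: le_trans (H n) _; rewrite ler_pdivrMr // mulrC -ler_pdivrMr ?exprn_gt0 //.
apply: ltW; apply: (lt_le_trans (truncnS_gt _)); rewrite ler_nat.
exact: leqW.
Qed.

Section Plancherel.
Context {R : realType}.
Local Notation RR := (measurableTypeR R).
Implicit Types k K phi : R -> R[i].

(** Bounded support makes such functions integrable, so for them [fhat] is an absolutely convergent
    integral. *)
Definition L2b k : Prop := L2 (leb R) k /\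
  exists2 N : R, 0 <= N & forall t, ~ (- N <= t <= N) -> k t = 0.

Lemma L2b_itv k : L2b k -> exists al be : R, al <= be /\
  forall t, ~ (`]al, be]%classic : set R) t -> k t = 0.
Proof.
move=> [_ [N N0 kN]]; exists (- N - 1), N; split; first by lra.
move=> t H; apply: kN => /andP[h1 h2]; apply: H; rewrite /= in_itv /= h2 andbT; lra.
Qed.

Lemma L2b_comb al be s : comb (steps al be) s -> L2b s.
Proof.
move=> cs; split; first exact: L2_comb_steps cs.
have [k [c [p [Sp ->]]]] := cs.
exists (`|al| + `|be|); first by rewrite addr_ge0.
move=> t H; rewrite big1 // => i _; have [x [y [h1 h2 h3 ->]]] := Sp i.
rewrite /itvf indicE memNset ?mulr0 // /= in_itv /= => /andP[h4 h5]; apply: H.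
have := ler_norm (- al); rewrite normrN => h6; have := ler_norm be => h7.
by have := normr_ge0 al; have := normr_ge0 be => ? ?; apply/andP; split; lra.
Qed.

Lemma L2bD k k' : L2b k -> L2b k' -> L2b (fun t => k t + k' t).
Proof.
move=> [k2 [N N0 kN]] [k2' [N' N0' kN']]; split; first exact: L2D.
exists (N + N'); first exact: addr_ge0.
by move=> t H; rewrite kN ?kN' ?addr0 // => /andP[h1 h2]; apply: H; apply/andP; split; lra.
Qed.

Lemma L2bZ z k : L2b k -> L2b (fun t => z * k t).
Proof.
move=> [k2 [N N0 kN]]; split; first exact: L2Z.
by exists N => // t H; rewrite kN ?mulr0.
Qed.

Lemma L2bB k k' : L2b k -> L2b k' -> L2b (fun t => k t - k' t).
Proof.
move=> bk bk'; have := L2bD bk (L2bZ (-1) bk').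
by under eq_fun do rewrite mulN1r.
Qed.

Lemma cmeasurable_phase (l : R) : cmeasurable (setT : set RR) (fun t : RR => expi (- (l * t)) : R[i]).
Proof.
apply: cmeasurable_expi; apply: measurable_funN_real.
by apply: measurable_funM => //; exact: measurable_cst.
Qed.

Lemma cintegrable_phase k (l : R) : cintegrable (leb R) setT k ->
  cintegrable (leb R) setT (fun t => k t * expi (- (l * t))).
Proof.
move=> ik; apply: (cintegrable_le (h := fun t : RR => ComplexField.Normc.normc (k t))).
- by apply: cmeasurableM; [exact: cintegrable_cmeasurable ik|exact: cmeasurable_phase].
- exact: cintegrable_normc.
- by move=> t; rewrite normcM normc_expi mulr1.
Qed.

Lemma L2b_mul_itv k al be : (forall t, ~ (`]al, be]%classic : set R) t -> k t = 0) ->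
  k = fun t => k t * itvf al be t.
Proof.
move=> k0; apply/funext => t; rewrite /itvf indicE.
case: (boolP (t \in _)) => [|tI]; first by rewrite mulr1.
by rewrite mulr0 k0 // => /mem_set h; rewrite h in tI.
Qed.

Lemma L2b_cintegrable k : L2b k -> cintegrable (leb R) setT k.
Proof.
move=> bk; have [al [be [ab k0]]] := L2b_itv bk; rewrite (L2b_mul_itv k0).
by apply: L2M_cintegrable; [case: bk|exact: L2_itvf].
Qed.

Lemma fhatD k k' l : cintegrable (leb R) setT k -> cintegrable (leb R) setT k' ->
  fhat (fun t => k t + k' t) l = fhat k l + fhat k' l.
Proof.
move=> ik ik'; rewrite /fhat -cintegralD; try exact: cintegrable_phase.
by congr cintegral; apply/funext => t; rewrite mulrDl.
Qed.

Lemma fhatZ z k l : cintegrable (leb R) setT k -> fhat (fun t => z * k t) l = z * fhat k l.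
Proof.
move=> ik; rewrite /fhat -cintegralZ; last exact: cintegrable_phase.
by congr cintegral; apply/funext => t; rewrite mulrA.
Qed.

Lemma fhatB k k' l : cintegrable (leb R) setT k -> cintegrable (leb R) setT k' ->
  fhat (fun t => k t - k' t) l = fhat k l - fhat k' l.
Proof.
move=> ik ik'; rewrite /fhat -cintegralB; try exact: cintegrable_phase.
by congr cintegral; apply/funext => t; rewrite mulrBl.
Qed.

Lemma fhat_sum n (k : 'I_n -> R -> R[i]) l : (forall i, cintegrable (leb R) setT (k i)) ->
  fhat (fun t => \sum_(i < n) k i t) l = \sum_(i < n) fhat (k i) l.
Proof.
move=> ik; rewrite /fhat -cintegral_sum => [|i]; last exact: cintegrable_phase.
by congr cintegral; apply/funext => t; rewrite mulr_suml.
Qed.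

Definition itv_pairs : set ((RR -> R[i]) * (RR -> R[i])) :=
  [set p | exists x y, x <= y /\ p = (itvf x y, fhat (itvf x y))].

Lemma itv_pairs_L21 p : itv_pairs p -> L2 (leb R) p.1.
Proof. by move=> [x [y [xy ->]]]; exact: L2_itvf. Qed.

Lemma itv_pairs_L22 p : itv_pairs p -> L2 (leb R) p.2.
Proof. by move=> [x [y [xy ->]]]; exact: L2_fhat_itvf. Qed.

Lemma itv_pairs_gram p q : itv_pairs p -> itv_pairs q ->
  ip (leb R) p.2 q.2 = (2 * pi)%:C * ip (leb R) p.1 q.1.
Proof. by move=> [x [y [xy ->]]] [x' [y' [xy' ->]]]; exact: ip_fhat_itvf. Qed.

Lemma simul_approx_step al be s : comb (steps al be) s ->
  simul_approx (leb R) (leb R) itv_pairs s (fhat s).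
Proof.
move=> cs; have bs := L2b_comb cs; split; first by case: bs => [[]].
  by apply: cmeasurable_fhat; case: bs => [[]].
move=> e e0; have [k [c [p [Sp sE]]]] := cs.
exists k, c, (fun i => (p i, fhat (p i))).
have e0' : (L2sq (leb R) setT (fun=> 0%R) < e%:E)%E.
  by rewrite /L2sq; under eq_integral do rewrite sqnormc0; rewrite integral0 lte_fin.
split=> /=.
- by move=> i; have [x [y [_ xy _ ->]]] := Sp i; exists x, y.
- by rewrite (_ : (fun x => _) = fun=> 0) //; apply/funext => x; rewrite sE subrr.
- rewrite (_ : (fun x => _) = fun=> 0) //; apply/funext => l.
  have ip_ i : cintegrable (leb R) setT (p i).
    apply: L2b_cintegrable; apply: (L2b_comb (al := al) (be := be)).
    exact: comb_gen.
  rewrite sE fhat_sum => [|i]; last exact: cintegrableZ.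
  by apply/eqP; rewrite subr_eq0; apply/eqP; apply: eq_bigr => i _; rewrite fhatZ.
Qed.

Lemma nrm_fhat_step al be s : comb (steps al be) s ->
  L2 (leb R) (fhat s) /\ nrm (leb R) (fhat s) = 2 * pi * nrm (leb R) s.
Proof.
move=> /simul_approx_step H; split.
  by have [] := simul_approx_L2 itv_pairs_L21 itv_pairs_L22 H.
exact: (simul_approx_nrm itv_pairs_L21 itv_pairs_L22 itv_pairs_gram H).
Qed.

Lemma nrm_itvf (al be : R) : al <= be -> nrm (leb R) (itvf al be) = be - al.
Proof.
move=> ab; have := ip_itvf al be al be; rewrite ipgg => -[->].
by rewrite /overlap minxx maxxx; case: lerP => // h; lra.
Qed.

Lemma sqnormc_fhat_le k al be l : al <= be -> L2 (leb R) k ->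
  (forall t, ~ (`]al, be]%classic : set R) t -> k t = 0) ->
  sqnormc (fhat k l) <= nrm (leb R) k * (be - al).
Proof.
move=> ab k2 k0.
have k2' : L2 (leb R) (fun t => expi (- (l * t)) * k t).
  apply: (L2_mul_bounded (B := 1)) => //; first exact: cmeasurable_phase.
  by move=> t; rewrite sqnormc_expi.
have -> : fhat k l = ip (leb R) (fun t => expi (- (l * t)) * k t) (itvf al be).
  rewrite /fhat /ip {1}(L2b_mul_itv k0); congr cintegral; apply/funext => t.
  by rewrite itvf_conj; ring.
have -> : nrm (leb R) k = nrm (leb R) (fun t => expi (- (l * t)) * k t).
  by congr fine; apply: eq_integral => t _; rewrite sqnormcM sqnormc_expi mul1r.
rewrite -nrm_itvf //.
exact: ip_CauchySchwarz (L2_itvf _ _).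
Qed.

Lemma limn_einf_le (u : nat -> \bar R) (B : \bar R) : (forall n, (u n <= B)%E) ->
  (limn_einf u <= B)%E.
Proof.
move=> uB; rewrite limn_einf_lim; apply: lime_le; first exact: is_cvg_einfs.
apply: nearW => n; apply: le_trans (uB n); apply: ereal_inf_lbound.
by exists n => /=.
Qed.

(** Steps converging to [k] in [L2] on a fixed interval have pointwise convergent transforms, and
    Fatou's lemma bounds the limit. The constant is twice the sharp one, the price of [nrmB_le]; the
    sharp constant is recovered in [FT_pair_nrm]. *)
Lemma L2sq_fhat_le k : L2b k ->
  (L2sq (leb R) setT (fhat k) <= (4 * pi * nrm (leb R) k)%:E)%E.
Proof.
move=> bk; have [al [be [ab k0]]] := L2b_itv bk; have [k2 _] := bk.
have pi0 := pi_gt0 R.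
apply/lee_addgt0Pr => e e0; rewrite -EFinD.
have [_ dk] := step_dense ab k2 k0.
(* The first bound keeps the final excess below [e], the second forces pointwise convergence of the
   transforms. *)
pose ep (n : nat) : R := Num.min (e / (4 * pi)) n.+1%:R^-1.
have ep0 n : 0 < ep n by rewrite lt_min invr_gt0 ltr0n andbT divr_gt0 // mulr_gt0.
have /choice[s sP] : forall n, exists s, comb (steps al be) s /\
    nrm (leb R) (fun t => k t - s t) < ep n.
  by move=> n; have [s cs ks] := dk _ (ep0 n); exists s.
have s0 n t : ~ (`]al, be]%classic : set R) t -> s n t = 0.
  have [[m [c [p [Sp ->]]]] _] := sP n; move=> tI; rewrite big1 // => i _.
  have [x [y [h1 h2 h3 ->]]] := Sp i.
  rewrite /itvf indicE memNset ?mulr0 // /= in_itv /= => /andP[h4 h5]; apply: tI.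
  by rewrite /= in_itv /=; apply/andP; split; lra.
have s2 n := L2_comb_steps (sP n).1.
have lim l : (fun n => (sqnormc (fhat (s n) l))%:E) @ \oo --> (sqnormc (fhat k l))%:E.
  apply: cvg_EFin; first exact: nearW.
  have dl n : sqnormc (fhat k l - fhat (s n) l) <= (be - al) / n.+1%:R.
    have bs := L2b_comb (sP n).1.
    rewrite -fhatB; [|exact: L2b_cintegrable|exact: L2b_cintegrable].
    apply: le_trans (sqnormc_fhat_le l ab (L2B k2 (s2 n)) _) _.
      by move=> t tI; rewrite k0 // s0 // subr0.
    rewrite mulrC ler_wpM2l ?subr_ge0 //; apply: ltW; apply: (lt_le_trans (sP n).2).
    by rewrite /ep ge_min lexx orbT.
  have cRe : (fun n => complex.Re (fhat (s n) l)) @ \oo --> complex.Re (fhat k l).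
    apply: (cvg_sq (C := be - al)) => n; apply: le_trans (dl n).
    by rewrite -cReN -cReD; exact: Re_sq_le.
  have cIm : (fun n => complex.Im (fhat (s n) l)) @ \oo --> complex.Im (fhat k l).
    apply: (cvg_sq (C := be - al)) => n; apply: le_trans (dl n).
    by rewrite -cImN -cImD; exact: Im_sq_le.
  rewrite sqnormcE !expr2; under eq_fun do rewrite /= sqnormcE !expr2.
  by apply: cvgD; exact: cvgM.
have -> : L2sq (leb R) setT (fhat k) =
    (\int[leb R]_l limn_einf (fun n => (sqnormc (fhat (s n) l))%:E))%E.
  by apply: eq_integral => l _; rewrite (cvg_limn_einf_sup (lim l)).
have mfs n : cmeasurable (setT : set RR) (fhat (s n)) by apply: cmeasurable_fhat; case: (s2 n).
apply: le_trans (fatou (leb R) measurableT (f := fun n l => (sqnormc (fhat (s n) l))%:E) _ _) _.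
- by move=> n; apply/measurable_EFinP; exact: measurable_sqnormc.
- by move=> n l _; rewrite lee_fin sqnormc_ge0.
apply: limn_einf_le => n; have [fs2 fsn] := nrm_fhat_step (sP n).1.
have := L2sqE fs2; rewrite /L2sq => ->; rewrite lee_fin fsn.
have h1 : nrm (leb R) (s n) <= 2 * nrm (leb R) k + 2 * ep n.
  have : nrm (leb R) (fun t => k t - (k t - s n t)) <= _ := nrmB_le k2 (L2B k2 (s2 n)).
  under [in nrm _ _]eq_fun do rewrite subKr.
  by have := (sP n).2; lra.
have h2 : 4 * pi * ep n <= e.
  have : ep n <= e / (4 * pi) by rewrite /ep ge_min lexx.
  by rewrite ler_pdivlMr ?mulr_gt0 // mulrC.
have := ler_wpM2l (mulr_ge0 (ler0n R 2) (ltW pi0)) h1; lra.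
Qed.

Lemma L2_fhat k : L2b k -> L2 (leb R) (fhat k).
Proof.
move=> bk; split; first by apply: cmeasurable_fhat; case: bk => [[]].
by apply: (le_lt_trans (L2sq_fhat_le bk)); exact: ltry.
Qed.

Lemma nrm_fhat_le k : L2b k -> nrm (leb R) (fhat k) <= 4 * pi * nrm (leb R) k.
Proof. by move=> bk; have := L2sq_fhat_le bk; rewrite L2sqE ?lee_fin //; exact: L2_fhat. Qed.

Lemma simul_approx_closure k K : L2 (leb R) k -> L2 (leb R) K ->
  (forall e : R, 0 < e -> exists al be s, [/\ comb (steps al be) s,
     nrm (leb R) (fun t => k t - s t) < e & nrm (leb R) (fun t => K t - fhat s t) < e]) ->
  simul_approx (leb R) (leb R) itv_pairs k K.
Proof.
move=> k2 K2 H; split; [by case: k2|by case: K2|move=> e e0].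
have e4 : 0 < e / 4 by lra.
have [al [be [s [cs ks Ks]]]] := H _ e4.
have s2 := L2_comb_steps cs; have [fs2 _] := nrm_fhat_step cs.
have [_ _ /(_ _ e4)[n [c [p [Gp p1 p2]]]]] := simul_approx_step cs.
have q1 : L2 (leb R) (fun x => \sum_(i < n) c i * (p i).1 x).
  by apply: L2_sum => i; apply: L2Z; exact: itv_pairs_L21.
have q2 : L2 (leb R) (fun x => \sum_(i < n) c i * (p i).2 x).
  by apply: L2_sum => i; apply: L2Z; exact: itv_pairs_L22.
rewrite L2sqE in p1; last exact: L2B. rewrite L2sqE in p2; last exact: L2B.
rewrite !lte_fin in p1 p2.
exists n, c, p; split=> //.
- rewrite L2sqE ?lte_fin; last exact: L2B.
  rewrite (_ : (fun x => _) = (fun t => (k t - s t) + (s t - \sum_(i < n) c i * (p i).1 t))).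
    by apply: (le_lt_trans (nrmD_le (L2B k2 s2) (L2B s2 q1))); exact: add_quarters.
  by apply/funext => t; rewrite addrA subrK.
- rewrite L2sqE ?lte_fin; last exact: L2B.
  rewrite (_ : (fun x => _) = (fun t => (K t - fhat s t) + (fhat s t - \sum_(i < n) c i * (p i).2 t))).
    by apply: (le_lt_trans (nrmD_le (L2B K2 fs2) (L2B fs2 q2))); exact: add_quarters.
  by apply/funext => t; rewrite addrA subrK.
Qed.

(* L2 pairs (function, Fourier transform); unlike is_fourier, closed under limits by construction. *)
Definition FT_pair k K : Prop := [/\ L2 (leb R) k, L2 (leb R) K &
  forall e : R, 0 < e -> exists k', [/\ L2b k',
     nrm (leb R) (fun t => k t - k' t) < e & nrm (leb R) (fun t => K t - fhat k' t) < e]].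

Lemma FT_pair_L2b k : L2b k -> FT_pair k (fhat k).
Proof.
move=> bk; split; [by case: bk|exact: L2_fhat|move=> e e0; exists k].
have E : nrm (leb R) (fun=> 0) = 0 by rewrite /nrm /L2sq; under eq_integral do rewrite sqnormc0; rewrite integral0.
split=> //.
  by rewrite (_ : (fun t => _) = (fun=> 0)) ?E //; apply/funext => t; rewrite subrr.
by rewrite (_ : (fun t => _) = (fun=> 0)) ?E //; apply/funext => t; rewrite subrr.
Qed.

(** The approximant [k'] of bounded support is replaced by a step function; [nrm_fhat_le] controls
    the change of its transform, hence the divisor [1 + 4 * pi]. After this, the Gram identity on
    intervals yields Plancherel's theorem for all pairs. *)
Lemma FT_pair_simul k K : FT_pair k K -> simul_approx (leb R) (leb R) itv_pairs k K.
Proof.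
move=> [k2 K2 H]; apply: simul_approx_closure => // e e0.
have e4 : 0 < e / 4 by lra.
have [k' [bk' kk' Kk']] := H _ e4; have [k2' _] := bk'; have f2' := L2_fhat bk'.
have pi0 := pi_gt0 R.
have [al [be [ab k0]]] := L2b_itv bk'.
have p1 : 0 < 1 + 4 * pi :> R by rewrite addr_gt0 // mulr_gt0.
have e' : 0 < e / 4 / (1 + 4 * pi) by rewrite divr_gt0.
have [_ /(_ _ e')[s cs ks]] := step_dense ab k2' k0.
exists al, be, s; have bs := L2b_comb cs; have s2 := L2_comb_steps cs; have fs2 := L2_fhat bs.
have n0 := nrm_ge0 (leb R) (fun t => k' t - s t).
rewrite ltr_pdivlMr // in ks.
have pn : 0 <= pi * nrm (leb R) (fun t => k' t - s t) by rewrite mulr_ge0 // ltW.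
have ks4 : nrm (leb R) (fun t => k' t - s t) < e / 4.
  by move: ks pn; move: (nrm _ _) => z; rewrite mulrDr mulr1 => ? ?; lra.
split=> //.
  rewrite (_ : (fun x => _) = (fun t => (k t - k' t) + (k' t - s t))).
    by apply: (le_lt_trans (nrmD_le (L2B k2 k2') (L2B k2' s2))); exact: add_quarters.
  by apply/funext => t; rewrite addrA subrK.
rewrite (_ : (fun x => _) = (fun t => (K t - fhat k' t) + fhat (fun t => k' t - s t) t)).
  have := nrm_fhat_le (L2bB bk' bs).
  have := nrmD_le (L2B K2 f2') (L2_fhat (L2bB bk' bs)); lra.
by apply/funext => l; rewrite fhatB ?addrA ?subrK //; exact: L2b_cintegrable.
Qed.

Lemma FT_pair_ip k K k' K' : FT_pair k K -> FT_pair k' K' ->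
  ip (leb R) K K' = (2 * pi)%:C * ip (leb R) k k'.
Proof.
move=> /FT_pair_simul h /FT_pair_simul h'.
exact: (simul_approx_ip itv_pairs_L21 itv_pairs_L22 itv_pairs_gram h h').
Qed.

Lemma FT_pair_nrm k K : FT_pair k K -> nrm (leb R) K = 2 * pi * nrm (leb R) k.
Proof.
move=> /FT_pair_simul h.
exact: (simul_approx_nrm itv_pairs_L21 itv_pairs_L22 itv_pairs_gram h).
Qed.

End Plancherel.

(** * Calculus of Fourier pairs and their relation to [fourier] and [fourierT] *)

Section FourierPairs.
Context {R : realType}.
Local Notation RR := (measurableTypeR R).
Implicit Types k K phi : R -> R[i].

Lemma L2on_L2 (D : set RR) phi : measurable D -> L2on D phi -> L2 (leb R) phi /\
  L2sq (leb R) setT phi = L2sq (leb R) D phi.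
Proof.
move=> mD [mphi phi2 phi0].
have E : L2sq (leb R) setT phi = L2sq (leb R) D phi.
  rewrite /L2sq [RHS]integral_mkcond; apply: eq_integral => t _; rewrite patchE.
  case: (boolP (t \in D)) => // tD; rewrite phi0 ?sqnormc0 //.
  by move=> /mem_set h; rewrite h in tD.
by split=> //; split=> //; rewrite E.
Qed.

(** Plancherel's theorem gives [nrm K], [nrm K'] and [ip K K'] one common value, so the difference
    has norm zero. *)
Lemma FT_pair_unique k K K' : FT_pair k K -> FT_pair k K' -> {ae leb R, forall l, K l = K' l}.
Proof.
move=> kK kK'; have [_ K2 _] := kK; have [_ K2' _] := kK'.
have : nrm (leb R) (fun l => K l - K' l) = 0.
  rewrite nrmB // (FT_pair_nrm kK) (FT_pair_nrm kK') (FT_pair_ip kK kK') ipgg.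
  by rewrite -ofrealM /=; ring.
move=> /(nrm_eq0_ae (L2B K2 K2')); apply: ae_mono => l /eqP.
by rewrite subr_eq0 => /eqP.
Qed.

Lemma nrm_ae_eq d (X : measurableType d) (m : {measure set X -> \bar R}) (g h : X -> R[i]) :
  cmeasurable setT g -> cmeasurable setT h -> {ae m, forall x, g x = h x} -> nrm m g = nrm m h.
Proof. by move=> mg mh gh; rewrite /nrm (ae_eq_L2sq mg mh gh). Qed.

Lemma FT_pair_ae k K k' K' : cmeasurable (setT : set RR) k' -> cmeasurable (setT : set RR) K' ->
  {ae leb R, forall l, k l = k' l} -> {ae leb R, forall l, K l = K' l} ->
  FT_pair k K -> FT_pair k' K'.
Proof.
move=> mk' mK' kk' KK' [k2 K2 H]; have [mk _] := k2; have [mK _] := K2.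
split; [exact: (ae_eq_L2 mk' kk' k2)|exact: (ae_eq_L2 mK' KK' K2)|move=> e e0].
have [k0 [bk0 h1 h2]] := H _ e0; exists k0; have [[mk0 _] _] := bk0.
have mf0 := cmeasurable_fhat mk0; split=> //.
- rewrite -(@nrm_ae_eq _ RR (leb R) (fun t => k t - k0 t)) //; try exact: cmeasurableB.
  by apply: (ae_mono _ kk') => l ->.
- rewrite -(@nrm_ae_eq _ RR (leb R) (fun t => K t - fhat k0 t)) //; try exact: cmeasurableB.
  by apply: (ae_mono _ KK') => l ->.
Qed.

Lemma FT_pairD k K k' K' : FT_pair k K -> FT_pair k' K' ->
  FT_pair (fun t => k t + k' t) (fun l => K l + K' l).
Proof.
move=> [k2 K2 H] [k2' K2' H']; split; [exact: L2D|exact: L2D|move=> e e0].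
have e4 : 0 < e / 4 by lra.
have [k0 [bk0 h1 h2]] := H _ e4; have [k0' [bk0' h1' h2']] := H' _ e4.
have [k02 _] := bk0; have K02 := L2_fhat bk0; have [k02' _] := bk0'; have K02' := L2_fhat bk0'.
exists (fun t => k0 t + k0' t); split; first exact: L2bD.
- rewrite [X in nrm _ X](_ : _ = (fun t => (k t - k0 t) + (k' t - k0' t))).
    by apply: (le_lt_trans (nrmD_le (L2B k2 k02) (L2B k2' k02'))); exact: add_quarters.
  by apply/funext => t; rewrite opprD addrACA.
- rewrite [X in nrm _ X](_ : _ = (fun t => (K t - fhat k0 t) + (K' t - fhat k0' t))).
    by apply: (le_lt_trans (nrmD_le (L2B K2 K02) (L2B K2' K02'))); exact: add_quarters.
  by apply/funext => t; rewrite fhatD ?opprD 1?addrACA //; exact: L2b_cintegrable.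
Qed.

Lemma FT_pairZ z k K : FT_pair k K -> FT_pair (fun t => z * k t) (fun l => z * K l).
Proof.
move=> [k2 K2 H]; split; [exact: L2Z|exact: L2Z|move=> e e0].
have z0 := sqnormc_ge0 z.
have z1 : 0 < sqnormc z + 1 by lra.
have ez : 0 < e / (sqnormc z + 1) by rewrite divr_gt0.
have [k0 [bk0 h1 h2]] := H _ ez; have [k02 _] := bk0; have K02 := L2_fhat bk0.
rewrite !ltr_pdivlMr // in h1 h2.
exists (fun t => z * k0 t); split; first exact: L2bZ.
- rewrite [X in nrm _ X](_ : _ = (fun t => z * (k t - k0 t))); last first.
    by apply/funext => t; rewrite mulrBr.
  rewrite nrmZ; last exact: L2B.
  by have := nrm_ge0 (leb R) (fun t => k t - k0 t); nra.
- rewrite [X in nrm _ X](_ : _ = (fun t => z * (K t - fhat k0 t))); last first.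
    by apply/funext => t; rewrite mulrBr fhatZ //; exact: L2b_cintegrable.
  rewrite nrmZ; last exact: L2B.
  by have := nrm_ge0 (leb R) (fun t => K t - fhat k0 t); nra.
Qed.

Lemma FT_pair0 : FT_pair (fun=> 0 : R[i]) (fun=> 0).
Proof.
split; [exact: L20|exact: L20|move=> e e0]; exists (fun=> 0).
have E : nrm (leb R) (fun=> 0 : R[i]) = 0.
  by rewrite /nrm /L2sq; under eq_integral do rewrite sqnormc0; rewrite integral0.
split.
- by split; [exact: L20|exists 0].
- by rewrite (_ : (fun t => _) = (fun=> 0)) ?E //; apply/funext => t; rewrite subrr.
- rewrite (_ : (fun t => _) = (fun=> 0)) ?E //; apply/funext => t.
  rewrite /fhat (_ : (fun t => _) = (fun=> 0)) ?cintegral0 ?subrr //.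
  by apply/funext => s; rewrite mul0r.
Qed.

Lemma FT_pair_sum n (k K : 'I_n -> R -> R[i]) : (forall i, FT_pair (k i) (K i)) ->
  FT_pair (fun t => \sum_(i < n) k i t) (fun l => \sum_(i < n) K i l).
Proof.
elim: n k K => [|n IH] k K H.
  rewrite (_ : (fun t => _) = (fun=> 0)); last by apply/funext => t; rewrite big_ord0.
  rewrite (_ : (fun t => \sum_(i < 0) K i t) = (fun=> 0)); first exact: FT_pair0.
  by apply/funext => t; rewrite big_ord0.
rewrite (_ : (fun t => _) = (fun t => \sum_(i < n) k (widen_ord (leqnSn n) i) t + k ord_max t)).
  rewrite (_ : (fun l => \sum_(i < n.+1) K i l) =
     (fun t => \sum_(i < n) K (widen_ord (leqnSn n) i) t + K ord_max t)).
    by apply: FT_pairD => //; apply: IH.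
  by apply/funext => t; rewrite big_ord_recr.
by apply/funext => t; rewrite big_ord_recr.
Qed.

Lemma cmeasurable_phase_pos (t : R) : cmeasurable (setT : set RR) (fun l : RR => expi (l * t) : R[i]).
Proof.
apply: cmeasurable_expi; apply: measurable_funM => //; exact: measurable_cst.
Qed.

Lemma fhat_shift k t l : cmeasurable (setT : set RR) k ->
  cintegrable (leb R) setT k ->
  fhat (fun s => k (s + t)) l = expi (l * t) * fhat k l.
Proof.
move=> mk ik; rewrite /fhat -cintegralZ; last exact: cintegrable_phase.
have mg : cmeasurable (setT : set RR) (fun s => expi (l * t) * (k s * expi (- (l * s)))).
  apply: cmeasurableM; first exact: cmeasurable_cst.
  by apply: cmeasurableM => //; exact: cmeasurable_phase.
rewrite -[RHS](cintegral_preserving (leb_preserving_shift t) mg).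
congr cintegral; apply/funext => s; rewrite mulrDr opprD expiD.
by have := expiD (l * t) (- (l * t)); rewrite subrr expi0 => h; rewrite -[LHS]mul1r h; ring.
Qed.

Lemma fhat_conj_reflect k l : cmeasurable (setT : set RR) k ->
  cintegrable (leb R) setT k ->
  fhat (fun s => (k (- s))^*) l = (fhat k l)^*.
Proof.
move=> mk ik; rewrite /fhat -cintegral_conj; last exact: cintegrable_phase.
have mg : cmeasurable (setT : set RR) (fun s => (k s * expi (- (l * s)))^*).
  apply: cmeasurable_conj; apply: cmeasurableM => //; exact: cmeasurable_phase.
rewrite -[RHS](cintegral_preserving (@leb_preserving_opp R) mg).
by congr cintegral; apply/funext => s; rewrite conjcM -expiN mulrN !opprK.
Qed.

Lemma L2b_shift t k : L2b k -> L2b (fun s => k (s + t)).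
Proof.
move=> [k2 [N N0 kN]]; split; first exact: (L2_preserving (leb_preserving_shift t)).
exists (N + `|t|); first by rewrite addr_ge0.
move=> s H; apply: kN => /andP[h1 h2]; apply: H.
by have := ler_norm t; have := ler_norm (- t); rewrite normrN => *; apply/andP; split; lra.
Qed.

Lemma L2b_conj_reflect k : L2b k -> L2b (fun s => (k (- s))^*).
Proof.
move=> [k2 [N N0 kN]]; split.
  by apply: L2_conj; exact: (L2_preserving (@leb_preserving_opp R)).
exists N => // s H; rewrite kN ?rmorph0 // => /andP[h1 h2]; apply: H.
by apply/andP; split; lra.
Qed.

Lemma FT_pair_shift k K t : FT_pair k K ->
  FT_pair (fun s => k (s + t)) (fun l => expi (l * t) * K l).
Proof.
move=> [k2 K2 H].
have L2p G : L2 (leb R) G -> L2 (leb R) (fun l => expi (l * t) * G l).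
  apply: (L2_mul_bounded (B := 1)); first exact: cmeasurable_phase_pos.
  by move=> l; rewrite sqnormc_expi.
split; [exact: (L2_preserving (leb_preserving_shift t))|exact: L2p|move=> e e0].
have [k0 [bk0 h1 h2]] := H _ e0; have [k02 _] := bk0; have [mk0 _] := k02.
exists (fun s => k0 (s + t)); split; first exact: L2b_shift.
- apply: le_lt_trans h1; rewrite le_eqVlt; apply/orP; left; apply/eqP.
  rewrite /nrm; congr fine.
  apply: (L2sq_preserving (leb_preserving_shift t) (g := fun s => k s - k0 s)).
  by apply: cmeasurableB => //; case: k2.
- apply: le_lt_trans h2; rewrite le_eqVlt; apply/orP; left; apply/eqP.
  apply: nrm_ext => l; rewrite fhat_shift //; last exact: L2b_cintegrable.
  by rewrite -mulrBr sqnormcM sqnormc_expi mul1r.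
Qed.

Lemma FT_pair_conj_reflect k K : FT_pair k K ->
  FT_pair (fun s => (k (- s))^*) (fun l => (K l)^*).
Proof.
move=> [k2 K2 H].
have k2' := L2_preserving (@leb_preserving_opp R) k2.
split; [exact: L2_conj|exact: L2_conj|move=> e e0].
have [k0 [bk0 h1 h2]] := H _ e0; have [k02 _] := bk0; have [mk0 _] := k02.
exists (fun s => (k0 (- s))^*); split; first exact: L2b_conj_reflect.
- apply: le_lt_trans h1; rewrite le_eqVlt; apply/orP; left; apply/eqP.
  rewrite -(nrm_conj (leb R) (fun t : RR => k t - k0 t)) /nrm; congr fine.
  rewrite -(L2sq_preserving (@leb_preserving_opp R) (g := fun t : RR => (k t - k0 t)^*)).
    by apply: eq_integral => s _; rewrite conjcB.
  by apply: cmeasurable_conj; apply: cmeasurableB => //; case: k2.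
- apply: le_lt_trans h2; rewrite le_eqVlt; apply/orP; left; apply/eqP.
  rewrite -(nrm_conj (leb R) (fun t : RR => K t - fhat k0 t)); apply: nrm_ext => l.
  by rewrite fhat_conj_reflect ?conjcB //; exact: L2b_cintegrable.
Qed.

(** Parseval's identity for [k2] and the conjugate of [w |-> k1 (t - w)]: translation multiplies the
    transform by a phase, and conjugated reflection conjugates it. *)
Lemma FT_pair_convolution k1 K1 k2 K2 t : FT_pair k1 K1 -> FT_pair k2 K2 ->
  cintegral (leb R) setT (fun l => expi (l * t) * (K1 l * K2 l)) =
  (2 * pi)%:C * cintegral (leb R) setT (fun w => k2 w * k1 (t - w)).
Proof.
move=> H1 H2; have := FT_pair_ip H2 (FT_pair_conj_reflect (FT_pair_shift t H1)).
rewrite /ip => h; transitivity (cintegral (leb R) setT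
    (fun x => K2 x * ((expi (x * t) * K1 x)^*)^*)).
  by congr cintegral; apply/funext => l; rewrite conjCK; ring.
rewrite h; congr (_ * _); congr cintegral; apply/funext => w.
by rewrite conjCK addrC.
Qed.

Lemma is_fourier_FT_pair phi Phi : L2on `[0, +oo[ phi -> is_fourier phi Phi -> FT_pair phi Phi.
Proof.
move=> ophi [mP P2 Plim].
have [phi2 _] := L2on_L2 (measurable_itv _) ophi; have [mphi _ phi0] := ophi.
have PL2 : L2 (leb R) Phi by split.
split=> // e e0.
pose A (n : nat) : set RR := [set t | t <= n%:R].
have AE n : A n = `]-oo, n%:R]%classic by apply/seteqP; split => x; rewrite /A /= in_itv.
have mA n : measurable (A n) by rewrite AE; exact: measurable_itv.
have Ax (t : RR) : \forall n \near \oo, A n t.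
  exists (Num.truncn t).+1 => // n /= tn; rewrite /A /=; apply: ltW.
  by apply: (lt_le_trans (truncnS_gt _)); rewrite ler_nat.
have e0E : (0 < e%:E)%E by rewrite lte_fin.
have [n1 _ H1] := nrm_cut phi2 mA Ax e0.
have [n2 _ H2] := Plim _ (open_ereal_lt' e0E).
pose n := maxn n1 n2.
have {}H1 := H1 n (leq_maxl _ _); have {}H2 := H2 n (leq_maxr _ _).
have b2 : L2b (fun x => cind (A n) x * phi x).
  split.
    exact: L2_cind.
  exists n%:R => // t H; rewrite /cind indicE; have [t0|t0] := ltP t 0.
    by rewrite phi0 ?mulr0 //= in_itv /= andbT leNgt t0.
  rewrite memNset ?mul0r // => tn; apply: H; apply/andP; split=> //.
  by rewrite (le_trans _ t0) // oppr_le0.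
have EF l : cintegral (leb R) `[0, n%:R] (fun t => expi (- (l * t)) * phi t) =
    fhat (fun x => cind (A n) x * phi x) l.
  rewrite cintegral_indic /fhat; congr cintegral; apply/funext => t.
  rewrite /cind !indicE AE !mem_setE !in_itv /=.
  have [t0|t0] := ltP t 0; last by ring.
  by rewrite phi0 ?mulr0 ?mul0r ?mulr0 //= in_itv /= andbT leNgt t0.
exists (fun x => cind (A n) x * phi x); split=> //.
rewrite -lte_fin -L2sqE; last by apply: L2B => //; exact: L2_fhat.
rewrite (_ : (fun t => _) = (fun l => Phi l -
   cintegral (leb R) `[0, n%:R] (fun t => expi (- (l * t)) * phi t))); first exact: H2.
by apply/funext => l; rewrite EF.
Qed.

(** The second alternative is the default value of the choice. It is excluded later by
    [power_not_ae0], for factors of a density of positive power. *)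
Lemma fourier_cases phi : L2on `[0, +oo[ phi ->
  FT_pair phi (fourier phi) \/ fourier phi = (fun=> 0).
Proof.
move=> ophi; rewrite /fourier.
have [[Phi hPhi]|nex] := pselect (exists Phi, is_fourier phi Phi).
  left; apply: is_fourier_FT_pair => //.
  by apply: (xgetPex (fun=> 0 : R[i]) (P := [set Phi | is_fourier phi Phi])); exists Phi.
right; apply: xgetPN => Phi hPhi; apply: nex; by exists Phi.
Qed.

Lemma L2on_itv_L2b (T : R) phi : 0 <= T -> L2on `[0, T] phi -> L2b phi.
Proof.
move=> T0 ophi; have [phi2 _] := L2on_L2 (measurable_itv _) ophi; have [_ _ phi0] := ophi.
split=> //; exists T => // t H; apply: phi0; rewrite /= in_itv /= => /andP[h1 h2].
by apply: H; apply/andP; split=> //; lra.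
Qed.

Lemma L2on_itv_halfline (T : R) phi : L2on `[0, T] phi -> L2on `[0, +oo[ phi.
Proof.
move=> ophi; have [mphi _ phi0] := ophi.
have phi0' t : ~ (`[0, +oo[%classic : set R) t -> phi t = 0.
  move=> H; apply: phi0; rewrite /= in_itv /= => /andP[h1 h2].
  by apply: H; rewrite /= in_itv /= h1.
have [phi2 _] := L2on_L2 (measurable_itv _) ophi.
split=> //; have [_] := phi2; apply: le_lt_trans; rewrite /L2sq.
apply: (ge0_subset_integral (leb R)) => // [|t _]; last by rewrite lee_fin sqnormc_ge0.
by apply/measurable_EFinP; exact: measurable_sqnormc.
Qed.

Lemma fourierT_fhat (T : R) phi : L2on `[0, T] phi -> fourierT T phi = fhat phi.
Proof.
move=> [_ _ phi0]; apply/funext => l; rewrite /fourierT cintegral_indic /fhat.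
congr cintegral; apply/funext => t; rewrite indicE.
case: (boolP (t \in _)) => [_|tT]; first by rewrite mul1r.
by rewrite mul0r phi0 ?mul0r // => /mem_set h; rewrite h in tT.
Qed.

Lemma fourier_fourierT (T : R) phi : 0 <= T -> L2on `[0, T] phi ->
  FT_pair phi (fourier phi) /\ {ae leb R, forall l, fourier phi l = fourierT T phi l}.
Proof.
move=> T0 ophi; have bphi := L2on_itv_L2b T0 ophi; have [_ _ phi0] := ophi.
have isF : is_fourier phi (fhat phi).
  have [mF F2] := L2_fhat bphi; split=> //.
  (* Once [N] exceeds [T] the truncated transform is the full one, so the errors are eventually
     [0]. *)
  apply: cvg_near_cst; exists (Num.truncn T).+1 => // N /= TN.
  rewrite (_ : (fun l => _) = (fun=> 0)); first by rewrite /L2sq; under eq_integral do rewrite sqnormc0; rewrite integral0.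
  apply/funext => l; rewrite cintegral_indic /fhat; apply/eqP; rewrite subr_eq0; apply/eqP.
  congr cintegral; apply/funext => t; rewrite indicE mem_setE in_itv /=.
  have [t0|t0] := boolP ((0 <= t) && (t <= N%:R)); first by rewrite mul1r mulrC.
  rewrite mul0r phi0 ?mul0r //= in_itv /= => /andP[h1 h2]; move: t0; rewrite h1 /= => /negP; apply.
  by apply: (le_trans h2); apply: ltW; apply: (lt_le_trans (truncnS_gt _)); rewrite ler_nat.
have FP : FT_pair phi (fourier phi).
  apply: is_fourier_FT_pair; first exact: L2on_itv_halfline ophi.
  by apply: (xgetPex (fun=> 0 : R[i]) (P := [set Phi | is_fourier phi Phi])); exists (fhat phi).
split=> //; rewrite (fourierT_fhat ophi).
exact: (FT_pair_unique FP (FT_pair_L2b bphi)).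
Qed.

End FourierPairs.

(** * Products of causal functions *)

Section WeakHardy.
Context {R : realType}.
Local Notation RR := (measurableTypeR R).
Implicit Types F G k K g : R -> R[i].

Lemma leb_Fubini (F : RR * RR -> R[i]) : cmeasurable setT F ->
  (\int[leb R]_x \int[leb R]_y (ComplexField.Normc.normc (F (x, y)))%:E < +oo)%E ->
  cintegrable (leb R) setT (fun x => cintegral (leb R) setT (fun y => F (x, y))) /\
  cintegral (leb R) setT (fun x => cintegral (leb R) setT (fun y => F (x, y))) =
  cintegral (leb R) setT (fun y => cintegral (leb R) setT (fun x => F (x, y))).
Proof.
exact: (@cintegrable_param R _ _ RR RR
  (lebesgue_measure : {sigma_finite_measure set RR -> \bar R})
  (lebesgue_measure : {sigma_finite_measure set RR -> \bar R}) F).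
Qed.

Lemma leb_cmeasurable_param (F : RR * RR -> R[i]) : cmeasurable setT F ->
  cmeasurable setT (fun x => cintegral (leb R) setT (fun y => F (x, y))).
Proof.
exact: (@cmeasurable_param R _ _ RR RR (lebesgue_measure : {sigma_finite_measure set RR -> \bar R}) F).
Qed.

Lemma iterated_product_lty (a b : RR -> R) : (leb R).-integrable setT (fun x => (a x)%:E) ->
  (leb R).-integrable setT (fun x => (b x)%:E) -> (forall x, 0 <= a x) -> (forall x, 0 <= b x) ->
  (\int[leb R]_x \int[leb R]_y (a x * b y)%:E < +oo)%E.
Proof.
move=> ia ib a0 b0; have mb := measurable_int _ ib.
have E x : (\int[leb R]_y (a x * b y)%:E = (a x)%:E * \int[leb R]_y (b y)%:E)%E.
  rewrite -(@ge0_integralZl_EFin _ _ _ (leb R) setT measurableT (fun y => (b y)%:E) _ mb (a x)) //.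
  by move=> y _; rewrite lee_fin.
have fb : (\int[leb R]_y (b y)%:E)%E \is a fin_num by exact: integrable_fin_num.
under eq_integral do rewrite E -(fineK fb) -EFinM mulrC EFinM.
have fb0 : 0 <= fine (\int[leb R]_y (b y)%:E)%E.
  by apply: fine_ge0; apply: integral_ge0 => y _; rewrite lee_fin.
rewrite (@ge0_integralZl_EFin _ _ _ (leb R) setT measurableT (fun y => (a y)%:E) _ (measurable_int _ ia) _ fb0) //.
  have /fineK <- : (\int[leb R]_y (a y)%:E)%E \is a fin_num by exact: integrable_fin_num.
  by rewrite -EFinM ltry.
by move=> y _; rewrite lee_fin.
Qed.

(* F is integrable and orthogonal to the analytic exponentials: the boundary value of an H^1 function. *)
Definition wH1 F : Prop := cintegrable (leb R) setT F /\
  forall x, 0 <= x -> cintegral (leb R) setT (fun l => expi (- (l * x)) * F l) = 0.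

Lemma cmeasurable_phase_left (x : R) :
  cmeasurable (setT : set RR) (fun l : RR => expi (- (l * x)) : R[i]).
Proof.
apply: cmeasurable_expi; apply: measurable_funN_real.
by apply: measurable_funM => //; exact: measurable_cst.
Qed.

Lemma cintegrable_phase_mul F (x : R) : cintegrable (leb R) setT F ->
  cintegrable (leb R) setT (fun l => expi (- (l * x)) * F l).
Proof.
move=> ik; apply: (cintegrable_le (h := fun t : RR => ComplexField.Normc.normc (F t))).
- apply: cmeasurableM; last exact: cintegrable_cmeasurable ik.
  exact: cmeasurable_phase_left.
- exact: cintegrable_normc.
- by move=> t; rewrite normcM normc_expi mul1r.
Qed.

Lemma wH1D F G : wH1 F -> wH1 G -> wH1 (fun l => F l + G l).
Proof.
move=> [iF F0] [iG G0]; split; first exact: cintegrableD.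
move=> x x0; transitivity (cintegral (leb R) setT (fun l : RR =>
   expi (- (l * x)) * F l + expi (- (l * x)) * G l)).
  by congr cintegral; apply/funext => l; rewrite mulrDr.
by rewrite cintegralD ?F0 ?G0 ?addr0 //; exact: cintegrable_phase_mul.
Qed.

Lemma wH1Z z F : wH1 F -> wH1 (fun l => z * F l).
Proof.
move=> [iF F0]; split; first exact: cintegrableZ.
move=> x x0; transitivity (cintegral (leb R) setT (fun l : RR => z * (expi (- (l * x)) * F l))).
  by congr cintegral; apply/funext => l; ring.
by rewrite cintegralZ ?F0 ?mulr0 //; exact: cintegrable_phase_mul.
Qed.

Lemma wH1_phase (y : R) F : 0 <= y -> wH1 F -> wH1 (fun l => expi (- (l * y)) * F l).
Proof.
move=> y0 [iF F0]; split; first exact: cintegrable_phase_mul.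
move=> x x0; rewrite -[RHS](F0 (x + y)) ?addr_ge0 //.
by congr cintegral; apply/funext => l; rewrite mulrA -expiD mulrDr opprD.
Qed.

Lemma wH1_ae F G : cmeasurable (setT : set RR) G -> {ae leb R, forall l, F l = G l} ->
  wH1 F -> wH1 G.
Proof.
move=> mG FG [iF F0]; have mF := cintegrable_cmeasurable iF.
have iG := ae_eq_cintegrable mG FG iF.
split=> // x x0; rewrite -[RHS](F0 x x0); apply: ae_eq_cintegral.
- exact: cintegrable_cmeasurable (cintegrable_phase_mul x iG).
- exact: cintegrable_cmeasurable (cintegrable_phase_mul x iF).
- by apply: (ae_mono _ FG) => l ->.
Qed.

(** The integral is a convolution evaluated at [- x <= 0]. For [w < 0] the factor [k2 w] vanishes,
    and for [w > 0] the factor [k1 (- x - w)] does. *)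
Lemma FT_pair_wH1 k1 K1 k2 K2 : FT_pair k1 K1 -> FT_pair k2 K2 ->
  (forall t, t < 0 -> k1 t = 0) -> (forall t, t < 0 -> k2 t = 0) ->
  wH1 (fun l => K1 l * K2 l).
Proof.
move=> P1 P2 z1 z2; have [k12 K12 _] := P1; have [k22 K22 _] := P2.
split; first exact: L2M_cintegrable.
move=> x x0; transitivity (cintegral (leb R) setT (fun l : RR => expi (l * (- x)) * (K1 l * K2 l))).
  by congr cintegral; apply/funext => l; rewrite mulrN.
rewrite (FT_pair_convolution _ P1 P2) (_ : cintegral _ _ _ = 0) ?mulr0 //.
rewrite -(@cintegral0 R _ RR (leb R)); apply: ae_eq_cintegral.
- apply: cmeasurableM; first by case: k22.
  by case: (L2_preserving (leb_preserving_reflect (- x)) k12).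
- exact: cmeasurable_cst.
- apply: (ae_mono _ (@ae_neq0 R)) => w w0.
  have [wn|wp] := ltP w 0; first by rewrite z2 ?mul0r.
  rewrite z1 ?mulr0 //; have : 0 < w by rewrite lt_def w0.
  by move=> ?; lra.
Qed.

(** [fhat g] superposes the phases [expi (- (l * t))] with [t >= 0], each of which preserves [wH1];
    Fubini's theorem performs the superposition. *)
Lemma wH1_L1_mul g F : cintegrable (leb R) setT g -> (forall t, t < 0 -> g t = 0) ->
  wH1 F -> wH1 (fun l => fhat g l * F l).
Proof.
move=> ig g0 [iF F0].
have mg := cintegrable_cmeasurable ig; have mF := cintegrable_cmeasurable iF.
pose H (x : R) (p : RR * RR) : R[i] := expi (- (p.1 * x)) * F p.1 * (g p.2 * expi (- (p.1 * p.2))).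
have mH x : cmeasurable setT (H x).
  apply: cmeasurableM; last first.
    apply: cmeasurableM; last exact: measurable_phase.
    exact: (cmeasurable_comp (u := (snd : RR * RR -> RR))).
  exact: (cmeasurable_comp (u := (fst : RR * RR -> RR)) _
     (cintegrable_cmeasurable (cintegrable_phase_mul x iF))).
have nH x : (\int[leb R]_l \int[leb R]_t (ComplexField.Normc.normc (H x (l, t)))%:E < +oo)%E.
  have -> : (\int[leb R]_l \int[leb R]_t (ComplexField.Normc.normc (H x (l, t)))%:E =
      \int[leb R]_l \int[leb R]_t
        (ComplexField.Normc.normc (F l) * ComplexField.Normc.normc (g t))%:E)%E.
    apply: eq_integral => l _; apply: eq_integral => t _.
    by rewrite /H /= !normcM !normc_expi mul1r mulr1.
  exact: (iterated_product_lty (cintegrable_normc iF) (cintegrable_normc ig)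
    (fun=> normc_ge0 _) (fun=> normc_ge0 _)).
have E1 x l : cintegral (leb R) setT (fun t : RR => H x (l, t)) = expi (- (l * x)) * (fhat g l * F l).
  rewrite /H /= cintegralZ; last exact: cintegrable_phase.
  by rewrite -/(fhat g l); ring.
have E2 x : 0 <= x -> cintegral (leb R) setT (fun l => expi (- (l * x)) * (fhat g l * F l)) = 0.
  move=> x0; under [in cintegral _ _ _]eq_fun do rewrite -E1.
  have [_ ->] := leb_Fubini (mH x) (nH x).
  rewrite -(@cintegral0 R _ RR (leb R)); congr cintegral; apply/funext => t.
  have [tn|tp] := ltP t 0.
    rewrite -(@cintegral0 R _ RR (leb R)); congr cintegral; apply/funext => l.
    by rewrite /H /= g0 // mul0r mulr0.
  transitivity (cintegral (leb R) setT (fun l : RR => g t * (expi (- (l * (x + t))) * F l))).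
    by congr cintegral; apply/funext => l; rewrite /H /= mulrDr opprD expiD; ring.
  rewrite cintegralZ; last exact: cintegrable_phase_mul.
  by rewrite F0 ?mulr0 // addr_ge0.
split=> //; have [] := leb_Fubini (mH 0) (nH 0) => + _.
by congr cintegrable; apply/funext => l; rewrite E1 mulr0 oppr0 expi0 mul1r.
Qed.

Definition chi1 (s l : R) : R[i] := (1 - expi (- (l * s))) * (1 +i* l) / (0 +i* l).

Lemma chiE n s l : chi n s l = chi1 s l ^+ n.
Proof. by rewrite /chi /chi1 !exprMn exprVn. Qed.

(** Since [(1 + il) / (il) = 1 + 1 / (il)], the factor [chi1] is the transform of a finite measure
    on [[0, s]]: Lebesgue measure plus a point mass at [0] minus one at [s]. It is therefore a
    bounded causal multiplier. *)
Lemma chi1E s l : 0 <= s -> l != 0 ->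
  chi1 s l = fhat (itvf 0 s) l + 1 - expi (- (l * s)).
Proof.
move=> s0 l0; have il : (0 +i* l : R[i]) != 0 by rewrite eq_complex negb_and l0 orbT.
rewrite fhat_itvf // mulr0 oppr0 expi0 /chi1.
have -> : (1 +i* l : R[i]) = 1 + (0 +i* l) by apply: complex_ext => /=; rewrite ?addr0 ?add0r.
by field.
Qed.

Lemma cmeasurable_itv_inv : cmeasurable (setT : set RR) (fun l : RR => (0 +i* l : R[i])^-1).
Proof.
rewrite (_ : (fun l => _) = (fun l : RR => - (0 +i* 1) * (l^-1)%:C)).
  apply: cmeasurableM; first exact: cmeasurable_cst.
  by apply: cmeasurable_real; exact: measurable_invr.
apply/funext => l; have [->|l0] := eqVneq l 0.
  rewrite [in RHS](_ : (0^-1)%:C = 0 :> R[i]) ?mulr0; first exact: invr0.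
  by rewrite (invr0 R).
have il : (0 +i* l : R[i]) != 0 by rewrite eq_complex negb_and l0 orbT.
apply: (mulfI il); rewrite mulfV //; apply: complex_ext; rewrite !(cReM, cImM, cReN, cImN) /=.
  by field.
by ring.
Qed.

Lemma cmeasurable_chi1 s : cmeasurable (setT : set RR) (chi1 s).
Proof.
apply: cmeasurableM; last exact: cmeasurable_itv_inv.
apply: cmeasurableM.
  apply: cmeasurableB; first exact: cmeasurable_cst.
  exact: cmeasurable_phase_left.
by split => /=; [exact: measurable_cst|exact: measurable_id].
Qed.

Lemma cmeasurable_chi n s : cmeasurable (setT : set RR) (chi n s).
Proof.
rewrite (_ : chi n s = (fun l => chi1 s l ^+ n)); last by apply/funext => l; rewrite chiE.
by apply: cmeasurableX; exact: cmeasurable_chi1.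
Qed.

Lemma wH1_chi1 s F : 0 <= s -> wH1 F -> wH1 (fun l => chi1 s l * F l).
Proof.
move=> s0 hF; have mF := cintegrable_cmeasurable hF.1.
have h1 : wH1 (fun l => fhat (itvf 0 s) l * F l).
  apply: wH1_L1_mul => // [|t t0].
    apply: L2b_cintegrable; apply: (L2b_comb (al := 0) (be := s)); apply: comb_gen.
    by exists 0, s.
  by rewrite /itvf indicE memNset //= in_itv /= ltNge (ltW t0).
have h2 := wH1Z (-1) (wH1_phase s0 hF).
apply: wH1_ae (wH1D (wH1D h1 hF) h2).
  by apply: cmeasurableM => //; exact: cmeasurable_chi1.
by apply: (ae_mono _ (@ae_neq0 R)) => l l0; rewrite chi1E //; ring.
Qed.

Lemma wH1_chi n s F : 0 <= s -> wH1 F -> wH1 (fun l => chi n s l * F l).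
Proof.
move=> s0 hF; elim: n => [|n IH].
  by under eq_fun do rewrite chiE expr0 mul1r.
have := wH1_chi1 s0 IH; congr wH1; apply/funext => l.
by rewrite !chiE exprS mulrA.
Qed.

(* |1 - e^{-i l s}| <= min(2, |l| s), which keeps chi bounded near 0 and at infinity. *)
Lemma sqnormc_chi1_le (s l : R) : 0 <= s -> sqnormc (chi1 s l) <= 2 * s ^+ 2 + 8.
Proof.
move=> s0; have [->|l0] := eqVneq l 0.
  rewrite /chi1 mul0r oppr0 expi0 subrr !mul0r sqnormc0.
  by have := sqr_ge0 s; lra.
rewrite chi1E // -addrA; apply: le_trans (sqnormcD_le _ _) _; apply: lerD.
  rewrite ler_pM2l //.
  apply: le_trans (sqnormc_fhat_le l s0 (L2_itvf 0 s) _) _.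
    by move=> t tI; rewrite /itvf indicE memNset.
  by rewrite nrm_itvf // subr0 expr2.
have := sqnormcD_le (1 : R[i]) (- expi (- (l * s))).
rewrite sqnormcN sqnormc_expi sqnormc1; lra.
Qed.

Lemma sqnormc_chi_le n (s l : R) : 0 <= s -> sqnormc (chi n s l) <= (2 * s ^+ 2 + 8) ^+ n.
Proof.
move=> s0; rewrite chiE sqnormcX; apply: lerXn2r; rewrite ?nnegrE ?sqnormc_ge0 //.
  by have := sqr_ge0 s; lra.
exact: sqnormc_chi1_le.
Qed.

End WeakHardy.

(* Re-types a variable of measurableTypeR R, a copy of R, at type R. *)
Lemma funextR {R : realType} {V : Type} (f g : measurableTypeR R -> V) :
  (forall x : R, f x = g x) -> f = g.
Proof. exact: funext. Qed.

Lemma sum_ord_extend {V : nmodType} (G : nat -> V) (K M : nat) : (K <= M)%N ->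
  (forall k, (K < k)%N -> (k <= M)%N -> G k = 0) ->
  \sum_(k < K.+1) G k = \sum_(k < M.+1) G k.
Proof.
move=> KM G0; rewrite -!(big_mkord xpredT G) [RHS](@big_cat_nat _ _ _ K.+1) //=.
rewrite [X in _ + X]big_nat_cond [X in _ + X]big1 ?addr0 // => k; rewrite andbT => /andP[k1 k2].
exact: G0.
Qed.

Lemma dcoef0 (R : realType) n : dcoef R n 0 = 1.
Proof. by rewrite /dcoef big_ord1 expr0 expr1n coef1. Qed.

(** * The prediction operator as a convolution *)

Section Convolution.
Context {R : realType}.
Local Notation RR := (measurableTypeR R).
Variables (n : nat) (tau T : R) (a : R -> R[i]).
Hypothesis (htau : 0 < tau) (hT : 0 < T).
Hypothesis ha : cmeasurable (X := measurableTypeR R) `[0, T] a.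
Hypothesis ha1 : (\int[leb R]_(t in `[0%R, T])
              (ComplexField.Normc.normc (Dop n tau T a t))%:E < +oo)%E.
Hypothesis ha2 : (\int[leb R]_(t in `[0%R, T])
              (t * sqnormc (Dop n tau T a t))%:E < +oo)%E.

Definition trunc_a (t : R) : R[i] := cind (`[0, T]%classic : set R) t * a t.

(** [D a] with a summation bound independent of [t]: the additional terms vanish because [trunc_a]
    is [0] beyond [T]. In this form measurability is immediate. *)
Definition trunc_b (t : R) : R[i] := cind (`[0, T]%classic : set R) t *
  \sum_(k < (Num.truncn (T / tau)).+1) trunc_a (t + tau * k%:R) * (dcoef R n k)%:C.

Lemma cind_itvE (b1 b2 : itv_bound R) (t : R) :
  cind [set` Interval b1 b2] t = (t \in Interval b1 b2)%:R :> R[i].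
Proof. by rewrite /cind indicE mem_setE; case: (_ \in _). Qed.

Lemma cmeasurable_trunc_a : cmeasurable (setT : set RR) trunc_a.
Proof.
have [a1 a2] := ha; have mI : measurable (`[0, T]%classic : set RR) by exact: measurable_itv.
have E (f : RR -> R) : measurable_fun `[0, T] f -> measurable_fun setT (f \_ `[0, T]).
  by move=> mf; apply/(measurable_restrict f mI measurableT); rewrite setTI.
split.
- rewrite (_ : (fun t => _) = (fun t => complex.Re (a t)) \_ `[0, T]); first exact: E.
  apply: funextR => t; rewrite patchE /trunc_a /cind indicE.
  by case: (t \in _); rewrite cReM /= ?mul1r !mul0r subr0.
- rewrite (_ : (fun t => _) = (fun t => complex.Im (a t)) \_ `[0, T]); first exact: E.
  apply: funextR => t; rewrite patchE /trunc_a /cind indicE.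
  by case: (t \in _); rewrite cImM /= ?mul1r !mul0r addr0.
Qed.

Lemma trunc_a_out t : ~ (0 <= t <= T) -> trunc_a t = 0.
Proof. by move=> h; rewrite /trunc_a cind_itvE in_itv /=; case: (boolP (0 <= t <= T)) => [/h//|_]; rewrite mul0r. Qed.

Lemma trunc_a_in t : 0 <= t <= T -> trunc_a t = a t.
Proof. by move=> h; rewrite /trunc_a cind_itvE in_itv /= h mul1r. Qed.

Lemma cmeasurable_trunc_b : cmeasurable (setT : set RR) trunc_b.
Proof.
apply: cmeasurableM.
  by apply: cmeasurable_real; apply: measurable_indic; exact: measurable_itv.
apply: cmeasurable_sum => k; apply: cmeasurableM; last exact: cmeasurable_cst.
apply: (cmeasurable_comp (u := fun t : RR => t + tau * k%:R : RR)); last exact: cmeasurable_trunc_a.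
by case: (leb_preserving_shift (tau * k%:R)).
Qed.

Lemma le_trunc_quot t (k : nat) : t <= T ->
  (k <= Num.truncn ((T - t) / tau))%N = (t + tau * k%:R <= T).
Proof.
move=> tT; rewrite truncn_ge_nat; last by rewrite divr_ge0 ?subr_ge0 // ltW.
by rewrite ler_pdivlMr // lerBrDl mulrC.
Qed.

Lemma trunc_quot_le t : 0 <= t -> (Num.truncn ((T - t) / tau) <= Num.truncn (T / tau))%N.
Proof. by move=> t0; apply: le_truncn; rewrite ler_pM2r ?invr_gt0 // lerBlDr lerDl. Qed.

Lemma trunc_bE t : 0 <= t <= T -> trunc_b t = Dop n tau T a t.
Proof.
move=> tT; have /andP[t0 t1] := tT; rewrite /trunc_b cind_itvE in_itv /= tT mul1r /Dop.
rewrite -(@sum_ord_extend _ (fun k => trunc_a (t + tau * k%:R) * (dcoef R n k)%:C) _ _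
   (trunc_quot_le t0)).
  apply: eq_bigr => k _; rewrite trunc_a_in //.
  by rewrite -le_trunc_quot // -ltnS ltn_ord andbT addr_ge0 // mulr_ge0 // ltW.
move=> k; rewrite ltnNge le_trunc_quot // => /negP kT _.
by rewrite trunc_a_out ?mul0r // => /andP[].
Qed.

Lemma trunc_b_out t : ~ (0 <= t <= T) -> trunc_b t = 0.
Proof. by move=> h; rewrite /trunc_b cind_itvE in_itv /=; case: (boolP (0 <= t <= T)) => [/h//|_]; rewrite mul0r. Qed.

Lemma cintegrable_trunc_b : cintegrable (leb R) setT trunc_b.
Proof.
apply: cintegrableP; first exact: cmeasurable_trunc_b.
have -> : (\int[leb R]_t (ComplexField.Normc.normc (trunc_b t))%:E =
   \int[leb R]_(t in `[0%R, T]) (ComplexField.Normc.normc (Dop n tau T a t))%:E)%E; last exact: ha1.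
rewrite [RHS]integral_mkcond; apply: eq_integral => t _; rewrite patchE mem_setE in_itv /=.
case: ifP => h; first by rewrite trunc_bE.
by rewrite trunc_b_out ?h // normc_sqrt sqnormc0 sqrtr0.
Qed.

Lemma L2_trunc_b (e : R) : 0 < e -> L2 (leb R) (fun t => cind (`[e, T]%classic : set R) t * trunc_b t).
Proof.
move=> e0; have mb := cmeasurable_trunc_b.
have mt : measurable_fun (setT : set RR) (fun t : RR => (t * sqnormc (trunc_b t))%:E).
  by apply/measurable_EFinP; apply: measurable_funM => //; exact: measurable_sqnormc.
have h0 (t : R) : 0 <= t * sqnormc (trunc_b t).
  have [/andP[t0 _]|/negP h] := boolP (0 <= t <= T); first by rewrite mulr_ge0 ?sqnormc_ge0.
  by rewrite trunc_b_out // sqnormc0 mulr0.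
have it : (leb R).-integrable setT (fun t => (t * sqnormc (trunc_b t))%:E).
  apply/integrableP; split=> //; under eq_integral do rewrite gee0_abs ?lee_fin //.
  have -> : (\int[leb R]_t (t * sqnormc (trunc_b t))%:E =
   \int[leb R]_(t in `[0%R, T]) (t * sqnormc (Dop n tau T a t))%:E)%E; last exact: ha2.
  rewrite [RHS]integral_mkcond; apply: eq_integral => t _; rewrite patchE mem_setE in_itv /=.
  case: ifP => h; first by rewrite trunc_bE.
  by rewrite trunc_b_out ?h // sqnormc0 mulr0.
apply: (int_L2 (h := fun t : RR => e^-1 * (t * sqnormc (trunc_b t)))).
- apply: cmeasurableM => //; apply: cmeasurable_real; apply: measurable_indic.
  exact: measurable_itv.
- exact: (integrableZl measurableT e^-1 it).
- move=> t; rewrite cind_itvE in_itv /=.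
  have [/andP[t0 tT]|_] := boolP (e <= t <= T).
    rewrite mul1r mulrA ler_peMl ?sqnormc_ge0 // mulrC ler_pdivlMr ?mul1r //.
  by rewrite mul0r sqnormc0 mulr_ge0 // invr_ge0 ltW.
Qed.

(* a = b - sum_(k >= 1) d_k a (. + tau k) expresses a on one more step of length tau to the left. *)
Lemma L2_trunc_a (e : R) : 0 < e -> L2 (leb R) (fun t => cind (`[e, T]%classic : set R) t * trunc_a t).
Proof.
move=> e0.
pose A (m : nat) : set RR := [set t | e <= t <= T /\ T - m%:R * tau < t].
have AE m : A m = `[e, T]%classic `&` `]T - m%:R * tau, +oo[%classic.
  by apply/seteqP; split => t; rewrite /A /= !in_itv /= andbT.
have mA m : measurable (A m) by rewrite AE; apply: measurableI; exact: measurable_itv.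
have L m : L2 (leb R) (fun t => cind (A m) t * trunc_a t).
  elim: m => [|m IH].
    rewrite (_ : (fun t => _) = (fun=> 0)); first exact: L20.
    apply: funextR => t; rewrite /cind indicE memNset ?mul0r // /A /= mul0r subr0 => -[/andP[_ h]].
    by rewrite ltNge h.
  have L1 : L2 (leb R) (fun t => cind (`[e, T]%classic : set R) t * trunc_b t -
      \sum_(k < Num.truncn (T / tau)) (dcoef R n k.+1)%:C *
         (cind (A m) (t + tau * k.+1%:R) * trunc_a (t + tau * k.+1%:R))).
    apply: L2B; first exact: L2_trunc_b.
    apply: L2_sum => k; apply: L2Z.
    exact: (L2_preserving (leb_preserving_shift (tau * k.+1%:R)) IH).
  have := L2_cind (mA m.+1) L1; congr L2; apply: funextR => t.
  have [tA|tA] := boolP (t \in A m.+1); last by rewrite /cind indicE (negbTE tA) !mul0r.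
  have := tA; rewrite inE => -[et Tt]; have /andP[e1 t1] := et.
  have t01 : 0 <= t <= T by rewrite t1 andbT (le_trans (ltW e0)).
  have -> : cind (A m.+1) t = 1 :> R[i] by rewrite /cind indicE tA.
  rewrite !mul1r cind_itvE in_itv /= et mul1r.
  rewrite /trunc_b cind_itvE in_itv /= t01 mul1r big_ord_recl /= mulr0 addr0 dcoef0 mulr1.
  rewrite -addrA -sumrB big1 ?addr0 // => k _; rewrite /bump /= add1n.
  have [sT|sT] := boolP (t + tau * k.+1%:R <= T); last first.
    rewrite trunc_a_out ?mulr0 ?mul0r ?subr0 //; by move=> /andP[_]; exact/negP.
  have -> : cind (A m) (t + tau * k.+1%:R) = 1 :> R[i]; last by rewrite mul1r mulrC subrr.
  rewrite /cind indicE mem_set // /A /= sT andbT.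
  have p : tau <= tau * k.+1%:R by rewrite ler_peMr ?ler1n // ltW.
  split; first by move: htau; lra.
  by move: Tt htau; rewrite mulrS mulrDl mul1r; lra.
have := L (Num.truncn (T / tau)).+1; congr L2; apply: funextR => t; congr (_ * _).
rewrite /cind; congr (_%:C); congr (\1__ t); rewrite AE; apply/seteqP; split => s /=; first by case.
move=> h; split=> //; rewrite in_itv /= andbT; move: h; rewrite in_itv /= => /andP[h1 h2].
have : T / tau < (Num.truncn (T / tau)).+1%:R by exact: truncnS_gt.
rewrite ltr_pdivrMr //; move: hT htau; lra.
Qed.

Variable psi : R -> R[i].
Hypothesis psi2 : L2 (leb R) psi.
Hypothesis psi0 : forall t, t < 0 -> psi t = 0.

Definition causal_conv (t : R) : R[i] := cintegral (leb R) setT (fun s => trunc_b s * psi (s - t)).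

(** With [s = u + t], the weights [dcoef] recombine the translates of [a] into [D a]. The point
    [t = 0] is excluded because integrating the sum term by term uses the square integrability of
    [a] on [[t, T]], known for [t > 0]. *)
Lemma DAop_conv t : 0 < t -> t <= T -> DAop n tau T a psi t = causal_conv t.
Proof.
move=> t0 tT; pose M := Num.truncn (T / tau).
have psi_cut u : psi u = (0 <= u)%R%:R * psi u.
  by case: leP => h; rewrite ?mul1r // psi0 ?mul0r.
have ik k : cintegrable (leb R) setT (fun u : RR => trunc_a (u + t + tau * k%:R) * psi u).
  have := L2M_cintegrable (L2_preserving (leb_preserving_shift (t + tau * k%:R)) (L2_trunc_a t0)) psi2.
  congr cintegrable; apply: funextR => u; rewrite addrA cind_itvE in_itv /=.
  have [u0|u0] := ltP u 0; first by rewrite psi0 // !mulr0.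
  have h : t <= u + t + tau * k%:R by have := mulr_ge0 (ltW htau) (ler0n R k); lra.
  rewrite h /=; have [_|/negP h2] := boolP (u + t + tau * k%:R <= T); first by rewrite mul1r.
  by rewrite trunc_a_out ?mulr0 ?mul0r // => /andP[].
transitivity (\sum_(k < M.+1) (dcoef R n k)%:C *
   cintegral (leb R) setT (fun u : RR => trunc_a (u + t + tau * k%:R) * psi u)).
  rewrite /DAop (eq_bigr (fun k : 'I_(Num.truncn ((T - t) / tau)).+1 => (dcoef R n k)%:C *
    cintegral (leb R) setT (fun u : RR => trunc_a (u + t + tau * k%:R) * psi u))); last first.
    move=> k _; rewrite cintegral_indic; congr (_ * cintegral _ _ _); apply: funextR => u.
    rewrite -/(cind _ u) cind_itvE in_itv /=.
    have [u0|u0] := ltP u 0; first by rewrite psi0 // !mulr0.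
    have h : 0 <= u + t + tau * k%:R by have := mulr_ge0 (ltW htau) (ler0n R k); lra.
    rewrite /=; have -> : (u <= T - t - tau * k%:R) = (u + t + tau * k%:R <= T).
      by apply/idP/idP => ?; lra.
    have [h2|/negP h2] := boolP (u + t + tau * k%:R <= T).
      by rewrite mul1r trunc_a_in // h.
    by rewrite mul0r trunc_a_out ?mul0r // => /andP[].
  apply: (@sum_ord_extend _ (fun k => (dcoef R n k)%:C *
    cintegral (leb R) setT (fun u : RR => trunc_a (u + t + tau * k%:R) * psi u)) _ _
    (trunc_quot_le (ltW t0))) => k; rewrite ltnNge le_trunc_quot // => /negP kT _.
  rewrite (_ : (fun u => _) = (fun=> 0)) ?cintegral0 ?mulr0 //; apply: funextR => u.
  have [u0|u0] := ltP u 0; first by rewrite psi0 // mulr0.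
  rewrite trunc_a_out ?mul0r // => /andP[_ h]; apply: kT; lra.
under eq_bigr do rewrite -cintegralZ //.
rewrite -cintegral_sum => [|k]; last exact: cintegrableZ.
have mg : cmeasurable (setT : set RR) (fun s => trunc_b s * psi (s - t)).
  apply: cmeasurableM; first exact: cmeasurable_trunc_b.
  by case: (L2_preserving (leb_preserving_shift (- t)) psi2).
rewrite /causal_conv -(cintegral_preserving (leb_preserving_shift t) mg).
congr cintegral; apply: funextR => u; rewrite addrK.
have [u0|u0] := ltP u 0; first by rewrite psi0 // mulr0 big1 // => k _; rewrite !mulr0.
rewrite /trunc_b cind_itvE in_itv /=.
have ut0 : 0 <= u + t by lra.
rewrite ut0 /=; have [h|h] := boolP (u + t <= T).
  by rewrite mul1r mulr_suml; apply: eq_bigr => k _; ring.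
rewrite !mul0r big1 // => k _; rewrite trunc_a_out ?mul0r ?mulr0 //.
have kp := mulr_ge0 (ltW htau) (ler0n R k).
by rewrite -ltNge in h => /andP[_]; lra.
Qed.

Lemma causal_conv_out t : T < t -> causal_conv t = 0.
Proof.
move=> tT; rewrite /causal_conv (_ : (fun s => _) = (fun=> 0)) ?cintegral0 //.
apply: funextR => s; have [st|st] := ltP s t; first by rewrite psi0 ?mulr0 // subr_lt0.
by rewrite trunc_b_out ?mul0r // => /andP[_]; lra.
Qed.

Lemma cmeasurable_causal_conv : cmeasurable (setT : set RR) causal_conv.
Proof.
have [mpsi _] := psi2.
apply: (leb_cmeasurable_param (F := fun p : RR * RR => trunc_b p.2 * psi (p.2 - p.1))).
apply: cmeasurableM.
  apply: (cmeasurable_comp (u := (snd : RR * RR -> RR))) => //; exact: cmeasurable_trunc_b.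
apply: (cmeasurable_comp (u := (fun p : RR * RR => (p.2 - p.1 : RR)))) => //.
exact: measurable_funB.
Qed.

(* DAop is equal to the convolution only almost everywhere, on ]0, T]; this version vanishes outside. *)
Definition trunc_DA (t : R) : R[i] := cind (`[0, T]%classic : set R) t * DAop n tau T a psi t.

Lemma trunc_DA_conv t : t != 0 -> trunc_DA t = cind (`]0, T]%classic : set R) t * causal_conv t.
Proof.
move=> t0; rewrite /trunc_DA !cind_itvE !in_itv /= lt_def t0 /=.
have [/andP[h1 h2]|h] := boolP (0 <= t <= T); last by rewrite !mul0r.
by rewrite !mul1r DAop_conv // lt_def t0.
Qed.

Lemma cmeasurable_trunc_DA : cmeasurable (setT : set RR) trunc_DA.
Proof.
rewrite (_ : trunc_DA = fun t => if t == 0 then trunc_DA 0 else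
   cind (`]0, T]%classic : set R) t * causal_conv t); last first.
  by apply: funextR => t; case: eqVneq => [->//|t0]; exact: trunc_DA_conv.
apply: cmeasurable_if; [|exact: cmeasurable_cst|].
  by apply: measurable_fun_eqr; [exact: measurable_id|exact: measurable_cst].
apply: cmeasurableM; last exact: cmeasurable_causal_conv.
by apply: cmeasurable_real; apply: measurable_indic; exact: measurable_itv.
Qed.

Lemma sqnormc_causal_conv_le t : 0 < t ->
  sqnormc (causal_conv t) <=
  nrm (leb R) (fun s => cind (`[t, T]%classic : set R) s * trunc_b s) * nrm (leb R) psi.
Proof.
move=> t0; have b2 := L2_trunc_b t0.
have p2 : L2 (leb R) (fun s => psi (s - t)).
  exact: (L2_preserving (leb_preserving_shift (- t)) psi2).
have -> : causal_conv t = ip (leb R) (fun s => cind (`[t, T]%classic : set R) s * trunc_b s)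
    (fun s => (psi (s - t))^*).
  rewrite /causal_conv /ip; congr cintegral; apply: funextR => s; rewrite conjCK cind_itvE in_itv /=.
  have [st|st] := ltP s t; first by rewrite psi0 ?mulr0 // subr_lt0.
  rewrite /=; have [h|/negP h] := boolP (s <= T); first by rewrite mul1r.
  by rewrite trunc_b_out ?mulr0 ?mul0r // => /andP[].
apply: le_trans (ip_CauchySchwarz b2 (L2_conj p2)) _.
rewrite nrm_conj /nrm -(L2sq_preserving (leb_preserving_shift (- t)) (g := psi)) //.
by case: psi2.
Qed.

End Convolution.

Lemma sqnormc_fhat_le_L1 {R : realType} (k : R -> R[i]) (l : R) : cintegrable (leb R) setT k ->
  sqnormc (fhat k l) <= 2 * (\int[leb R]_t ComplexField.Normc.normc (k t)) ^+ 2.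
Proof.
move=> ik; set C := \int[leb R]_t _; have [i1 i2] := cintegrable_phase l ik.
have iN := cintegrable_normc ik.
have h (f : measurableTypeR R -> R) : (leb R).-integrable setT (fun t => (f t)%:E) ->
    (forall t, `|f t| <= ComplexField.Normc.normc (k t)) -> (\int[leb R]_t f t) ^+ 2 <= C ^+ 2.
  move=> fi fb; rewrite -real_normK ?num_real // ler_sqr ?nnegrE //; last first.
    by apply: Rintegral_ge0 => t _; exact: normc_ge0.
  apply: le_trans (le_normr_Rintegral _ fi) _ => //.
  apply: le_Rintegral => //; exact: integrable_norm fi.
rewrite sqnormcE /fhat /cintegral /= (_ : 2 * C ^+ 2 = C ^+ 2 + C ^+ 2); last by ring.
apply: lerD; apply: h => // t.
  by apply: le_trans (Re_le_normc _) _; rewrite normcM normc_expi mulr1.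
by apply: le_trans (Im_le_normc _) _; rewrite normcM normc_expi mulr1.
Qed.

(** * Square integrability of the predicted function and orthogonality of the prediction error *)

Section PredictionError.
Context {R : realType}.
Local Notation RR := (measurableTypeR R).
Variables (n : nat) (tau T : R) (a : R -> R[i]).
Hypothesis (htau : 0 < tau) (hT : 0 < T).
Hypothesis ha : cmeasurable (X := measurableTypeR R) `[0, T] a.
Hypothesis ha1 : (\int[leb R]_(t in `[0%R, T])
              (ComplexField.Normc.normc (Dop n tau T a t))%:E < +oo)%E.
Hypothesis ha2 : (\int[leb R]_(t in `[0%R, T])
              (t * sqnormc (Dop n tau T a t))%:E < +oo)%E.

Local Notation b := (trunc_b n tau T a).
Let mb : cmeasurable (setT : set RR) b := cmeasurable_trunc_b n tau ha.

Let triangle : set (RR * RR) := [set p | 0 < p.1 /\ p.1 <= p.2].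

Let mtriangle : measurable triangle.
Proof.
have m1 : measurable ((fst : RR * RR -> RR) @^-1` `]0, +oo[%classic).
  by rewrite -[X in measurable X]setTI; apply: measurable_fst => //; exact: measurable_itv.
have m2 : measurable ((fun p : RR * RR => p.2 - p.1 : RR) @^-1` `[0, +oo[%classic).
  rewrite -[X in measurable X]setTI.
  have mf : measurable_fun (setT : set (RR * RR)) (fun p : RR * RR => p.2 - p.1 : RR).
    exact: measurable_funB.
  by apply: mf => //; exact: measurable_itv.
have := measurableI _ _ m1 m2; congr measurable; apply/seteqP.
by split => -[x y]; rewrite /triangle /= !in_itv /= !andbT subr_ge0.
Qed.

Let in_triangle (t s : R) : ((t, s) \in triangle) = (0 < t <= s).
Proof. by apply/idP/andP => [/set_mem [h1 h2]|[h1 h2]]; [split|apply: mem_set; split]. Qed.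

(** Integrating first over [t] in []0, s]] produces exactly the weight [s] of the hypothesis
    [ha2]. *)
Let integral_triangle : (\int[leb R]_t \int[leb R]_s (\1_triangle (t, s) * sqnormc (b s))%:E < +oo)%E.
Proof.
have mq : measurable_fun setT (fun p : RR * RR => (\1_triangle p * sqnormc (b p.2))%:E).
  apply/measurable_EFinP; apply: measurable_funM; first exact: measurable_indic.
  apply: measurable_sqnormc.
  exact: (cmeasurable_comp (u := (snd : RR * RR -> RR))).
have q0 (p : RR * RR) : (0 <= (\1_triangle p * sqnormc (b p.2))%:E)%E.
  by rewrite lee_fin mulr_ge0 ?sqnormc_ge0.
have := fubini_tonelli (m1 := lebesgue_measure) (m2 := lebesgue_measure) _ mq q0.
rewrite /= => E; rewrite /leb {}E.
have -> : (\int[lebesgue_measure]_s \int[lebesgue_measure]_t (\1_triangle (t, s) * sqnormc (b s))%:E =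
   \int[leb R]_(s in `[0%R, T]) (s * sqnormc (Dop n tau T a s))%:E)%E; last exact: ha2.
rewrite [RHS]integral_mkcond; apply: eq_integral => s _; rewrite patchE mem_setE in_itv /=.
have [/andP[s0 sT]|/negP h] := boolP (0 <= s <= T); last first.
  have -> : b s = 0 by exact: trunc_b_out.
  under eq_integral do rewrite sqnormc0 mulr0.
  by rewrite integral0.
have s0T : 0 <= s <= T by rewrite s0 sT.
have Eb : b s = Dop n tau T a s := trunc_bE n a htau s0T.
rewrite Eb.
have -> : (\int[lebesgue_measure]_t (\1_triangle (t, s) * sqnormc (Dop n tau T a s))%:E =
   \int[leb R]_t ((sqnormc (Dop n tau T a s))%:E * (\1_(`]0%R, s]%classic : set RR) t)%:E))%E.
  apply: eq_integral => t _; rewrite -EFinM mulrC; congr ((_ * _)%:E).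
  by rewrite !indicE in_triangle mem_setE in_itv.
have I1 : (\int[leb R]_t (\1_(`]0%R, s]%classic : set RR) t)%:E = s%:E)%E.
  transitivity (L2sq (leb R) setT (itvf 0 s)).
    by apply: eq_integral => t _; rewrite sqnormc_itvf.
  by rewrite (L2sqE (L2_itvf 0 s)) nrm_itvf // subr0.
have m1 : measurable_fun setT (fun t : RR => (\1_(`]0%R, s]%classic : set RR) t)%:E : \bar R).
  by apply/measurable_EFinP; apply: measurable_indic; exact: measurable_itv.
have g1 (t : RR) : setT t -> (0 <= (\1_(`]0%R, s]%classic : set RR) t)%:E :> \bar R)%E.
  by move=> _; rewrite lee_fin.
rewrite (ge0_integralZl_EFin (leb R) measurableT g1 m1 (sqnormc_ge0 (Dop n tau T a s))) I1.
by rewrite -EFinM mulrC.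
Qed.

Section Causal.
Variables (psi Psi : R -> R[i]).
Hypothesis pair_psi : FT_pair psi Psi.
Hypothesis psi0 : forall t, t < 0 -> psi t = 0.
Let psi2 : L2 (leb R) psi. Proof. by case: pair_psi. Qed.
Let Psi2 : L2 (leb R) Psi. Proof. by case: pair_psi. Qed.

Local Notation rho := (trunc_DA n tau T a psi).
Let mrho : cmeasurable (setT : set RR) rho :=
  cmeasurable_trunc_DA htau hT ha ha2 psi2 psi0.

Let rho_ae : {ae leb R, forall t, rho t = cind (`]0, T]%classic : set R) t * causal_conv n tau T a psi t}.
Proof.
by apply: (ae_mono _ (@ae_neq0 R)) => t t0; exact: trunc_DA_conv.
Qed.

Let mcc : cmeasurable (setT : set RR)
  (fun t => cind (`]0, T]%classic : set R) t * causal_conv n tau T a psi t).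
Proof.
apply: cmeasurableM; last exact: cmeasurable_causal_conv.
by apply: cmeasurable_real; apply: measurable_indic; exact: measurable_itv.
Qed.

(** A Hilbert-Schmidt bound: Cauchy-Schwarz estimates the square at [t] by [nrm psi] times the
    integral of [|b|^2] over [[t, T]], and the integral of the latter over [t] is
    [integral_triangle]. *)
Lemma L2_trunc_DA : L2 (leb R) rho.
Proof.
split=> //; rewrite (ae_eq_L2sq mrho mcc rho_ae) /L2sq.
pose N := nrm (leb R) psi; have N0 : 0 <= N := nrm_ge0 _ _.
have mI : measurable_fun setT (fun t : RR => \int[leb R]_s (\1_triangle (t, s) * sqnormc (b s))%:E)%E.
  apply: (@measurable_fun_fubini_tonelli_F _ _ RR RR R lebesgue_measure
     (fun p : RR * RR => (\1_triangle p * sqnormc (b p.2))%:E)); last first.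
    by move=> p; rewrite lee_fin mulr_ge0 ?sqnormc_ge0.
  apply/measurable_EFinP; apply: measurable_funM; first exact: measurable_indic.
  apply: measurable_sqnormc.
  exact: (cmeasurable_comp (u := (snd : RR * RR -> RR))).
have I0 (t : RR) : (0 <= \int[leb R]_s (\1_triangle (t, s) * sqnormc (b s))%:E)%E.
  by apply: integral_ge0 => s _; rewrite lee_fin mulr_ge0 ?sqnormc_ge0.
apply: (@le_lt_trans _ _ (N%:E * \int[leb R]_t \int[leb R]_s (\1_triangle (t, s) * sqnormc (b s))%:E)%E).
  have I0' (t : RR) : setT t -> (0 <= \int[leb R]_s (\1_triangle (t, s) * sqnormc (b s))%:E)%E.
    by move=> _; exact: I0.
  rewrite -(ge0_integralZl_EFin (leb R) measurableT I0' mI N0).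
  apply: ge0_le_integral; first exact: measurableT.
  - by move=> t _; rewrite lee_fin sqnormc_ge0.
  - by apply/measurable_EFinP; exact: measurable_sqnormc.
  - by apply: emeasurable_funM; [exact: measurable_cst|exact: mI].
  move=> t _; rewrite cind_itvE in_itv /=.
  have [/andP[t0 tT]|_] := boolP (0 < t <= T); last first.
    by rewrite mul0r sqnormc0 mule_ge0 // lee_fin.
  rewrite mul1r; have b2 := L2_trunc_b htau ha ha2 t0.
  apply: (@le_trans _ _ (nrm (leb R) (fun s => cind (`[t, T]%classic : set R) s * b s) * N)%:E).
    by rewrite lee_fin; exact: sqnormc_causal_conv_le.
  rewrite mulrC EFinM -(L2sqE b2); apply: lee_wpmul2l; first by rewrite lee_fin.
  rewrite le_eqVlt; apply/orP; left; apply/eqP; apply: eq_integral => s _; congr (_%:E).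
  rewrite sqnormcM cind_itvE in_itv /= indicE.
  rewrite in_triangle t0 /=.
  have [h|/negP h] := boolP (s <= T).
    by rewrite andbT; case: (t <= s); rewrite ?sqnormc1 ?sqnormc0.
  by rewrite trunc_b_out ?sqnormc0 ?mulr0 // => /andP[].
have : (\int[leb R]_t \int[leb R]_s (\1_triangle (t, s) * sqnormc (b s))%:E)%E \is a fin_num.
  by rewrite ge0_fin_numE ?integral_triangle //; exact: integral_ge0.
by move=> /fineK <-; rewrite -EFinM ltry.
Qed.

(** At [psi = Wop n tau phi] this is [rchar] by conversion; the arguments below concern an arbitrary
    causal [psi]. *)
Definition rch (l : R) : R[i] :=
  cintegral (leb R) `[0, T] (fun t => DAop n tau T a psi t * expi (t * l)).

Lemma L2b_trunc_DA : L2b rho.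
Proof.
split; first exact: L2_trunc_DA.
exists T; first exact: ltW.
move=> t h; rewrite /trunc_DA cind_itvE in_itv /=.
have [/andP[h1 h2]|] := boolP (0 <= t <= T); last by rewrite mul0r.
by exfalso; apply: h; rewrite h2 andbT; move: hT; lra.
Qed.

Lemma rchE l : rch l = cintegral (leb R) setT (fun t => rho t * expi (t * l)).
Proof.
rewrite /rch cintegral_indic; congr cintegral; apply/funext => t.
by rewrite /trunc_DA /cind mulrA.
Qed.

(** The phase of [rch] has the sign opposite to that of the Fourier transform, so its conjugate, not
    [rch] itself, is the transform of a causal function. *)
Lemma FT_pair_rch : FT_pair (fun t => (rho t)^*) (fun l => (rch l)^*).
Proof.
have br := L2b_trunc_DA; have ir := L2b_cintegrable br.
have bc : L2b (fun t => (rho t)^*).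
  have [r2 [N N0 h]] := br; split; first exact: L2_conj.
  by exists N => // t tN; rewrite h // rmorph0.
have := FT_pair_L2b bc; congr FT_pair; apply: funextR => l.
rewrite rchE -cintegral_conj; last first.
  apply: (cintegrable_le (h := fun t : RR => ComplexField.Normc.normc (rho t))).
  - by apply: cmeasurableM; [exact: mrho|exact: cmeasurable_phase_pos].
  - exact: cintegrable_normc.
  - by move=> t; rewrite normcM normc_expi mulr1.
by congr cintegral; apply: funextR => t; rewrite conjcM -expiN mulrC [t * l]mulrC mulrC.
Qed.

Lemma L2_rch : L2 (leb R) rch.
Proof.
have [_ r2 _] := FT_pair_rch; have := L2_conj r2.
by congr L2; apply/funext => l; rewrite conjCK.
Qed.

Lemma nrm_rch : (L2sq (leb R) setT rch = (2 * pi)%:E * L2sq (leb R) `[0%R, T] (DAop n tau T a psi))%E.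
Proof.
have -> : L2sq (leb R) `[0%R, T] (DAop n tau T a psi) = L2sq (leb R) setT rho.
  rewrite /L2sq [LHS]integral_mkcond; apply: eq_integral => t _; rewrite patchE /trunc_DA /cind indicE.
  by case: (t \in _); rewrite ?mul1r ?mul0r ?sqnormc0.
rewrite (L2sqE L2_rch) (L2sqE L2_trunc_DA) -EFinM; congr (_%:E).
by have := FT_pair_nrm FT_pair_rch; rewrite !nrm_conj.
Qed.

Lemma AcharE l : Achar n tau T a l = cintegral (leb R) setT (fun t => b t * expi (t * l)).
Proof.
rewrite /Achar cintegral_indic; congr cintegral; apply: funextR => t.
rewrite -/(cind _ t) cind_itvE in_itv /=; have [h|/negP h] := boolP (0 <= t <= T).
  by rewrite mul1r trunc_bE.
by rewrite trunc_b_out // !mul0r.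
Qed.

Lemma cmeasurable_Achar : cmeasurable (setT : set RR) (Achar n tau T a).
Proof.
rewrite (_ : Achar _ _ _ _ = (fun l => cintegral (leb R) setT (fun t => b t * expi (t * l)))).
  apply: (leb_cmeasurable_param (F := fun p : RR * RR => b p.2 * expi (p.2 * p.1))).
  apply: cmeasurableM; first exact: (cmeasurable_comp (u := (snd : RR * RR -> RR))).
  by apply: cmeasurable_expi; exact: measurable_funM.
by apply: funextR => l; exact: AcharE.
Qed.

Let C := \int[leb R]_t ComplexField.Normc.normc (b t).
Let ib : cintegrable (leb R) setT b := cintegrable_trunc_b htau ha ha1.

Lemma cintegrable_phase_pos g (l : R) : cintegrable (leb R) setT g ->
  cintegrable (leb R) setT (fun t => g t * expi (t * l)).
Proof.
move=> ig; apply: (cintegrable_le (h := fun t : RR => ComplexField.Normc.normc (g t))).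
- apply: cmeasurableM; first exact: cintegrable_cmeasurable ig.
  exact: cmeasurable_phase_pos.
- exact: cintegrable_normc.
- by move=> t; rewrite normcM normc_expi mulr1.
Qed.

Lemma sqnormc_Achar_le l : sqnormc (Achar n tau T a l) <= 2 * C ^+ 2.
Proof.
rewrite AcharE (_ : cintegral _ _ _ = fhat b (- l)); first exact: sqnormc_fhat_le_L1.
by rewrite /fhat; congr cintegral; apply/funext => t; congr (_ * expi _); ring.
Qed.

Lemma L2_Achar_mul K : L2 (leb R) K -> L2 (leb R) (fun l => Achar n tau T a l * K l).
Proof.
apply: (L2_mul_bounded (X := RR) (b := Achar n tau T a) (B := 2 * C ^+ 2)).
  exact: cmeasurable_Achar.
exact: sqnormc_Achar_le.
Qed.

(** Both parts of the integral equal [2 * pi] times that of [g2 * rho]. For [rch] this is Parseval's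
    identity. For [Achar], which superposes the phases [expi (t * l)] with density [b t], it is the
    convolution formula at each [t] followed by an exchange of integrals: a causal [g2] sees only
    [w >= 0], where the correlation of [b] with [psi] is [D A psi]. *)
Lemma integral_prediction g2 G2 : FT_pair g2 G2 -> (forall t, t < 0 -> g2 t = 0) ->
  cintegral (leb R) setT (fun l => (Achar n tau T a l * Psi l - rch l) * G2 l) = 0.
Proof.
move=> P2 g20; have [g22 G22 _] := P2; have [mg2 _] := g22; have [mG2 _] := G22.
have [mPsi _] := Psi2; have [mpsi _] := psi2.
have iPG : cintegrable (leb R) setT (fun l => Psi l * G2 l) by exact: L2M_cintegrable.
transitivity (cintegral (leb R) setT (fun l => Achar n tau T a l * Psi l * G2 l) -
              cintegral (leb R) setT (fun l => rch l * G2 l)).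
  rewrite -cintegralB.
  - by congr cintegral; apply/funext => l; rewrite mulrBl.
  - by apply: L2M_cintegrable => //; exact: L2_Achar_mul.
  - by apply: L2M_cintegrable => //; exact: L2_rch.
apply/eqP; rewrite subr_eq0; apply/eqP.
have E1 : cintegral (leb R) setT (fun l => rch l * G2 l) =
    (2 * pi)%:C * cintegral (leb R) setT (fun w => g2 w * rho w).
  transitivity (ip (leb R) G2 (fun l => (rch l)^*)).
    by congr cintegral; apply/funext => l; rewrite conjCK mulrC.
  rewrite (FT_pair_ip P2 FT_pair_rch); congr (_ * _).
  by congr cintegral; apply/funext => l; rewrite conjCK.
have E2 : cintegral (leb R) setT (fun l => Achar n tau T a l * Psi l * G2 l) =
    cintegral (leb R) setT (fun t => b t * ((2 * pi)%:C *
      cintegral (leb R) setT (fun w => g2 w * psi (t - w)))).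
  pose F (p : RR * RR) := (Psi p.1 * G2 p.1) * (b p.2 * expi (p.2 * p.1)).
  have mF : cmeasurable setT F.
    apply: cmeasurableM.
      exact: (cmeasurable_comp (u := (fst : RR * RR -> RR)) _ (cintegrable_cmeasurable iPG)).
    apply: cmeasurableM; first exact: (cmeasurable_comp (u := (snd : RR * RR -> RR))).
    by apply: cmeasurable_expi; exact: measurable_funM.
  have nF : (\int[leb R]_x \int[leb R]_y (ComplexField.Normc.normc (F (x, y)))%:E < +oo)%E.
    have -> : (\int[leb R]_x \int[leb R]_y (ComplexField.Normc.normc (F (x, y)))%:E =
        \int[leb R]_x \int[leb R]_y (ComplexField.Normc.normc (Psi x * G2 x) *
           ComplexField.Normc.normc (b y))%:E)%E.
      apply: eq_integral => x _; apply: eq_integral => y _.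
      by rewrite /F /= normcM (normcM (b y)) normc_expi mulr1.
    exact: (iterated_product_lty (cintegrable_normc iPG) (cintegrable_normc ib)
      (fun=> normc_ge0 _) (fun=> normc_ge0 _)).
  transitivity (cintegral (leb R) setT (fun x => cintegral (leb R) setT (fun y => F (x, y)))).
    congr cintegral; apply: funextR => l; rewrite /F /= cintegralZ; last exact: cintegrable_phase_pos.
    by rewrite -AcharE; ring.
  have [_ ->] := leb_Fubini mF nF; congr cintegral; apply: funextR => t.
  rewrite -(FT_pair_convolution t pair_psi P2) -cintegralZ.
    by congr cintegral; apply: funextR => l; rewrite /F /= [l * t]mulrC; ring.
  have := cintegrable_phase_pos t iPG; congr cintegrable.
  by apply: funextR => l; rewrite mulrC.
rewrite E1 E2 {E1 E2}; pose H (p : RR * RR) := b p.1 * (g2 p.2 * psi (p.1 - p.2)).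
have mH : cmeasurable setT H.
  apply: cmeasurableM; first exact: (cmeasurable_comp (u := (fst : RR * RR -> RR))).
  apply: cmeasurableM; first exact: (cmeasurable_comp (u := (snd : RR * RR -> RR))).
  apply: (cmeasurable_comp (u := (fun p : RR * RR => (p.1 - p.2 : RR)))) => //.
  exact: measurable_funB.
have psit t : L2 (leb R) (fun w => psi (t - w)).
  exact: (L2_preserving (leb_preserving_reflect t)).
(* [|g2 y * psi (x - y)|] is at most the sum of the two squares, whose integral [D] is independent
   of [x]. The integrability of [b] then suffices for Fubini's theorem. *)
pose D := nrm (leb R) g2 + nrm (leb R) psi.
have nH : (\int[leb R]_x \int[leb R]_y (ComplexField.Normc.normc (H (x, y)))%:E < +oo)%E.
  apply: (@le_lt_trans _ _ (\int[leb R]_x (D%:E * (ComplexField.Normc.normc (b x))%:E))%E); last first.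
    have D0 : 0 <= D by rewrite addr_ge0 ?nrm_ge0.
    rewrite (@ge0_integralZl_EFin _ _ _ (leb R) setT measurableT (fun y => (ComplexField.Normc.normc (b y))%:E) _ (measurable_int _ (cintegrable_normc ib)) _ D0) //.
      have /fineK <- : (\int[leb R]_y (ComplexField.Normc.normc (b y))%:E)%E \is a fin_num.
        exact: (integrable_fin_num _ (cintegrable_normc ib)).
      by rewrite -EFinM ltry.
    by move=> y _; rewrite lee_fin normc_ge0.
  have mN : measurable_fun setT (fun p : RR * RR => (ComplexField.Normc.normc (H p))%:E).
    by apply/measurable_EFinP; exact: measurable_normc.
  apply: ge0_le_integral => //.
  - by move=> x _; apply: integral_ge0 => y _; rewrite lee_fin normc_ge0.
  - apply: (@measurable_fun_fubini_tonelli_F _ _ RR RR R lebesgue_measure _ mN).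
    by move=> p; rewrite lee_fin normc_ge0.
  - apply: emeasurable_funM; first exact: measurable_cst.
    exact: (measurable_int _ (cintegrable_normc ib)).
  move=> x _; have i1 := L2_int g22; have i2 := L2_int (psit x).
  apply: (@le_trans _ _ (\int[leb R]_y ((ComplexField.Normc.normc (b x))%:E *
      (sqnormc (g2 y) + sqnormc (psi (x - y)))%:E))%E).
    apply: ge0_le_integral => //.
    - by move=> y _; rewrite lee_fin normc_ge0.
    - by apply: (measurableT_comp mN); exact: measurable_pair1.
    - apply: emeasurable_funM; first exact: measurable_cst.
      by apply/measurable_EFinP; apply: measurable_funD; apply: measurable_sqnormc => //; case: (psit x).
    move=> y _; rewrite -EFinM lee_fin /H /= normcM ler_wpM2l ?normc_ge0 // normcM /sqnormc.
    have := sqr_ge0 (ComplexField.Normc.normc (g2 y) - ComplexField.Normc.normc (psi (x - y))).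
    have := normc_ge0 (g2 y); have := normc_ge0 (psi (x - y)).
    by move: (ComplexField.Normc.normc (g2 y)) (ComplexField.Normc.normc (psi (x - y))) => u v; nra.
  have s2 : (\int[leb R]_y (sqnormc (g2 y) + sqnormc (psi (x - y)))%:E = D%:E)%E.
    under eq_integral do rewrite EFinD.
    rewrite (integralD measurableT i1 i2) /D EFinD -(L2sqE g22) -(L2sqE psi2).
    by congr (_ + _)%E; exact: (L2sq_preserving (leb_preserving_reflect x) mpsi).
  have mS : measurable_fun setT (fun y => (sqnormc (g2 y) + sqnormc (psi (x - y)))%:E).
    by apply/measurable_EFinP; apply: measurable_funD; apply: measurable_sqnormc => //; case: (psit x).
  have S0 (y : RR) : setT y -> (0 <= (sqnormc (g2 y) + sqnormc (psi (x - y)))%:E)%E.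
    by move=> _; rewrite lee_fin addr_ge0 ?sqnormc_ge0.
  by rewrite (ge0_integralZl_EFin (leb R) measurableT S0 mS (normc_ge0 (b x))) s2 muleC.
have [iH EH] := leb_Fubini mH nH.
transitivity ((2 * pi)%:C * cintegral (leb R) setT (fun x => cintegral (leb R) setT (fun y => H (x, y)))).
  rewrite -(cintegralZ _ iH); congr cintegral; apply: funextR => t.
  have it : cintegrable (leb R) setT (fun w => g2 w * psi (t - w)).
    exact: L2M_cintegrable g22 (psit t).
  by rewrite /H /= (cintegralZ _ it) mulrCA.
rewrite {}EH; congr (_ * _); apply: ae_eq_cintegral.
- by apply: (@cmeasurable_param2 _ _ _ RR RR lebesgue_measure H).
- exact: cmeasurableM.
apply: (ae_mono _ (@ae_neq0 R)) => w w0.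
have [wn|wp] := ltP w 0.
  rewrite g20 // mul0r (_ : (fun x => _) = (fun=> 0)) ?cintegral0 //.
  by apply: funextR => t; rewrite /H /= g20 // mul0r mulr0.
have wp' : 0 < w by rewrite lt_def w0.
transitivity (g2 w * causal_conv n tau T a psi w).
  rewrite /causal_conv -cintegralZ.
    by congr cintegral; apply: funextR => t; rewrite /H /=; ring.
  have := L2M_cintegrable (L2_trunc_b htau ha ha2 wp') (L2_preserving (leb_preserving_shift (- w)) psi2).
  congr cintegrable; apply: funextR => t; rewrite cind_itvE in_itv /=.
  have [tw|tw] := ltP t w; first by rewrite psi0 ?mulr0 // subr_lt0.
  have [h|/negP h] := boolP (t <= T); first by rewrite mul1r.
  by rewrite trunc_b_out ?mulr0 ?mul0r // => /andP[].
congr (_ * _); rewrite trunc_DA_conv // cind_itvE in_itv /= wp' /=.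
have [h|h] := boolP (w <= T); first by rewrite mul1r.
by rewrite mul0r causal_conv_out // ltNge.
Qed.

(** A phase [expi (- (l * x))] with [x >= 0] only delays [g2], which stays causal, so
    [integral_prediction] applies to the delayed pair. *)
Lemma wH1_prediction g2 G2 : FT_pair g2 G2 -> (forall t, t < 0 -> g2 t = 0) ->
  wH1 (fun l => (Achar n tau T a l * Psi l - rch l) * G2 l).
Proof.
move=> P2 g20; have [_ G22 _] := P2; split.
  by apply: L2M_cintegrable => //; apply: L2B; [exact: L2_Achar_mul|exact: L2_rch].
move=> x x0; have := FT_pair_shift (- x) P2 => /integral_prediction.
move=> H; rewrite -[RHS]H; last by move=> t t0; apply: g20; lra.
by congr cintegral; apply/funext => l; rewrite mulrN; ring.
Qed.

End Causal.
End PredictionError.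

(** * A process with given spectral density *)

Section ChiZeros.
Context {R : realType}.
Local Notation RR := (measurableTypeR R).

Lemma cos_eq1 (x : R) : cos x = 1 -> exists k : nat, `|x| = 2 * pi * k%:R.
Proof.
have p0 : 0 < 2 * pi :> R by rewrite mulr_gt0 ?pi_gt0.
have H (y : R) : 0 <= y -> cos y = 1 -> exists k : nat, y = 2 * pi * k%:R.
  move=> y0 cy; exists (Num.truncn (y / (2 * pi))).
  have /andP[h1 h2] : (Num.truncn (y / (2 * pi)))%:R <= y / (2 * pi) < (Num.truncn (y / (2 * pi))).+1%:R.
    by rewrite Num.Theory.truncn_itv // divr_ge0 // ltW.
  set k := Num.truncn _ in h1 h2 *; pose z := y - 2 * pi * k%:R.
  have z0 : 0 <= z by rewrite /z subr_ge0 mulrC -ler_pdivlMr.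
  have z2 : z < 2 * pi by move: h2; rewrite ltr_pdivrMr // /z -natr1 mulrDl mul1r mulrC; lra.
  have cz : cos z = 1.
    rewrite -cy -(periodicn (@cosD2pi R) k z); congr cos; rewrite /z.
    by rewrite -[_ *+ k]mulr_natr -[pi *+ 2]mulr_natr; ring.
  suff : z = 0 by rewrite /z => /eqP; rewrite subr_eq0 => /eqP.
  have [zp|zp] := leP z pi.
    by apply: (@cos_inj R); rewrite ?in_itv /= ?z0 ?lexx ?pi_ge0 // cos0.
  (* Beyond [pi], injectivity of the cosine on [[0, pi]] is applied to [2 * pi - z]; the outcome
     [z = 2 * pi] contradicts [z < 2 * pi]. *)
  suff : 2 * pi - z = 0 by move=> e; move: z2; rewrite (_ : z = 2 * pi); lra.
  apply: (@cos_inj R); rewrite ?in_itv /= ?lexx ?pi_ge0 ?andbT //; first by apply/andP; split; lra.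
  rewrite cos0 -[RHS]cz -[RHS]cosN -[RHS]cosD2pi; congr cos.
  by rewrite -[pi *+ 2]mulr_natr; ring.
move=> cx; apply: H; first exact: normr_ge0.
by case: (ger0P x) => h; rewrite ?cosN.
Qed.

Lemma expi_neq1_ae (s : R) : s != 0 -> \forall l \ae leb R, expi (- (l * s)) != 1.
Proof.
move=> s0; pose D : set R := (fun p : nat * bool => (-1) ^+ p.2 * (2 * pi * p.1%:R) / s) @` setT.
have cD : countable D by apply: card_le_trans (card_image_le _ _) _; exact: countableP.
exists D; split.
- exact: countable_measurable.
- exact: countable_lebesgue_measure0.
- move=> l /= /negP; rewrite negbK => /eqP /(congr1 (@complex.Re _)) /=.
  rewrite cosN => /cos_eq1[k hk]; exists (k, l * s < 0) => //=.
  rewrite -hk; case: (ltrP (l * s) 0) => h.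
    by rewrite ltr0_norm //= expr1 mulN1r opprK mulfK.
  by rewrite ger0_norm //= expr0 mul1r mulfK.
Qed.

Lemma chi_neq0_ae n (s : R) : 0 < s -> \forall l \ae leb R, chi n s l != 0.
Proof.
move=> s0; apply: ae_mono2 (expi_neq1_ae (lt0r_neq0 s0)) ae_neq0 => l h l0.
rewrite /chi !mulf_neq0 ?invr_eq0 ?expf_neq0 //.
- by rewrite subr_eq0 eq_sym.
- by rewrite eq_complex /= oner_eq0.
- by rewrite eq_complex /= negb_and l0 orbT.
Qed.

End ChiZeros.

Lemma add_halves_density {R : realType} (p q J : R) : p != 0 -> q != 0 ->
  (4 * p * q)^-1 * J + (4 * p * q)^-1 * J = (2 * p * q)^-1 * J.
Proof. by move=> a b; field; rewrite a b. Qed.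

Lemma mul_half_quotient {R : realType} (p e : R) : p != 0 -> p * (e / (2 * p)) = e / 2.
Proof. by move=> a; field. Qed.

Section RandomPhaseProcess.
Context {R : realType}.
Local Notation RR := (measurableTypeR R).
Local Notation X := (RR * bool)%type.
Variables (n : nat) (P0 : R) (f : R -> R).
Hypotheses (hP0 : 0 < P0) (fs : spectral_density f).
Hypothesis f1 : (\int[leb R]_l (f l)%:E = (2 * pi * P0)%:E)%E.

(** Half of the normalized density: each of the two signs receives mass one half, as [f] has
    integral [2 * pi * P0]. *)
Definition half_density (l : RR) : \bar R := (f l / (4 * pi * P0))%:E.

Let mhd : measurable_fun setT half_density.
Proof.
apply/measurable_EFinP; apply: measurable_funM; last exact: measurable_cst.
by case: fs.
Qed.

Let c0 : 0 < 4 * pi * P0. Proof. by rewrite !mulr_gt0 ?pi_gt0. Qed.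

Let hd0 l : (0 <= half_density l)%E.
Proof. by rewrite lee_fin divr_ge0 ?(ltW c0) //; case: fs. Qed.

Let ihd : (leb R).-integrable setT half_density.
Proof.
case: fs => _ _ fi.
rewrite (_ : half_density = fun l => ((4 * pi * P0)^-1)%:E * (f l)%:E)%E; first exact: integrableZl.
by apply/funext => l; rewrite /half_density mulrC EFinM.
Qed.

Let half_measure : set RR -> \bar R := fun A => (\int[leb R]_(l in A) half_density l)%E.

Let hm0 : half_measure set0 = 0%E. Proof. exact: integral_set0. Qed.
Let hm_ge0 A : (0 <= half_measure A)%E. Proof. exact: integral_ge0. Qed.
Let hm_sigma : semi_sigma_additive half_measure.
Proof. exact: semi_sigma_additive_nng_induced. Qed.

HB.instance Definition _ := isMeasure.Build _ _ _ half_measure hm0 hm_ge0 hm_sigma.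

Let mpair (b : bool) : measurable_fun setT (fun l : RR => (l, b) : X).
Proof. exact: pair2_measurable. Qed.

Let branch (b : bool) : {measure set X -> \bar R} := 
  measure_function_pushforward__canonical__measure_function_Measure half_measure (mpair b).

Let phase_measure : set X -> \bar R := measure_add (branch true) (branch false).
HB.instance Definition _ := Measure.on phase_measure.

Let phase_measureE A : phase_measure A = (half_measure [set l | A (l, true)] +
  half_measure [set l | A (l, false)])%E.
Proof. exact: measure_addE. Qed.

Let half_measureE A : measurable A ->
  half_measure A = ((4 * pi * P0)^-1 * \int[leb R]_(l in A) f l)%:E.
Proof.
move=> mA; rewrite /half_measure /half_density; case: fs => mf f0 fi.
have fA : (leb R).-integrable A (fun l => (f l)%:E) by apply: integrableS fi.
under eq_integral do rewrite mulrC EFinM.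
by rewrite integralZl // EFinM /Rintegral fineK // integrable_fin_num.
Qed.

Let phase_measure1 : phase_measure setT = 1%E.
Proof.
rewrite phase_measureE.
have -> : [set l | [set: X] (l, true)] = setT by apply/seteqP; split.
rewrite (half_measureE measurableT) /Rintegral f1 -EFinD; congr (_%:E).
have a := lt0r_neq0 hP0; have b := lt0r_neq0 (pi_gt0 R).
by rewrite add_halves_density // mulVf // !mulf_neq0.
Qed.

HB.instance Definition _ := Measure_isProbability.Build _ _ _ phase_measure phase_measure1.

Let P : probability X R := phase_measure.

Let sgn (w : X) : R[i] := (if w.2 then 1 else - 1) * (Num.sqrt P0)%:C.
Let Z (A : set R) (w : X) : R[i] := sgn w * cind A w.1.
Let xi (t : R) (w : X) : R[i] :=
  sgn w * (expi (t * w.1) * ((1 +i* w.1) ^+ n / (0 +i* w.1) ^+ n)).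

Let sqnormc_sgn w : sqnormc (sgn w) = P0.
Proof.
rewrite /sgn sqnormcM sqnormc_real sqr_sqrtr ?(ltW hP0) //.
by case: (w.2); rewrite ?sqnormcN sqnormc1 mul1r.
Qed.

Let msgn : cmeasurable setT sgn.
Proof.
apply: cmeasurableM; last exact: cmeasurable_cst.
apply: (cmeasurable_if (b := snd)); try exact: cmeasurable_cst.
exact: measurable_snd.
Qed.

Let sgnM w (z y : R[i]) : sgn w * z * (sgn w * y)^* = P0%:C * (z * y^*).
Proof. by rewrite -(sqnormc_sgn w) -mulc_conj conjcM; ring. Qed.

Let mZ (A : set RR) : measurable A -> cmeasurable setT (Z A).
Proof.
move=> mA; apply: cmeasurableM => //.
apply: (cmeasurable_comp (u := (fst : X -> RR)) (g := cind A)); first exact: measurable_fst.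
by apply: cmeasurable_real; exact: measurable_indic.
Qed.

Let mxi t : cmeasurable setT (xi t).
Proof.
apply: cmeasurableM => //.
apply: (cmeasurable_comp (u := (fst : X -> RR)) (g := fun l => expi (t * l) * ((1 +i* l) ^+ n / (0 +i* l) ^+ n))).
  exact: measurable_fst.
apply: cmeasurableM.
  by apply: cmeasurable_expi; apply: measurable_funM => //; exact: measurable_cst.
rewrite (_ : (fun x => _) = (fun x => (1 +i* x) ^+ n * ((0 +i* x)^-1) ^+ n)); last by apply/funext => x; rewrite exprVn.
apply: cmeasurableM; apply: cmeasurableX; last exact: cmeasurable_itv_inv.
by split; [exact: measurable_cst|exact: measurable_id].
Qed.

(** By the binomial theorem the difference of order [n] multiplies the phase by
    [(1 - expi (- (l * s))) ^+ n], which completes the factor of [xi] to [chi n s]. The increments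
    are thus bounded although the factor of [xi] has a pole at [0]. *)
Let incr_xi t s w : incr n xi t s w = sgn w * (expi (t * w.1) * chi n s w.1).
Proof.
have phaseE (y : R) (l : nat) : expi ((t - l%:R * s) * y) = expi (t * y) * expi (- (y * s)) ^+ l.
  by rewrite expiX -expiD; congr expi; ring.
have E (A B S K Y : R[i]) : A * (S * (Y * B * K)) = S * (Y * (A * B * K)) by ring.
rewrite /incr /xi /chi; set K := _ / _.
transitivity (sgn w * (expi (t * w.1) * ((\sum_(l < n.+1)
   (-1) ^+ l * 'C(n, l)%:R * expi (- (w.1 * s)) ^+ l) * K))).
  by rewrite mulr_suml !mulr_sumr; apply: eq_bigr => l _; rewrite phaseE E.
congr (_ * (_ * _)); rewrite -mulrA; congr (_ * _).
rewrite exprDn; apply: eq_bigr => l _.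
by rewrite expr1n mul1r [in RHS]exprNn -[RHS]mulr_natr -!mulrA [in LHS](mulrC 'C(n, l)%:R).
Qed.

Let mincr t s : cmeasurable setT (incr n xi t s).
Proof. by apply: cmeasurable_sum => i; apply: cmeasurableM; [exact: cmeasurable_cst|exact: mxi]. Qed.

Let flip (w : X) : X := (w.1, ~~ w.2).

Let flip_preserving : preserving P flip.
Proof.
split.
  apply: measurable_fun_pair; first exact: measurable_fst.
  by apply: (measurableT_comp (f := negb)) => //; exact: measurable_snd.
move=> A mA; rewrite [LHS]phase_measureE [RHS]phase_measureE addeC.
by congr (half_measure _ + half_measure _)%E.
Qed.

Let sgn_flip w : sgn (flip w) = - sgn w.
Proof. by rewrite /sgn /flip /=; case: (w.2); rewrite /= !mulN1r ?opprK !mul1r. Qed.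

Let mean0 (g : X -> R[i]) : cintegrable P setT g -> (forall w, g (flip w) = - g w) ->
  cintegral P setT g = 0.
Proof.
move=> ig gf; have := cintegral_preserving flip_preserving (cintegrable_cmeasurable ig).
under [X in cintegral _ _ X = _]eq_fun do rewrite gf.
by rewrite cintegralN // => /eqP; rewrite eq_sym -addr_eq0 -mulr2n mulrn_eq0 /= => /eqP.
Qed.

Let bounded_L2 (g : X -> R[i]) (B : R) : cmeasurable setT g -> (forall w, sqnormc (g w) <= B) ->
  L2 P g /\ (L2sq P setT g <= B%:E)%E.
Proof.
move=> mg gB; have L : (L2sq P setT g <= B%:E)%E.
  apply: (@le_trans _ _ (\int[P]_w (cst B%:E) w)%E).
    apply: ge0_le_integral => //=.
    - by move=> w _; rewrite lee_fin sqnormc_ge0.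
    - by apply/measurable_EFinP; exact: measurable_sqnormc.
    - by move=> w _; rewrite lee_fin.
  by rewrite integral_cst // [X in (_ * X)%E](phase_measure1 : _ = 1%E) mule1.
by split => //; split => //; apply: le_lt_trans L _; exact: ltry.
Qed.

Let bounded_cintegrable (g : X -> R[i]) (B : R) : cmeasurable setT g ->
  (forall w, sqnormc (g w) <= B) -> cintegrable P setT g.
Proof.
move=> mg gB; have [L _] := bounded_L2 mg gB.
have [L1 _] := bounded_L2 (cmeasurable_cst _ (1 : R[i])) (fun=> lexx (sqnormc (1 : R[i]))).
by have := L2M_cintegrable L L1; under eq_fun do rewrite mulr1.
Qed.

Let sqnormc_incr s t w : 0 <= s -> sqnormc (incr n xi t s w) <= P0 * (2 * s ^+ 2 + 8) ^+ n.
Proof.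
move=> s0; rewrite incr_xi sqnormcM sqnormc_sgn sqnormcM sqnormc_expi mul1r ler_wpM2l ?(ltW hP0) //.
exact: sqnormc_chi_le.
Qed.

Let stationary_xi : stationary_increments P n xi.
Proof.
split => //.
- by move=> t s s0; have [[]] := bounded_L2 (mincr t s) (fun w => sqnormc_incr t w (ltW s0)).
- move=> t s s0; apply: mean0; last by move=> w; rewrite !incr_xi sgn_flip mulNr.
  exact: bounded_cintegrable (mincr t s) (fun w => sqnormc_incr t w (ltW s0)).
- move=> t s1 s2 t0 t0' s10 s20; congr cintegral; apply/funext => w.
  have E (z : R) : expi ((z + t) * w.1) * chi n s1 w.1 * (expi (z * w.1) * chi n s2 w.1)^* =
      expi (t * w.1) * chi n s1 w.1 * (chi n s2 w.1)^*.
    rewrite mulrDl expiD conjcM.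
    transitivity (expi (z * w.1) * (expi (z * w.1))^* * (expi (t * w.1) * chi n s1 w.1 * (chi n s2 w.1)^*)).
      by ring.
    by rewrite mulc_conj sqnormc_expi mul1r.
  by rewrite !incr_xi !sgnM !E.
Qed.

Let phase_measure_fst (A : set RR) : measurable A ->
  P (fst @^-1` A) = ((2 * pi * P0)^-1 * \int[leb R]_(l in A) f l)%:E.
Proof.
move=> mA; rewrite [LHS]phase_measureE.
have E b : [set l | (fst @^-1` A) (l, b)] = A by [].
rewrite !E (half_measureE mA) -EFinD add_halves_density //; last exact: lt0r_neq0.
exact: lt0r_neq0 (pi_gt0 R).
Qed.

Let orthogonal_Z : orthogonal_measure P f Z.
Proof.
have bZ (A : set RR) w : sqnormc (Z A w) <= P0.
  rewrite sqnormcM sqnormc_sgn -[leRHS]mulr1 ler_wpM2l ?(ltW hP0) //.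
  by rewrite /cind sqnormc_real indicE; case: (_ \in _); rewrite ?expr1n ?expr0n.
split=> //.
- by move=> A mA; have [[]] := bounded_L2 (mZ mA) (bZ A).
- move=> A B mA mB; have mAB := measurableI _ _ mA mB.
  have mf : measurable (fst @^-1` (A `&` B) : set X).
    by rewrite -[Y in measurable Y]setTI; exact: measurable_fst.
  transitivity (cintegral P setT (fun w => P0%:C * cind (fst @^-1` (A `&` B)) w)).
    congr cintegral; apply/funext => w; rewrite /Z sgnM /cind conjc_ofreal -ofrealM.
    by rewrite indicI.
  rewrite cintegralZ; last first.
    apply: (@bounded_cintegrable _ 1); first by apply: cmeasurable_real; exact: measurable_indic.
    by move=> w; rewrite /cind sqnormc_real indicE; case: (_ \in _); rewrite ?expr1n ?expr0n.
  rewrite /cintegral /cind (_ : \int[P]_w _ = fine (P (fst @^-1` (A `&` B)))); last first.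
    by rewrite /Rintegral /= integral_indic // setIT.
  rewrite (_ : \int[P]_w _ = 0); last by rewrite /Rintegral /= integral0.
  rewrite phase_measure_fst // -[_ +i* 0]/(_%:C) -ofrealM [fine _]/=; congr (_%:C).
  by rewrite -[pi *+ 2]mulr_natl mulrA [(2 * pi * P0)^-1]invfM (mulrC P0) divfK // lt0r_neq0.
Qed.

Let simple_cind (del : R) (g : RR -> R[i]) (B : R) : cmeasurable setT g -> 0 < del ->
  (forall l, sqnormc (g l) <= B) ->
  exists m (c : 'I_m -> R[i]) (A : 'I_m -> set RR), (forall i, measurable (A i)) /\
    forall l, sqnormc (g l - \sum_(i < m) c i * cind (A i) l) <= del.
Proof.
move=> mg del0 gB; have [s [m [c [p [Hp ->]]]] gs] := simple_uniform mg del0 gB.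
have /choice[A HA] : forall i, exists A : set RR, measurable A /\ p i = cind A.
  by move=> i; have [A mA pA] := Hp i; exists A.
exists m, c, A; split => [i|l]; first by case: (HA i).
by have := gs l; congr (sqnormc (_ - _) <= _); apply: eq_bigr => i _; case: (HA i) => _ ->.
Qed.

Let spnorm2_le (g : R -> R[i]) (e : R) : cmeasurable (setT : set RR) g ->
  (forall l, sqnormc (g l) <= e) -> (spnorm2 f g <= (P0 * e)%:E)%E.
Proof.
move=> mg ge; have e0 : 0 <= e := le_trans (sqnormc_ge0 _) (ge 0).
case: fs => mf f0 _; have p0 : 0 <= (pi *+ 2)^-1 :> R by rewrite invr_ge0 mulrn_wge0 ?pi_ge0.
apply: (@le_trans _ _ (\int[leb R]_l (((pi *+ 2)^-1 * e)%:E * (f l)%:E))%E).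
  apply: ge0_le_integral => //=.
  - by move=> l _; rewrite lee_fin mulr_ge0 ?sqnormc_ge0 // mulr_ge0.
  - apply/measurable_EFinP; apply: measurable_funM; last exact: measurable_sqnormc.
    by apply: measurable_funM => //; exact: measurable_cst.
  - apply/measurable_EFinP; apply: measurable_funM => //; exact: measurable_cst.
  - move=> l _; rewrite -EFinM lee_fin -!mulrA ler_wpM2l // mulrC ler_wpM2r //; exact: ge.
have mfE : measurable_fun (setT : set RR) (fun l => (f l)%:E) by apply/measurable_EFinP.
have c0' : 0 <= (pi *+ 2)^-1 * e by rewrite mulr_ge0.
rewrite (ge0_integralZl_EFin (leb R) measurableT (f1 := fun l => (f l)%:E) (fun l _ => f0 l) mfE c0').
rewrite f1 -EFinM lee_fin -[pi *+ 2]mulr_natl mulrACA mulVf ?mul1r 1?mulrC //.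
by rewrite mulf_neq0 // lt0r_neq0 ?pi_gt0.
Qed.

(* canonical_factorization quantifies over all processes with the given density, so it carries
   information only once one exists: sqrt P0 e^{itl} ((1+il)/(il))^n with l drawn from the normalized
   spectral measure; an independent random sign makes it centred. *)
Lemma random_phase_process : exists d (Y : measurableType d) (Q : probability Y R)
  (x : R -> Y -> R[i]), has_spectral_density Q n x f /\
    forall t s, 0 < s -> L2sq Q setT (incr n x t s) <> 0%E.
Proof.
exists _, X, P, xi; split; first (split; [exact: stationary_xi|exists Z; first exact: orthogonal_Z]).
- move=> t s s0; have mg : cmeasurable (setT : set RR) (fun l => expi (t * l) * chi n s l).
    apply: cmeasurableM; last exact: cmeasurable_chi.
    by apply: cmeasurable_expi; apply: measurable_funM => //; exact: measurable_cst.
  split=> // e e0; have e1 : 0 < e / (2 * P0) by rewrite divr_gt0 // mulr_gt0.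
  have gB l : sqnormc (expi (t * l) * chi n s l) <= (2 * s ^+ 2 + 8) ^+ n.
    by rewrite sqnormcM sqnormc_expi mul1r sqnormc_chi_le // ltW.
  have [m [c [A [mA HA]]]] := simple_cind mg e1 gB.
  have he : ((P0 * (e / (2 * P0)))%:E < e%:E)%E.
    by rewrite mul_half_quotient ?lt0r_neq0 // lte_fin ltr_pdivrMr // ltr_pMr // ltr1n.
  exists m, c, (fun i => (cind (A i), Z (A i))); split.
  + by move=> i; exists (A i).
  + apply: le_lt_trans he; apply: spnorm2_le => //=.
    apply: cmeasurableB => //; apply: cmeasurable_sum => i; apply: cmeasurableM; first exact: cmeasurable_cst.
    by apply: cmeasurable_real; exact: measurable_indic.
  + apply: le_lt_trans he; have [|w|_ //] := @bounded_L2 (fun w => incr n xi t s w - \sum_(i < m) c i * Z (A i) w) (P0 * (e / (2 * P0))).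
      apply: cmeasurableB => //; apply: cmeasurable_sum => i; apply: cmeasurableM; first exact: cmeasurable_cst.
      exact: mZ.
    have -> : incr n xi t s w - \sum_(i < m) c i * Z (A i) w =
        sgn w * (expi (t * w.1) * chi n s w.1 - \sum_(i < m) c i * cind (A i) w.1).
      rewrite incr_xi mulrBr; congr (_ - _); rewrite mulr_sumr; apply: eq_bigr => i _.
      by rewrite /Z mulrCA.
    by rewrite sqnormcM sqnormc_sgn ler_wpM2l // ltW.
(* A vanishing increment would force [chi n s = 0] almost surely, while [chi n s] has only a null
   set of zeros and the law of the frequency has a density. *)
- move=> t s s0 h.
  have [L _] := bounded_L2 (mincr t s) (fun w => sqnormc_incr t w (ltW s0)).
  have [N [mN N0 hN]] : {ae P, forall w, incr n xi t s w = 0}.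
    by apply: nrm_eq0_ae => //; rewrite /nrm h.
  have mD : measurable [set l : RR | N (l, true)].
    by rewrite -[Y in measurable Y]setTI; exact: (mpair true).
  have D0 : half_measure [set l | N (l, true)] = 0%E.
    apply/eqP; rewrite eq_le measure_ge0 andbT; rewrite -N0 [leRHS]phase_measureE.
    by rewrite leeDl // measure_ge0.
  have [N' [mN' N'0 hN']] := chi_neq0_ae n s0.
  have E0 : half_measure N' = 0%E by apply: null_set_integral mN' _ N'0; exact: measurable_funTS.
  have T0 : (half_measure setT <= half_measure [set l | N (l, true)] + half_measure N')%E.
    apply: (@le_trans _ _ (half_measure ([set l | N (l, true)] `|` N'))); last exact: measureU2.
    rewrite le_measure ?inE //; first exact: measurableU.
    move=> l _; have [hl|hl] := pselect (N (l, true)); [by left|right].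
    apply: hN' => /= cl; apply: hl; apply: hN => hl.
    have : sgn (l, true) * (expi (t * l) * chi n s l) == 0 by rewrite -(incr_xi t s (l, true)); apply/eqP.
    rewrite mulf_eq0 [X in _ || X]mulf_eq0 (negPf cl) (negPf (expi_neq0 _)) !orbF.
    by rewrite -sqnormc_eq0 sqnormc_sgn; apply/negP; exact: lt0r_neq0.
  have := phase_measure1; rewrite phase_measureE.
  have -> : [set l | [set: X] (l, true)] = setT by apply/seteqP; split.
  have -> : half_measure setT = 0%E by apply/eqP; rewrite eq_le measure_ge0 andbT (le_trans T0) // D0 E0 adde0.
  by rewrite adde0 => /eqP; rewrite eq_sym onee_eq0.
Qed.

End RandomPhaseProcess.

(** * Canonical factorizations *)

Section Isometry.
Context {R : realType} d {X : measurableType d} d' {Y : measurableType d'}.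
Variables (m1 : {measure set X -> \bar R}) (m2 : {measure set Y -> \bar R}).

Lemma nrm_mono (g h : X -> R[i]) : cmeasurable setT g -> L2 m1 h ->
  (forall x, sqnormc (g x) <= sqnormc (h x)) -> nrm m1 g <= nrm m1 h.
Proof.
move=> mg h2 gh; have g2 : L2 m1 g := int_L2 mg (L2_int h2) gh.
rewrite -lee_fin -!L2sqE //; apply: ge0_le_integral => //.
- by move=> x _; rewrite lee_fin sqnormc_ge0.
- by apply/measurable_EFinP; exact: measurable_sqnormc.
- by apply/measurable_EFinP; apply: measurable_sqnormc; case: h2.
- by move=> x _; rewrite lee_fin.
Qed.

(** Distances to combinations depend only on Gram matrices. This transfers an approximation in the
    space of random variables to the line with the same coefficients. *)
Lemma nrm_comb_isometry (g : X -> R[i]) (h : Y -> R[i]) k (c : 'I_k -> R[i])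
    (g_ : 'I_k -> X -> R[i]) (h_ : 'I_k -> Y -> R[i]) :
  L2 m1 g -> L2 m2 h -> (forall i, L2 m1 (g_ i)) -> (forall i, L2 m2 (h_ i)) ->
  nrm m2 h = nrm m1 g -> (forall i, ip m2 h (h_ i) = ip m1 g (g_ i)) ->
  (forall i j, ip m2 (h_ i) (h_ j) = ip m1 (g_ i) (g_ j)) ->
  nrm m2 (fun w => h w - \sum_(i < k) c i * h_ i w) =
  nrm m1 (fun x => g x - \sum_(i < k) c i * g_ i x).
Proof.
move=> g2 h2 g_2 h_2 e1 e2 e3.
have cg i : L2 m1 (fun x => c i * g_ i x) by exact: L2Z.
have ch i : L2 m2 (fun x => c i * h_ i x) by exact: L2Z.
have sg := L2_sum cg; have sh := L2_sum ch.
have E : nrm m2 (fun w => \sum_(i < k) c i * h_ i w) = nrm m1 (fun x => \sum_(i < k) c i * g_ i x).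
  apply: (congr1 (@complex.Re R) (x := (_)%:C) (y := (_)%:C)).
  rewrite -!ipgg !ip_suml //; apply: eq_bigr => i _; rewrite !ip_sumr //; apply: eq_bigr => j _.
  by rewrite !ipZl ?ipZr ?e3.
rewrite !nrmB // e1 E; congr (_ - _ * complex.Re _).
by rewrite !ip_sumr //; apply: eq_bigr => i _; rewrite !ipZr // e2.
Qed.

End Isometry.

Section OrthogonalIncrements.
Context {R : realType} d {X : measurableType d} (P : probability X R).
Local Notation RR := (measurableTypeR R).
Variable eta : R -> X -> R[i].
Hypothesis oeta : orthogonal_increments P eta.

Lemma L2_increment x y : L2 P (fun w => eta y w - eta x w).
Proof.
case: oeta => meta N _; split; first exact: cmeasurableB.
by rewrite N ltry.
Qed.

Let nrm_increment x y : nrm P (fun w => eta y w - eta x w) = `|y - x|.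
Proof. by case: oeta => _ N _; rewrite /nrm N. Qed.

Let e x w := eta x w - eta 0 w.

Let e2 x : L2 P (e x). Proof. exact: L2_increment. Qed.

Let nrm_e x : nrm P (e x) = `|x|.
Proof. by rewrite nrm_increment subr0. Qed.

Let orth s1 t1 s2 t2 : s1 <= t1 -> t1 <= s2 -> s2 <= t2 ->
  ip P (fun w => eta t2 w - eta s2 w) (fun w => eta t1 w - eta s1 w) = 0.
Proof. by case: oeta => _ _; exact. Qed.

(** The covariance of the process normalized to vanish at [0]. Orthogonality is given for ordered
    intervals only, hence the distinction of three positions of [0]. *)
Let ip_e_le x y : x <= y -> ip P (e y) (e x) = ((`|y| + `|x| - `|y - x|) / 2)%:C.
Proof.
move=> xy; have yx0 : 0 <= y - x by rewrite subr_ge0.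
have [x0|x0] := leP 0 x.
  have y0 : 0 <= y := le_trans x0 xy.
  rewrite (_ : e y = fun w => (eta y w - eta x w) + e x w); last by apply/funext => w; rewrite /e addrA subrK.
  rewrite ipDl //; last exact: L2_increment.
  rewrite (orth x0 (lexx x) xy) add0r ipgg nrm_e.
  by congr (_%:C); rewrite (ger0_norm x0) (ger0_norm y0) (ger0_norm yx0); field.
have [y0|y0] := leP 0 y.
  rewrite (_ : e x = fun w => - 1 * (eta 0 w - eta x w)); last by apply/funext => w; rewrite /e; ring.
  rewrite ipZr ?orth ?mulr0 //; [|exact: ltW|exact: L2_increment].
  by rewrite (ger0_norm y0) (ger0_norm yx0) ltr0_norm // (_ : y + - x - (y - x) = 0) ?mul0r //; ring.
rewrite (_ : e x = fun w => e y w - (eta y w - eta x w)); last by apply/funext => w; rewrite /e; ring.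
rewrite ipBr //; last exact: L2_increment.
rewrite ipgg nrm_e (_ : ip _ (e y) _ = 0); last first.
  rewrite (_ : e y = fun w => - 1 * (eta 0 w - eta y w)); last by apply/funext => w; rewrite /e; ring.
  by rewrite ipZl ?orth ?mulr0 //; [exact: ltW|exact: L2_increment|exact: L2_increment].
by rewrite (ger0_norm yx0) (ltr0_norm x0) (ltr0_norm y0) subr0; congr (_%:C); field.
Qed.

Let ip_e x y : ip P (e x) (e y) = ((`|x| + `|y| - `|x - y|) / 2)%:C.
Proof.
have [xy|xy] := leP y x; first exact: ip_e_le.
by rewrite ip_sym // (ip_e_le (ltW xy)) conjc_ofreal distrC (addrC `|x|).
Qed.

Definition increment_pairs : set ((RR -> R[i]) * (X -> R[i])) :=
  [set p | exists x y, x <= y /\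
     p = ((fun s => (\1_(`]x, y]%classic : set R) s)%:C), (fun w => eta y w - eta x w))].

Lemma increment_pairs_L21 p : increment_pairs p -> L2 (leb R) p.1.
Proof. by move=> [x [y [_ ->]]]; exact: L2_itvf. Qed.

Lemma increment_pairs_L22 p : increment_pairs p -> L2 P p.2.
Proof. by move=> [x [y [_ ->]]]; exact: L2_increment. Qed.

Lemma increment_pairs_gram p q : increment_pairs p -> increment_pairs q ->
  ip P p.2 q.2 = 1%:C * ip (leb R) p.1 q.1.
Proof.
move=> [x [y [xy ->]]] [x' [y' [xy' ->]]] /=.
rewrite -[fun s => (\1_`]x, y] s)%:C]/(itvf x y) -[fun s => (\1_`]x', y'] s)%:C]/(itvf x' y') ip_itvf.
have E s t : (fun w => eta t w - eta s w) = fun w => e t w - e s w by apply/funext => w; rewrite /e; ring.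
have D u v : L2 P (fun w => e u w - e v w) := L2B (e2 u) (e2 v).
rewrite !E (ipBl (e2 y) (e2 x) (D y' x')) !(ipBr (e2 _) (e2 y') (e2 x')) !ip_e -!ofrealB -ofrealM mul1r; congr (_%:C).
by have := overlapE xy xy'; lra.
Qed.

End OrthogonalIncrements.

Section ConvolvedPairs.
Context {R : realType}.
Local Notation RR := (measurableTypeR R).
Implicit Types k K phi psi : R -> R[i].

Lemma FT_pairB k K k' K' : FT_pair k K -> FT_pair k' K' ->
  FT_pair (fun t => k t - k' t) (fun l => K l - K' l).
Proof.
move=> kK kK'; have := FT_pairD kK (FT_pairZ (-1) kK').
rewrite (_ : (fun t => k t + - 1 * k' t) = (fun t => k t - k' t)); last by apply/funext => t; rewrite mulN1r.
by rewrite (_ : (fun t => K t + - 1 * K' t) = (fun t => K t - K' t)) //; apply/funext => t; rewrite mulN1r.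
Qed.

Lemma ae_neq (x : R) : \forall t \ae leb R, t != x :> R.
Proof.
have := ae_preserving (leb_preserving_shift (- x)) (ae_neq0 (R := R)).
by apply: ae_mono => t; rewrite subr_eq0.
Qed.

(** If [fourier psi] were the default [0], then [chi n s * fourier phi], and with it [fourier phi],
    would vanish almost everywhere. *)
Lemma convolved_FT_pair n (s : R) phi psi : 0 < s -> L2on `[0, +oo[ phi ->
  ~ {ae leb R, forall l, fourier phi l = 0} -> is_convolved n s phi psi ->
  FT_pair psi (fun l => chi n s l * fourier phi l).
Proof.
move=> s0 phion nz [psion E].
have mPhi : cmeasurable (setT : set RR) (fourier phi).
  by case: (fourier_cases phion) => [[_ []]//|->]; exact: cmeasurable_cst.
case: (fourier_cases psion) => [psiE|psi0].
  have [[mpsi _] _ _] := psiE.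
  apply: FT_pair_ae psiE => //; first by apply: cmeasurableM => //; exact: cmeasurable_chi.
  by apply: (ae_mono _ (aeW _ (fun x : RR => erefl (psi x)))).
case: nz; rewrite psi0 in E; apply: ae_mono2 (chi_neq0_ae n s0) E => l cl.
by move/eqP; rewrite eq_sym mulf_eq0 (negPf cl) => /eqP.
Qed.

Lemma Wop_cases n (s : R) phi : 0 < s -> L2on `[0, +oo[ phi ->
  ~ {ae leb R, forall l, fourier phi l = 0} ->
  Wop n s phi = (fun=> 0) \/
  L2on `[0, +oo[ (Wop n s phi) /\ FT_pair (Wop n s phi) (fun l => chi n s l * fourier phi l).
Proof.
move=> s0 phion nz.
have [[psi hpsi]|no] := pselect (exists psi, is_convolved n s phi psi).
  right; have h : is_convolved n s phi (Wop n s phi).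
    by apply: (xgetPex (fun=> 0 : R[i]) (P := [set psi | is_convolved n s phi psi])); exists psi.
  by split; [case: h|exact: convolved_FT_pair].
by left; apply: xgetPN => psi hpsi; apply: no; exists psi.
Qed.

Lemma power_not_ae0 (P0 : R) (f : R -> R) phi : 0 < P0 -> measurable_fun (setT : set RR) f ->
  {ae leb R, forall l, f l = sqnormc (fourier phi l)} ->
  (\int[leb R]_l (f l)%:E = (2 * pi * P0)%:E)%E -> ~ {ae leb R, forall l, fourier phi l = 0}.
Proof.
move=> P00 mf fE f1 h; have : (\int[leb R]_l (f l)%:E = 0)%E.
  rewrite (ae_eq_integral (fun=> 0%E)) //; first by rewrite integral0.
  - exact/measurable_EFinP.
  - by apply: ae_mono2 h fE => l -> -> _; rewrite sqnormc0.
rewrite f1 => /eqP; rewrite eqe => /eqP E.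
have : 0 < 2 * pi * P0 by rewrite !mulr_gt0 ?pi_gt0.
by rewrite E ltxx.
Qed.

End ConvolvedPairs.

Section Canonical.
Context {R : realType}.
Local Notation RR := (measurableTypeR R).
Variables (n : nat) (P0 : R) (f : R -> R) (phi : R -> R[i]).
Hypotheses (hP0 : 0 < P0) (fc : canonical_factorization n f phi).
Hypothesis f1 : (\int[leb R]_l (f l)%:E = (2 * pi * P0)%:E)%E.
Local Notation Phi := (fourier phi).

Let phion : L2on `[0, +oo[ phi. Proof. by case: fc. Qed.

Lemma canonical_not_ae0 : ~ {ae leb R, forall l, Phi l = 0}.
Proof. case: fc => [[mf _ _] _ fE _]; exact: (power_not_ae0 hP0 mf fE f1). Qed.

Lemma canonical_FT_pair : FT_pair phi Phi.
Proof.
case: (fourier_cases phion) => // h; case: canonical_not_ae0; rewrite h.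
exact: aeW.
Qed.

Lemma canonical_process : exists d (X : measurableType d) (P : probability X R)
    (xi eta : R -> X -> R[i]),
  [/\ orthogonal_increments P eta, Hxi P n xi 0 = Heta P eta 0, moving_average P n xi eta phi &
      forall t s, 0 < s -> L2sq P setT (incr n xi t s) <> 0%E].
Proof.
have fs : spectral_density f by case: fc.
have [d [X [P [xi [hxi nv]]]]] := random_phase_process n hP0 fs f1.
case: fc => _ _ _ /(_ d X P xi hxi)[eta [oe Hz ma]].
by exists d, X, P, xi, eta; split.
Qed.

(** The default [Wop = 0] would make the moving average isometry assign norm zero to the increments
    of the random phase process, which do not vanish. *)
Lemma canonical_Wop s : 0 < s -> L2on `[0, +oo[ (Wop n s phi) /\
  FT_pair (Wop n s phi) (fun l => chi n s l * Phi l).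
Proof.
move=> s0; case: (Wop_cases n s0 phion canonical_not_ae0) => // W0.
have [d [X [P [xi [eta [oe _ ma nv]]]]]] := canonical_process.
case: (nv 0 s s0); have := ma 0 s s0; rewrite W0 => sa.
have [_ L] := simul_approx_L2 (@increment_pairs_L21 _ _ _ eta) (increment_pairs_L22 oe) sa.
rewrite L2sqE //; congr (_%:E).
rewrite (simul_approx_nrm (increment_pairs_L21 (eta := eta)) (increment_pairs_L22 oe) (increment_pairs_gram oe) sa).
by rewrite mul1r /nrm /L2sq; under eq_integral do rewrite sqnormc0; rewrite integral0.
Qed.

(** Transforms of the time-reversed moving average kernels of the increments of [xi] at times
    [t <= 0]: the past of the process, seen on the frequency axis. *)
Definition shifted_factors : set (RR -> R[i]) :=
  [set K | exists t s, [/\ t <= 0, 0 < s & K = fun l => expi (l * t) * (chi n s l * Phi l)]].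

Lemma shifted_factors_FT_pair t s : 0 < s ->
  FT_pair (fun r => Wop n s phi (r + t)) (fun l => expi (l * t) * (chi n s l * Phi l)).
Proof. by move=> s0; apply: FT_pair_shift; case: (canonical_Wop s0). Qed.

Lemma L2_shifted_factors K : shifted_factors K -> L2 (leb R) K.
Proof. by move=> [t [s [_ s0 ->]]]; case: (shifted_factors_FT_pair t s0). Qed.

Let itv_span (x y : R) : 0 <= x -> x <= y -> span_limit (leb R) shifted_factors (fhat (itvf x y)).
Proof.
move=> x0 xy.
have bI : L2b (itvf x y) by apply: (L2b_comb (al := x) (be := y)); apply: comb_gen; exists x, y.
split; first exact: L2_fhat.
move=> e e0; have p2 : 0 < 2 * pi :> R by rewrite mulr_gt0 ?pi_gt0.
have e1 : 0 < e / (2 * pi) by rewrite divr_gt0.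
have [d [X [P [xi [eta [oe Hz ma nv]]]]]] := canonical_process.
have nyx : - y <= - x by rewrite lerN2.
(* Time is reversed: the causal interval []x, y]] corresponds to the increment of [eta] over []- y,
   - x]], which lies in the past because [0 <= x]. *)
pose Y w := eta (- x) w - eta (- y) w.
have Y2 : L2 P Y := L2_increment oe (- y) (- x).
have [mY /(_ _ e1)[m [c [S [HS Se]]]]] : Hxi P n xi 0 Y.
  rewrite Hz; split; first by case: Y2.
  move=> d' d0; exists 1%N, (fun=> 1), (fun=> Y); split; first by move=> _; exists (- y), (- x); rewrite oppr_le0.
  rewrite (_ : (fun w => _) = (fun=> 0)); last by apply/funext => w; rewrite big_ord1 mul1r subrr.
  by rewrite /L2sq; under eq_integral do rewrite sqnormc0; rewrite integral0 lte_fin.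
have /choice[p hp] : forall i, exists p : R * R, [/\ p.1 <= 0, 0 < p.2 & S i = incr n xi p.1 p.2].
  by move=> i; have [t [s [t0 s0 E]]] := HS i; exists (t, s).
have sa i : simul_approx (leb R) P (increment_pairs eta) (fun r => Wop n (p i).2 phi ((p i).1 - r)) (S i).
  by case: (hp i) => _ s0 ->; exact: ma.
have saY : simul_approx (leb R) P (increment_pairs eta) (itvf (- y) (- x)) Y.
  split; [exact: cmeasurable_itvf|by case: Y2|] => d' d0.
  exists 1%N, (fun=> 1), (fun=> (itvf (- y) (- x), Y)); split; first by move=> _; exists (- y), (- x).
  - rewrite (_ : (fun w => _) = (fun=> 0)); last by apply/funext => w; rewrite big_ord1 mul1r subrr.
    by rewrite /L2sq; under eq_integral do rewrite sqnormc0; rewrite integral0 lte_fin.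
  - rewrite (_ : (fun w => _) = (fun=> 0)); last by apply/funext => w; rewrite big_ord1 mul1r subrr.
    by rewrite /L2sq; under eq_integral do rewrite sqnormc0; rewrite integral0 lte_fin.
have G1 := increment_pairs_L21 (eta := eta); have G2 := increment_pairs_L22 oe.
have gr := increment_pairs_gram oe.
have L2i i := simul_approx_L2 G1 G2 (sa i).
have ipE g h g' h' : simul_approx (leb R) P (increment_pairs eta) g h ->
    simul_approx (leb R) P (increment_pairs eta) g' h' -> ip P h h' = ip (leb R) g g'.
  by move=> a b; rewrite (simul_approx_ip G1 G2 gr a b) mul1r.
have Se' : nrm P (fun w => Y w - \sum_(i < m) c i * S i w) < e / (2 * pi).
  rewrite -lte_fin -L2sqE //; apply: L2B => //; apply: L2_sum => i; apply: L2Z.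
  by case: (L2i i).
have I2 := L2_itvf (- y) (- x).
rewrite (@nrm_comb_isometry R _ _ _ _ (leb R) P (itvf (- y) (- x)) Y m c
  (fun i r => Wop n (p i).2 phi ((p i).1 - r)) S I2 Y2 (fun i => proj1 (L2i i)) (fun i => proj2 (L2i i))) in Se'; first last.
- by move=> i j; exact: ipE.
- by move=> i; exact: ipE.
- by rewrite (simul_approx_nrm G1 G2 gr saY) mul1r.
exists (fun l => \sum_(i < m) c i * (expi (l * (p i).1) * (chi n (p i).2 l * Phi l))).
  exists m, c, (fun i l => expi (l * (p i).1) * (chi n (p i).2 l * Phi l)); split=> // i.
  by case: (hp i) => t0 s0 _; exists (p i).1, (p i).2.
have pairI : FT_pair (fun r => itvf (- y) (- x) (- r)) (fhat (itvf x y)).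
  apply: FT_pair_ae (FT_pair_L2b bI).
  - by case: (L2_preserving (@leb_preserving_opp R) I2).
  - by case: (L2_fhat bI).
  (* Reflection turns []- y, - x]] into [[x, y[], which differs from []x, y]] at the end points
     only. *)
  - apply: ae_mono2 (ae_neq x) (ae_neq y) => r rx ry.
    rewrite /itvf !indicE !mem_setE !in_itv /= ltrN2 lerN2 !le_eqVlt.
    by rewrite (negPf ry) (eq_sym x) (negPf rx) /= andbC.
  - exact: aeW.
have pairS : FT_pair (fun r => \sum_(i < m) c i * Wop n (p i).2 phi (r + (p i).1))
    (fun l => \sum_(i < m) c i * (expi (l * (p i).1) * (chi n (p i).2 l * Phi l))).
  apply: FT_pair_sum => i; apply: FT_pairZ; apply: shifted_factors_FT_pair.
  by case: (hp i).
rewrite (FT_pair_nrm (FT_pairB pairI pairS)) mulrC -ltr_pdivlMr //.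
apply: le_lt_trans Se'; rewrite le_eqVlt; apply/orP; left; apply/eqP.
rewrite /nrm -[in RHS](L2sq_preserving (@leb_preserving_opp R)).
  congr (fine (L2sq _ _ _)); apply/funext => r; congr (_ - _); apply: eq_bigr => i _.
  by rewrite opprK addrC.
apply: cmeasurableB; first exact: cmeasurable_itvf.
apply: cmeasurable_sum => i; apply: cmeasurableM; first exact: cmeasurable_cst.
by case: (L2i i) => -[].
Qed.

Let step_span (N : R) s : comb (steps 0 N) s -> span_limit (leb R) shifted_factors (fhat s).
Proof.
move=> [k [c [p [Hp ->]]]].
have ci i : cintegrable (leb R) setT (p i).
  by have [x [y [_ xy _ ->]]] := Hp i; apply: L2b_cintegrable; apply: (L2b_comb (al := x) (be := y)); apply: comb_gen; exists x, y.
rewrite (_ : fhat _ = fun l => \sum_(i < k) c i * fhat (p i) l); last first.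
  apply/funext => l; rewrite fhat_sum; last by move=> i; exact: cintegrableZ.
  by apply: eq_bigr => i _; rewrite fhatZ.
apply: (span_limit_sum (X := RR) L2_shifted_factors) => i.
apply: (span_limitZ (X := RR) L2_shifted_factors).
by have [x [y [x0 xy _ ->]]] := Hp i; exact: itv_span.
Qed.

(* eta(y) - eta(x) <-> 1_]x,y] is an isometry, and H^0(xi) = H^0(eta) says that the increments of xi
   span its image; the moving average representation reads them as translates of phi_s. *)
Lemma canonical_dense k K : FT_pair k K -> (forall t, t < 0 -> k t = 0) ->
  span_limit (leb R) shifted_factors K.
Proof.
move=> kK k0; have [k2 K2 _] := kK; have [mk _] := k2.
apply: (span_limit_closed (X := RR) L2_shifted_factors) => // e e0.
have p2 : 0 < 2 * pi :> R by rewrite mulr_gt0 ?pi_gt0.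
have e1 : 0 < e / (2 * pi) / 4 by rewrite !divr_gt0.
pose A (m : nat) : set RR := [set` `]-oo, (m%:R : R)] ].
have mA m : measurable (A m) by exact: measurable_itv.
have [|m _ /(_ m (leqnn m)) hm] := nrm_cut k2 mA _ e1.
  move=> t; exists (Num.truncn `|t|).+1 => // m /= hm; rewrite /A /= in_itv /=.
  apply: le_trans (ler_norm t) _; apply: le_trans (ltW (truncnS_gt _)) _.
  by rewrite ler_nat.
have mI : measurable (`]0, m%:R]%classic : set RR) by exact: measurable_itv.
have c2 : L2 (leb R) (fun t => cind (`]0, m%:R]%classic : set RR) t * k t) by exact: L2_cind.
have [|_ /(_ _ e1)[s cs hs]] := step_dense (ler0n R m) c2.
  by move=> t tI; rewrite /cind indicE memNset // mul0r.
have bs : L2b s := L2b_comb cs.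
exists (fhat s); first exact: step_span cs.
rewrite (FT_pair_nrm (FT_pairB kK (FT_pair_L2b bs))) mulrC -ltr_pdivlMr //.
have E : nrm (leb R) (fun t => k t - cind (A m) t * k t) =
    nrm (leb R) (fun t => k t - cind (`]0, m%:R]%classic : set RR) t * k t).
  apply: nrm_ae_eq.
  - by apply: cmeasurableB => //; case: (L2_cind (mA m) k2).
  - by apply: cmeasurableB => //; case: c2.
  - apply: ae_mono (ae_neq 0) => t t0; congr (_ - _); rewrite /cind !indicE !mem_setE /A !in_itv /=.
    case: (ltrP t 0) => h; first by rewrite k0 ?mulr0.
    by rewrite (_ : 0 < t) // lt_neqAle eq_sym t0.
rewrite E in hm; have s2 : L2 (leb R) s by case: bs.
rewrite (_ : (fun t => _) = (fun t => (k t - cind (`]0, m%:R]%classic : set RR) t * k t) +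
   (cind (`]0, m%:R]%classic : set RR) t * k t - s t))); last by apply/funext => t; rewrite addrA subrK.
apply: (le_lt_trans (nrmD_le (L2B k2 c2) (L2B c2 s2))); exact: add_quarters.
Qed.

(** All shifted factors vanish on the zero set of [Phi], hence so does, up to a null set, the
    transform of []0, 1]], a limit of their combinations. But that transform is nonzero almost
    everywhere. *)
Lemma canonical_neq0 : \forall l \ae leb R, Phi l != 0.
Proof.
have bI : L2b (itvf (0 : R) 1) by apply: (L2b_comb (al := 0) (be := 1)); apply: comb_gen; exists 0, 1.
have K2 := L2_fhat bI; pose K := fhat (itvf (0 : R) 1).
have [_ [mPhi _] _] := canonical_FT_pair.
pose N : set RR := [set l | sqnormc (Phi l) = 0].
have mN : measurable N.
  have mq := measurable_sqnormc mPhi; have := mq measurableT [set (0 : R)] (measurable_set1 _).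
  by rewrite setTI.
have [_ H] := itv_span (lexx 0) ler01.
have NK := L2_cind mN K2.
have : nrm (leb R) (fun l => cind N l * K l) = 0.
  apply/eqP; rewrite eq_le nrm_ge0 andbT; apply/ler_addgt0Pr => e e0; rewrite add0r.
  have [S cS hS] := H e e0; have S2 := L2_comb (X := RR) L2_shifted_factors cS.
  apply: le_trans (ltW hS); apply: nrm_mono; [by case: NK|exact: L2B|] => l.
  rewrite /cind indicE; have [|] := boolP (l \in N); last by rewrite mul0r sqnormc0 sqnormc_ge0.
  rewrite inE /N /= => /eqP; rewrite sqnormc_eq0 => /eqP Pl.
  have [k [c [p [Hp ->]]]] := cS; rewrite big1 ?subr0 ?mul1r // => i _.
  by have [t [s [_ _ ->]]] := Hp i; rewrite Pl !mulr0.
move=> /(nrm_eq0_ae NK) h.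
have h2 := expi_neq1_ae (oner_neq0 R).
apply: ae_mono2 (ae_mono2 (fun l a b => conj a b) h2 ae_neq0) h => l [e1 l0] a.
apply/negP => Pl; move: a; rewrite /K fhat_itvf // /cind indicE mem_set; last first.
  by rewrite /N /=; apply/eqP; rewrite sqnormc_eq0.
rewrite mul1r mulr0 oppr0 expi0; apply/eqP; rewrite mulf_neq0 ?invr_eq0 //.
- by rewrite subr_eq0 eq_sym.
- by rewrite eq_complex negb_and /= l0 orbT.
Qed.

End Canonical.

(** * Optimal characteristics *)

Section Orthogonality.
Context {R : realType} d {X : measurableType d} (m : {measure set X -> \bar R}).

Lemma cmeasurableV (g : X -> R[i]) : cmeasurable setT g -> cmeasurable setT (fun x => (g x)^-1).
Proof.
move=> mg; rewrite (_ : (fun x => _) = (fun x => ((sqnormc (g x))^-1)%:C * (g x)^*)).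
  apply: cmeasurableM; last exact: cmeasurable_conj.
  apply: cmeasurable_real; apply: (measurableT_comp measurable_invr); exact: measurable_sqnormc.
apply/funext => x; have [->|gx] := eqVneq (g x) 0; first by rewrite invr0 rmorph0 mulr0.
have c0 : (sqnormc (g x))%:C != 0 by rewrite -mulc_conj mulf_neq0 // conjC_eq0.
by apply: (mulIf gx); rewrite mulVf // -mulrA [_^* * _]mulrC mulc_conj -ofrealM mulVf // sqnormc_eq0.
Qed.

(** The last hypothesis says that [u - r] is orthogonal to [r], so this is the theorem of
    Pythagoras. *)
Lemma nrm_orthogonal_split (u r : X -> R[i]) : L2 m u -> L2 m r -> ip m u r = (nrm m r)%:C ->
  nrm m (fun x => u x - r x) = nrm m u - nrm m r.
Proof. by move=> u2 r2 E; rewrite nrmB // E /=; ring. Qed.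

End Orthogonality.

Section Prediction.
Context {R : realType}.
Local Notation RR := (measurableTypeR R).
Variables (n : nat) (tau T P0 : R) (a : R -> R[i]).
Hypothesis (htau : 0 < tau) (hT : 0 < T) (hP0 : 0 < P0).
Hypothesis ha : cmeasurable (X := measurableTypeR R) `[0, T] a.
Hypothesis ha1 : (\int[leb R]_(t in `[0%R, T])
              (ComplexField.Normc.normc (Dop n tau T a t))%:E < +oo)%E.
Hypothesis ha2 : (\int[leb R]_(t in `[0%R, T])
              (t * sqnormc (Dop n tau T a t))%:E < +oo)%E.
Local Notation r psi := (rch n tau T a psi).
Local Notation A := (Achar n tau T a).
Local Notation X0 := (chi n tau).

Definition has_power (f : R -> R) := (\int[leb R]_l (f l)%:E = (2 * pi * P0)%:E)%E.

Lemma L2on_causal (g : R -> R[i]) : L2on `[0, +oo[ g -> forall t, t < 0 -> g t = 0.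
Proof. by case=> _ _ g0 t t0; apply: g0; rewrite /= in_itv /= andbT; apply/negP; rewrite -ltNge. Qed.

Section Competitor.
Variables (f0 : R -> R) (phi0 phi psi : R -> R[i]).
Hypotheses (fc : canonical_factorization n f0 phi0) (f1 : has_power f0).
Hypotheses (phion : L2on `[0, +oo[ phi) (pair_phi : FT_pair phi (fourier phi)).
Hypotheses (psion : L2on `[0, +oo[ psi) (pair_psi : FT_pair psi (fun l => X0 l * fourier phi l)).
Local Notation Phi := (fourier phi).
Local Notation Phi0 := (fourier phi0).
Local Notation psi0 := (Wop n tau phi0).
Hypothesis u2 : L2 (leb R) (fun l => r psi0 l * (Phi l / Phi0 l)).

Let causal := L2on_causal psion.
Let r2 : L2 (leb R) (r psi) := L2_rch htau hT ha ha2 pair_psi causal.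
Let AP : L2 (leb R) (fun l => A l * (X0 l * Phi l)).
Proof. by apply: (L2_Achar_mul htau ha ha1); case: pair_psi. Qed.

Let w2 : L2 (leb R) (fun l => A l * (X0 l * Phi l) - r psi0 l * (Phi l / Phi0 l)) := L2B AP u2.

Let conj_rho_causal (t : R) : t < 0 -> (trunc_DA n tau T a psi t)^* = 0.
Proof.
move=> t0; rewrite /trunc_DA cind_itvE in_itv /= leNgt t0 /= mul0r; exact: rmorph0.
Qed.

Let pair_r := FT_pair_rch htau hT ha ha2 pair_psi causal.

Let ip_prediction : ip (leb R) (fun l => A l * (X0 l * Phi l) - r psi l) (r psi) = 0.
Proof. exact: (integral_prediction htau hT ha ha1 ha2 pair_psi causal pair_r conj_rho_causal). Qed.

(* The error A Psi - r0 Phi / Phi0 equals (A X0 Phi0 - r0) Phi / Phi0, so its product with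
   Phi0 is a product of two causal factors; such products against Phi0 suffice by density. *)
Let ip_factor t s : t <= 0 -> 0 < s ->
  ip (leb R) (fun l => (expi (l * t) * (chi n s l * Phi0 l))^*)
    (fun l => A l * (X0 l * Phi l) - r psi0 l * (Phi l / Phi0 l)) = 0.
Proof.
move=> t0 s0; have [W0 pW0] := canonical_Wop hP0 fc f1 htau.
have H := wH1_prediction htau hT ha ha1 ha2 pW0 (L2on_causal W0) pair_phi (L2on_causal phion).
have [iH /(_ (- t))] := wH1_chi n (ltW s0) H.
rewrite oppr_ge0 => /(_ t0) E.
have G2 : L2 (leb R) (fun l => expi (l * t) * (chi n s l * Phi0 l)).
  by apply: (L2_shifted_factors hP0 fc f1); exists t, s.
transitivity ((0 : R[i])^*); last exact: rmorph0.
rewrite /ip -E -cintegral_conj; last exact: (cintegrable_phase_mul (- t) iH).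
clear E.
apply: ae_eq_cintegral.
- exact: (cintegrable_cmeasurable (L2M_cintegrable (L2_conj G2) (L2_conj w2))).
- exact: (cmeasurable_conj (cintegrable_cmeasurable (cintegrable_phase_mul (- t) iH))).
- apply: ae_mono (canonical_neq0 hP0 fc f1) => l Pl; rewrite -conjcM; congr (_^*).
  have gen (e c x p q z y : R[i]) : q != 0 -> e * (c * q) * (z * (x * p) - y * (p / q)) =
      e * (c * ((z * (x * q) - y) * p)) by move=> q0; field.
  rewrite (gen _ _ _ _ _ _ _ Pl) mulrN opprK; reflexivity.
Qed.

(** The conjugate of [r psi] is a causal transform, hence a limit of combinations of shifted factors
    of [phi0]; by [ip_factor] the error is orthogonal to their conjugates, and so to [r psi]. The
    remaining product of [A * X0 * Phi] with [r psi] is evaluated by [ip_prediction]. *)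
Lemma competitor_ip : ip (leb R) (fun l => r psi0 l * (Phi l / Phi0 l)) (r psi) = (nrm (leb R) (r psi))%:C.
Proof.
have H : ip (leb R) (r psi) (fun l => A l * (X0 l * Phi l) - r psi0 l * (Phi l / Phi0 l)) = 0.
  apply: ip_approx0 => // e e0.
  have [_ /(_ _ e0)[S cS hS]] := canonical_dense hP0 fc f1 pair_r conj_rho_causal.
  have S2 := L2_comb (X := RR) (L2_shifted_factors hP0 fc f1) cS.
  exists (fun l => (S l)^*); first exact: L2_conj.
  split.
    rewrite -nrm_conj (_ : (fun l => _) = (fun l => (r psi l)^* - S l)) //.
    by apply/funext => l; rewrite conjcB conjCK.
  have [k [c [p [Hp SE]]]] := cS.
  have p2 i : L2 (leb R) (fun l => (p i l)^*).
    by apply: L2_conj; exact: (L2_shifted_factors hP0 fc f1).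
  rewrite (_ : (fun l => _) = (fun l => \sum_(i < k) (c i)^* * (p i l)^*)); last first.
    by apply/funext => l; rewrite SE rmorph_sum; apply: eq_bigr => i _; exact: conjcM.
  rewrite ip_suml //; last by move=> i; exact: L2Z.
  apply: big1 => i _; rewrite ipZl //.
  by have [t [s [t0 s0 ->]]] := Hp i; rewrite ip_factor ?mulr0.
have E : ip (leb R) (fun l => A l * (X0 l * Phi l)) (r psi) = (nrm (leb R) (r psi))%:C.
  by have := ip_prediction; rewrite ipBl // ipgg => /eqP; rewrite subr_eq0 => /eqP.
rewrite (_ : (fun l => _) = (fun l => A l * (X0 l * Phi l) - (A l * (X0 l * Phi l) - r psi0 l * (Phi l / Phi0 l)))).
  by rewrite ipBl // E (ip_sym r2 w2) H rmorph0 subr0.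
by apply/funext => l; rewrite opprB addrC subrK.
Qed.

Lemma competitor_le : nrm (leb R) (r psi) <= nrm (leb R) (fun l => r psi0 l * (Phi l / Phi0 l)).
Proof.
rewrite -subr_ge0 -nrm_orthogonal_split ?nrm_ge0 //; exact: competitor_ip.
Qed.

Lemma competitor_eq : nrm (leb R) (fun l => r psi0 l * (Phi l / Phi0 l)) <= nrm (leb R) (r psi) ->
  {ae leb R, forall l, r psi0 l * (Phi l / Phi0 l) = r psi l}.
Proof.
move=> h; have : nrm (leb R) (fun l => r psi0 l * (Phi l / Phi0 l) - r psi l) = 0.
  apply/eqP; rewrite eq_le nrm_ge0 andbT nrm_orthogonal_split ?subr_le0 //; exact: competitor_ip.
move/(nrm_eq0_ae (L2B u2 r2)); apply: ae_mono => l /eqP; by rewrite subr_eq0 => /eqP.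
Qed.

End Competitor.

(** Measurability is required of [h * X0] rather than of [h], because membership in [Hclass]
    provides it for the product only. *)
Lemma mse_weight (h : R -> R[i]) (f w : R -> R) :
  cmeasurable (setT : set RR) (fun l => h l * X0 l) -> measurable_fun (setT : set RR) f ->
  measurable_fun (setT : set RR) w -> (forall l, 0 <= f l) -> (forall l, 0 <= w l) ->
  {ae leb R, forall l, sqnormc (A l - h l) * sqnormc (X0 l) = w l} ->
  mse n tau T a h f = (((2 * pi)^-1)%:E * \int[leb R]_l (w l * f l)%:E)%E.
Proof.
move=> mh mf mw f0 w0 hw; have c0 : 0 <= (2 * pi)^-1 :> R by rewrite invr_ge0 mulr_ge0 ?pi_ge0.
have mwf : measurable_fun (setT : set RR) (fun l => (w l * f l)%:E).
  by apply/measurable_EFinP; exact: measurable_funM.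
rewrite -(ge0_integralZl_EFin (leb R) measurableT (f1 := fun l => (w l * f l)%:E)
  (fun l _ => mulr_ge0 (w0 l) (f0 l)) mwf c0).
apply: ae_eq_integral => //.
- apply/measurable_EFinP; apply: measurable_funM; first exact: measurable_cst.
  apply: measurable_funM => //.
  rewrite (_ : (fun l => _) = (fun l => sqnormc (A l * X0 l - h l * X0 l))).
    apply: measurable_sqnormc; apply: cmeasurableB => //; apply: cmeasurableM.
      exact: (cmeasurable_Achar n htau ha).
    exact: cmeasurable_chi.
  by apply/funext => l; rewrite -sqnormcM mulrBl.
- apply: measurable_funeM; exact: mwf.
- by apply: ae_mono hw => l -> _; rewrite -[pi *+ 2]mulr_natl EFinM.
Qed.

Lemma weight_L2sq (f : R -> R) (g F : R -> R[i]) : measurable_fun (setT : set RR) f ->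
  cmeasurable (setT : set RR) g -> cmeasurable (setT : set RR) F ->
  {ae leb R, forall l, f l = sqnormc (F l)} ->
  (\int[leb R]_l (sqnormc (g l) * f l)%:E)%E = L2sq (leb R) setT (fun l => g l * F l).
Proof.
move=> mf mg mF fF; apply: ae_eq_integral => //.
- by apply/measurable_EFinP; apply: measurable_funM => //; exact: measurable_sqnormc.
- by apply/measurable_EFinP; apply: measurable_sqnormc; exact: cmeasurableM.
- by apply: ae_mono fF => l -> _; rewrite sqnormcM.
Qed.

Section Optimal.
Variables (f0 : R -> R) (phi0 : R -> R[i]).
Hypotheses (fc : canonical_factorization n f0 phi0) (f1 : has_power f0).
Local Notation Phi0 := (fourier phi0).
Local Notation psi0 := (Wop n tau phi0).
Local Notation r0 := (r psi0).

Lemma canonical_rch : L2 (leb R) r0 /\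
  (L2sq (leb R) setT r0 = (2 * pi)%:E * DAWnorm2 n tau T a phi0)%E.
Proof.
have [W0 pW0] := canonical_Wop hP0 fc f1 htau; have c := L2on_causal W0.
by split; [exact: (L2_rch htau hT ha ha2 pW0 c)|exact: (nrm_rch htau hT ha ha2 pW0 c)].
Qed.

Lemma cmeasurable_ratio : cmeasurable (setT : set RR) (fun l => r0 l / Phi0 l).
Proof.
have [[mr _] _] := canonical_rch; have [_ [mP _] _] := canonical_FT_pair hP0 fc f1.
by apply: cmeasurableM => //; exact: cmeasurableV.
Qed.

Lemma DAWnorm2_nrm : DAWnorm2 n tau T a phi0 = ((2 * pi)^-1 * nrm (leb R) r0)%:E.
Proof.
have [r2 E] := canonical_rch; have p2 : 0 < 2 * pi :> R by rewrite mulr_gt0 ?pi_gt0.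
rewrite EFinM -L2sqE // E muleA -EFinM mulVf ?lt0r_neq0 // mul1e; reflexivity.
Qed.

(** The last hypothesis says that the prediction optimal for [f0] does no worse under [f] than under
    [f0]. It also supplies the square integrability of [r0 * Phi / Phi0] on which the comparison
    rests. *)
Lemma competitor_DAWnorm2 (f : R -> R) (phi : R -> R[i]) : measurable_fun (setT : set RR) f ->
  L2on `[0, +oo[ phi -> FT_pair phi (fourier phi) ->
  {ae leb R, forall l, f l = sqnormc (fourier phi l)} -> ~ {ae leb R, forall l, fourier phi l = 0} ->
  (\int[leb R]_l (sqnormc (r0 l / Phi0 l) * f l)%:E <= L2sq (leb R) setT r0)%E ->
  (DAWnorm2 n tau T a phi <= DAWnorm2 n tau T a phi0)%E /\
  (L2on `[0, +oo[ (Wop n tau phi) -> DAWnorm2 n tau T a phi = DAWnorm2 n tau T a phi0 ->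
   FT_pair (Wop n tau phi) (fun l => X0 l * fourier phi l) ->
   {ae leb R, forall l, r0 l / Phi0 l * fourier phi l = r (Wop n tau phi) l}).
Proof.
move=> mf phion pphi fE nz Le; have [r02 _] := canonical_rch.
have [_ [mP _] _] := pphi; have p2 : 0 < 2 * pi :> R by rewrite mulr_gt0 ?pi_gt0.
have uE : (fun l => r0 l / Phi0 l * fourier phi l) = (fun l => r0 l * (fourier phi l / Phi0 l)).
  by apply/funext => l; rewrite mulrAC mulrA.
rewrite (weight_L2sq mf cmeasurable_ratio mP fE) in Le.
have u2 : L2 (leb R) (fun l => r0 l * (fourier phi l / Phi0 l)).
  rewrite -uE; split; first by apply: cmeasurableM => //; exact: cmeasurable_ratio.
  by apply: le_lt_trans Le _; case: r02.
have un : nrm (leb R) (fun l => r0 l * (fourier phi l / Phi0 l)) <= nrm (leb R) r0.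
  by rewrite -lee_fin -!L2sqE // -uE.
have D0 : (0 <= DAWnorm2 n tau T a phi0)%E.
  by rewrite DAWnorm2_nrm lee_fin mulr_ge0 ?nrm_ge0 // invr_ge0 ltW.
have nE (won : L2on `[0, +oo[ (Wop n tau phi))
    (pw : FT_pair (Wop n tau phi) (fun l => X0 l * fourier phi l)) :
    DAWnorm2 n tau T a phi = ((2 * pi)^-1 * nrm (leb R) (r (Wop n tau phi)))%:E.
  have c := L2on_causal won; have rr2 := L2_rch htau hT ha ha2 pw c.
  rewrite EFinM -L2sqE // (nrm_rch htau hT ha ha2 pw c) muleA -EFinM mulVf ?lt0r_neq0 // mul1e; reflexivity.
split.
(* For a factor that need not be canonical, [Wop] may take its default value; the left side is then
   [0]. *)
- case: (Wop_cases n htau phion nz) => [W0|[won pw]].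
    rewrite /DAWnorm2 W0 (_ : DAop n tau T a (fun=> 0) = fun=> 0).
      by rewrite /L2sq; under eq_integral do rewrite sqnormc0; rewrite integral0.
    apply/funext => t; apply: big1 => k _; rewrite (_ : (fun u => _) = (fun=> 0)).
      by rewrite cintegral_indic; under [X in cintegral _ _ X]eq_fun do rewrite mulr0; rewrite cintegral0 mulr0.
    by apply/funext => u; rewrite mulr0.
  have c0 : 0 <= (2 * pi)^-1 :> R by rewrite invr_ge0 ltW.
  rewrite (nE won pw) DAWnorm2_nrm lee_fin.
  apply: ler_wpM2l; first exact: c0.
  exact: le_trans (competitor_le fc f1 phion pphi won pw u2) un.
- have c0 : (2 * pi)^-1 != 0 :> R by rewrite invr_eq0 lt0r_neq0.
  move=> won E0 pw.
  have E := esym E0.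
  have Ea := esym DAWnorm2_nrm.
  have Eb := nE won pw.
  have E1 := etrans Ea E.
  have E3 := etrans E1 Eb.
  have E2 := mulfI c0 (EFin_inj E3); clear E0 E E1 Ea Eb E3.
  move: (un); rewrite E2 => un'.
  have H := competitor_eq fc f1 phion pphi won pw u2 un'.
  have gen (x p q : R[i]) : x / q * p = x * (p / q) by rewrite mulrAC mulrA.
  apply: ae_mono H => l; rewrite gen; exact.
Qed.

End Optimal.

End Prediction.

(** * The error of the optimal characteristic and its lower bound over all characteristics *)

Section OptimalCharacteristic.
Context {R : realType}.
Local Notation RR := (measurableTypeR R).
Variables (n : nat) (tau T P0 : R) (a : R -> R[i]).
Hypothesis (htau : 0 < tau) (hT : 0 < T) (hP0 : 0 < P0).
Hypothesis ha : cmeasurable (X := measurableTypeR R) `[0, T] a.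
Hypothesis ha1 : (\int[leb R]_(t in `[0%R, T])
              (ComplexField.Normc.normc (Dop n tau T a t))%:E < +oo)%E.
Hypothesis ha2 : (\int[leb R]_(t in `[0%R, T])
              (t * sqnormc (Dop n tau T a t))%:E < +oo)%E.
Local Notation r psi := (rch n tau T a psi).
Local Notation A := (Achar n tau T a).
Local Notation X0 := (chi n tau).
Variables (f0 : R -> R) (phi0 : R -> R[i]).
Hypotheses (fc : canonical_factorization n f0 phi0) (f1 : has_power P0 f0).
Local Notation Phi0 := (fourier phi0).
Local Notation r0 := (r (Wop n tau phi0)).

Let f0E : {ae leb R, forall l, f0 l = sqnormc (Phi0 l)}. Proof. by case: fc. Qed.

Let cancel_ratio (x p : R[i]) : p != 0 -> x / p * p = x.
Proof. by move=> p0; rewrite divfK. Qed.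

Lemma canonical_ratio_L2sq (phi1 : R -> R[i]) : canonical_factorization n f0 phi1 ->
  (\int[leb R]_l (sqnormc (r (Wop n tau phi1) l / fourier phi1 l) * f0 l)%:E =
   L2sq (leb R) setT (r (Wop n tau phi1)))%E.
Proof.
move=> fc1; have [[mf _ _] _ fE _] := fc1.
have [_ [mP _] _] := canonical_FT_pair hP0 fc1 f1.
have [[mr _] _] := canonical_rch htau hT hP0 ha ha2 fc1 f1.
have mq := cmeasurable_ratio htau hT hP0 ha ha2 fc1 f1.
rewrite (weight_L2sq mf mq mP fE); apply: ae_eq_L2sq.
- exact: (cmeasurableM mq mP).
- exact: mr.
- apply: ae_mono (canonical_neq0 hP0 fc1 f1) => l; exact: cancel_ratio.
Qed.

Let canonical_compare (phi1 phi2 : R -> R[i]) :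
  canonical_factorization n f0 phi1 -> canonical_factorization n f0 phi2 ->
  (DAWnorm2 n tau T a phi2 <= DAWnorm2 n tau T a phi1)%E /\
  (DAWnorm2 n tau T a phi2 = DAWnorm2 n tau T a phi1 ->
   {ae leb R, forall l, r (Wop n tau phi1) l / fourier phi1 l * fourier phi2 l = r (Wop n tau phi2) l}).
Proof.
move=> fc1 fc2; have [[mf _ _] phion fE _] := fc2.
have pphi := canonical_FT_pair hP0 fc2 f1; have nz := canonical_not_ae0 hP0 fc2 f1.
have [won pw] := canonical_Wop hP0 fc2 f1 htau.
have le1 : (\int[leb R]_l (sqnormc (r (Wop n tau phi1) l / fourier phi1 l) * f0 l)%:E <= L2sq (leb R) setT (r (Wop n tau phi1)))%E.
  rewrite (canonical_ratio_L2sq fc1); exact: lexx.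
have [h1 h2] := competitor_DAWnorm2 htau hT hP0 ha ha1 ha2 fc1 f1 mf phion pphi fE nz le1.
split; first exact: h1.
move=> E; exact: (h2 won E pw).
Qed.

(** [hopt] is built from the chosen function [canon], while the statements concern a given [phi0].
    Two canonical functions of one density compete with each other in both directions, so equality
    holds and the quotients agree. *)
Let canonical_ratio_unique (phi1 : R -> R[i]) : canonical_factorization n f0 phi1 ->
  {ae leb R, forall l, r (Wop n tau phi1) l / fourier phi1 l = r0 l / Phi0 l}.
Proof.
move=> fc1; have [h1 h2] := canonical_compare fc1 fc; have [h3 _] := canonical_compare fc fc1.
have E : DAWnorm2 n tau T a phi0 = DAWnorm2 n tau T a phi1.
  have anti (x y : \bar R) : (x <= y -> y <= x -> x = y)%E by move=> xy yx; apply/le_anti/andP.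
  exact: (anti _ _ h1 h3).
have gen (x p y : R[i]) : p != 0 -> x * p = y -> x = y / p by move=> p0 <-; rewrite mulfK.
apply: ae_mono2 (h2 E) (canonical_neq0 hP0 fc f1) => l e p0; exact: (gen _ _ _ p0 e).
Qed.

Let canonP : canonical_factorization n f0 (Defs.canon n f0).
Proof.
apply: (xgetPex (fun=> 0 : R[i]) (P := [set phi | canonical_factorization n f0 phi])).
by exists phi0.
Qed.

Lemma mse_hopt (f : R -> R) : measurable_fun (setT : set RR) f -> (forall l, 0 <= f l) ->
  mse n tau T a (hopt n tau T a f0) f =
  (((2 * pi)^-1)%:E * \int[leb R]_l (sqnormc (r0 l / Phi0 l) * f l)%:E)%E.
Proof.
move=> mf f00.
have [_ [mP _] _] := canonical_FT_pair hP0 canonP f1.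
have [[mr _] _] := canonical_rch htau hT hP0 ha ha2 canonP f1.
have mA := cmeasurable_Achar n htau ha; have mX : cmeasurable (setT : set RR) X0 := cmeasurable_chi n tau.
have mh : cmeasurable (setT : set RR) (hopt n tau T a f0).
  exact: (cmeasurableB mA (cmeasurableM mr (cmeasurableV (cmeasurableM mX mP)))).
have gen (x y z p : R[i]) : y != 0 -> sqnormc (x - (x - z / (y * p))) * sqnormc y = sqnormc (z / p).
  by move=> y0; rewrite -sqnormcM opprB addrC subrK; congr sqnormc; rewrite invfM mulrA mulrAC divfK.
apply: (mse_weight htau ha (cmeasurableM mh mX) mf).
- apply: measurable_sqnormc; exact: (cmeasurable_ratio htau hT hP0 ha ha2 fc f1).
- exact: f00.
- move=> l; exact: sqnormc_ge0.
- apply: ae_mono2 (canonical_ratio_unique canonP) (chi_neq0_ae n htau) => l E X0l.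
  rewrite -E; exact: (gen _ _ _ _ X0l).
Qed.

Lemma mse_hopt_self : mse n tau T a (hopt n tau T a f0) f0 = DAWnorm2 n tau T a phi0.
Proof.
have [[mf f00 _] _ _ _] := fc; rewrite (mse_hopt mf f00) (canonical_ratio_L2sq fc).
have [r2 _] := canonical_rch htau hT hP0 ha ha2 fc f1.
rewrite (L2sqE r2) (DAWnorm2_nrm htau hT hP0 ha ha2 fc f1); reflexivity.
Qed.

Let fhat_halfline (g : R -> R[i]) (l : R) :
  cintegral (leb R) `[0, +oo[ (fun t => g t * expi (- (l * t))) =
  fhat (fun t => cind (`[0, +oo[%classic : set R) t * g t) l.
Proof. by rewrite cintegral_indic; congr cintegral; apply/funext => t; rewrite mulrA. Qed.

(** For admissible [h], the function [h * X0 * Phi0] is a limit of causal ones, all orthogonal to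
    [r0] because the conjugate of [r0] is causal. The error therefore has the same inner product
    with [r0] as [A * X0 * Phi0], namely [nrm r0], and Pythagoras bounds its norm below. *)
Lemma mse_ge (h : R -> R[i]) : L20minus n tau f0 (fun l => h l * X0 l) ->
  (DAWnorm2 n tau T a phi0 <= mse n tau T a h f0)%E.
Proof.
move=> [mh H]; have [[mf f00 _] phion _ _] := fc.
have pphi := canonical_FT_pair hP0 fc f1; have [_ P2 _] := pphi; have [mP _] := P2.
have [won pw] := canonical_Wop hP0 fc f1 htau.
have [r2 _] := canonical_rch htau hT hP0 ha ha2 fc f1.
have mA := cmeasurable_Achar n htau ha; have mX : cmeasurable (setT : set RR) X0 := cmeasurable_chi n tau.
have mAh : cmeasurable (setT : set RR) (fun l => A l * X0 l - h l * X0 l).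
  exact: (cmeasurableB (cmeasurableM mA mX) mh).
have p2 : 0 < 2 * pi :> R by rewrite mulr_gt0 ?pi_gt0.
have spE (g : R -> R[i]) : cmeasurable (setT : set RR) g ->
    spnorm2 f0 g = (((2 * pi)^-1)%:E * L2sq (leb R) setT (fun l => g l * Phi0 l)%R)%E.
  move=> mg; rewrite -(weight_L2sq mf mg mP f0E).
  have mw : measurable_fun (setT : set RR) (fun l => (sqnormc (g l) * f0 l)%:E).
    apply/measurable_EFinP; apply: measurable_funM; last exact: mf.
    exact: measurable_sqnormc.
  have w0 l : 0 <= sqnormc (g l) * f0 l by rewrite mulr_ge0 ?sqnormc_ge0.
  have c0 : 0 <= (2 * pi)^-1 :> R by rewrite invr_ge0 ltW.
  rewrite -(ge0_integralZl_EFin (leb R) measurableT (f1 := fun l => (sqnormc (g l) * f0 l)%:E)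
    (fun l _ => w0 l) mw c0).
  rewrite /spnorm2 -[pi *+ 2]mulr_natl; apply: eq_integral => l _.
  rewrite -EFinM; congr (_%:E); rewrite -mulrA; congr (_ * _); exact: mulrC.
have -> : mse n tau T a h f0 = (((2 * pi)^-1)%:E * L2sq (leb R) setT (fun l => (A l * X0 l - h l * X0 l) * Phi0 l)%R)%E.
  rewrite -(weight_L2sq mf mAh mP f0E).
  apply: (mse_weight htau ha mh mf (measurable_sqnormc mAh) f00 (fun l => sqnormc_ge0 _)).
  by apply: aeW => l; rewrite -sqnormcM mulrBl.
have causalr t : t < 0 -> (trunc_DA n tau T a (Wop n tau phi0) t)^* = 0.
  by move=> t0; rewrite /trunc_DA cind_itvE in_itv /= leNgt t0 /= mul0r; exact: rmorph0.
have prr := FT_pair_rch htau hT ha ha2 pw (L2on_causal won).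
(* A generator comes from an integrable [g], which need not be square-integrable and so need not
   belong to a Fourier pair. Orthogonality is obtained from [wH1_L1_mul] instead. *)
have gens (g : R -> R[i]) : cintegrable (leb R) `[0, +oo[ g ->
    let y := fun l => X0 l * cintegral (leb R) `[0, +oo[ (fun t => g t * expi (- (l * t))) in
    cmeasurable (setT : set RR) y /\ (L2 (leb R) (fun l => y l * Phi0 l) /\ ip (leb R) (fun l => y l * Phi0 l) r0 = 0).
  move=> ig y; pose g' t := cind (`[0, +oo[%classic : set R) t * g t.
  have yE : y = fun l => X0 l * fhat g' l by apply/funext => l; rewrite /y fhat_halfline.
  have ig' : cintegrable (leb R) setT g'.
    have mI : measurable (`[0%R, +oo[%classic : set RR) by exact: measurable_itv.
    case: ig => i1 i2; split.
    - move: i1 => /(integrable_mkcond _ mI); congr (_.-integrable _ _); apply/funext => t.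
      rewrite patchE /g' /cind indicE; case: (t \in _); rewrite ?mul1r ?mul0r //.
    - move: i2 => /(integrable_mkcond _ mI); congr (_.-integrable _ _); apply/funext => t.
      rewrite patchE /g' /cind indicE; case: (t \in _); rewrite ?mul1r ?mul0r //.
  have g'0 t : t < 0 -> g' t = 0 by move=> t0; rewrite /g' cind_itvE in_itv /= leNgt t0 mul0r.
  have mg : cmeasurable (setT : set RR) (fhat g') by exact: cmeasurable_fhat (cintegrable_cmeasurable ig').
  have [_ hX _] := pw.
  have W := FT_pair_wH1 pphi prr (L2on_causal phion) causalr.
  have [_ /(_ 0 (lexx _)) Z] := wH1_chi n (ltW htau) (wH1_L1_mul ig' g'0 W).
  split; first by rewrite yE; apply: cmeasurableM.
  split.
  - have := L2_mul_bounded (X := RR) mg (fun l => sqnormc_fhat_le_L1 l ig') hX.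
    by congr L2; apply/funext => l; rewrite yE mulrA (mulrC (X0 l)).
  - rewrite -[RHS]Z /ip; congr cintegral; apply/funext => l.
    rewrite yE mulr0 oppr0 expi0 mul1r !mulrA; reflexivity.
pose hP l := h l * X0 l * Phi0 l.
have approx (e : R) : 0 < e -> exists k, [/\ L2 (leb R) k, ip (leb R) k r0 = 0 &
    (L2sq (leb R) setT (fun l => hP l - k l)%R < e%:E)%E].
  move=> e0; have [m [c [s [Hs hs]]]] := H _ (divr_gt0 e0 p2).
  have G i : cmeasurable (setT : set RR) (s i) /\
      (L2 (leb R) (fun l => s i l * Phi0 l) /\ ip (leb R) (fun l => s i l * Phi0 l) r0 = 0).
    by have [g ig ->] := Hs i; exact: gens.
  have L2i i : L2 (leb R) (fun l => c i * (s i l * Phi0 l)) by apply: L2Z; case: (G i) => _ [].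
  exists (fun l => \sum_(i < m) c i * (s i l * Phi0 l)); split.
  - exact: L2_sum.
  - rewrite ip_suml //; apply: big1 => i _; have [_ [L Z]] := G i.
    by rewrite ipZl // Z mulr0.
  - move: hs; rewrite spE; last first.
      apply: cmeasurableB => //; apply: cmeasurable_sum => i; apply: cmeasurableM; first exact: cmeasurable_cst.
      by case: (G i).
    rewrite (_ : (fun l => (h l * X0 l - _) * Phi0 l) = (fun l => hP l - \sum_(i < m) c i * (s i l * Phi0 l))).
      by rewrite [e / _]mulrC EFinM lte_pmul2l ?lte_fin ?invr_gt0.
    apply/funext => l; rewrite mulrBl mulr_suml; congr (_ - _); apply: eq_bigr => i _; by rewrite mulrA.
have hP2 : L2 (leb R) hP.
  have [k [k2 _ hk]] := approx 1 ltr01.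
  have d2 : L2 (leb R) (fun l => hP l - k l).
    split; last exact: lt_trans hk (ltry _).
    by apply: cmeasurableB; [exact: cmeasurableM|case: k2].
  by have := L2D d2 k2; congr L2; apply/funext => l; rewrite subrK.
have hP0' : ip (leb R) hP r0 = 0.
  apply: ip_approx0 => // e e0; have [k [k2 kr hk]] := approx e e0; exists k => //; split=> //.
  by rewrite -lte_fin -L2sqE //; exact: L2B.
have [_ XP2 _] := pw; have AP2 := L2_Achar_mul htau ha ha1 XP2.
have Er : ip (leb R) (fun l => A l * (X0 l * Phi0 l)) r0 = (nrm (leb R) r0)%:C.
  have := integral_prediction htau hT ha ha1 ha2 pw (L2on_causal won) prr causalr.
  rewrite -[cintegral _ _ _]/(ip (leb R) (fun l => A l * (X0 l * Phi0 l) - r0 l) r0) (ipBl AP2 r2 r2) ipgg.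
  by move/eqP; rewrite subr_eq0 => /eqP.
rewrite (_ : (fun l => _) = (fun l => A l * (X0 l * Phi0 l) - hP l)); last first.
  by apply/funext => l; rewrite mulrBl mulrA.
have e2 := L2B AP2 hP2.
have le : nrm (leb R) r0 <= nrm (leb R) (fun l => A l * (X0 l * Phi0 l) - hP l).
  rewrite -subr_ge0 -(nrm_orthogonal_split e2 r2) ?nrm_ge0 //.
  by rewrite (ipBl AP2 hP2 r2) hP0' subr0 Er.
rewrite (DAWnorm2_nrm htau hT hP0 ha ha2 fc f1) (L2sqE e2) -EFinM lee_fin.
apply: ler_wpM2l le; by rewrite invr_ge0 ltW.
Qed.

End OptimalCharacteristic.

(** * The saddle point *)

Section Saddle.
Context {R : realType}.
Local Notation RR := (measurableTypeR R).

(* q / f1 is the weight of the error density: it is at least k^-1 where f1 is cut from above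
   and at most k^-1 where f1 is raised to v, so (q / f1 - k^-1) (f - f1) <= 0. *)
Lemma clipped_saddle (v f u f1 q k : R) : 0 < k -> 0 < f1 -> v <= f <= u ->
  f1 = Num.max v (Num.min u (k * q)) -> q / f1 * f + k^-1 * f1 <= q + k^-1 * f.
Proof.
move=> k0 f10 /andP[vf fu] E; pose w := q / f1.
have wq : w * f1 = q by rewrite /w divfK // gt_eqF.
have kk : k^-1 * k = 1 by rewrite mulVf // gt_eqF.
have ki : 0 < k^-1 by rewrite invr_gt0.
have H : (w - k^-1) * (f - f1) <= 0.
  have [ff|ff] := ltrP f f1.
    have f1q : f1 <= k * q.
      rewrite {1}E ge_max ge_min lexx orbT andbT.
      move: (le_lt_trans vf ff); rewrite E lt_max ltxx /= lt_min => /andP[_]; exact: ltW.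
    have : k^-1 <= w by rewrite /w ler_pdivlMr // -(mul1r q) -kk -mulrA ler_pM2l.
    by move=> h; rewrite mulr_ge0_le0 ?subr_ge0 // subr_le0 ltW.
  have [ff'|ff'] := ltrP f1 f; last by rewrite (_ : f = f1) ?subrr ?mulr0 //; apply/le_anti/andP.
  have qf1 : k * q <= f1.
    have : Num.min u (k * q) <= f1 by rewrite E le_max lexx orbT.
    by rewrite ge_min => /orP[h|//]; move: (lt_le_trans ff' fu); rewrite ltNge h.
  have : w <= k^-1 by rewrite /w ler_pdivrMr // -(mul1r q) -kk -mulrA ler_pM2l.
  by move=> h; rewrite mulr_le0_ge0 ?subr_le0 // subr_ge0.
rewrite -/w -wq; move: H; rewrite mulrBr !mulrBl; lra.
Qed.

Variables (n : nat) (tau T P0 : R) (v u : R -> R) (a : R -> R[i]).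
Hypothesis (htau : 0 < tau) (hT : 0 < T) (hP0 : 0 < P0).
Hypotheses (hv : spectral_density v) (hu : spectral_density u).
Hypothesis ha : cmeasurable (X := measurableTypeR R) `[0, T] a.
Hypothesis ha1 : (\int[leb R]_(t in `[0%R, T])
              (ComplexField.Normc.normc (Dop n tau T a t))%:E < +oo)%E.
Hypothesis ha2 : (\int[leb R]_(t in `[0%R, T])
              (t * sqnormc (Dop n tau T a t))%:E < +oo)%E.
Local Notation r psi := (rch n tau T a psi).
Local Notation D := (Dvu v u P0).
Local Notation DAW := (DAWnorm2 n tau T a).

(** Plancherel's theorem turns the norm [P0] on [[0, T]] into the total power, and for support in
    [[0, T]] the chosen transform agrees almost everywhere with the explicit integral. *)
Lemma finite_power (f : R -> R) (phi : R -> R[i]) : L2on `[0, T] phi ->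
  L2sq (leb R) `[0, T] phi = P0%:E -> spectral_density f ->
  {ae leb R, forall l, f l = sqnormc (fourier phi l)} ->
  has_power P0 f /\ {ae leb R, forall l, densT T phi l = f l}.
Proof.
move=> on E [mf _ _] fE; have [pphi aeE] := fourier_fourierT (ltW hT) on.
have [phi2 F2 _] := pphi; have [mF _] := F2.
have [_ E1] := L2on_L2 (measurable_itv _) on.
split; last by apply: ae_mono2 fE aeE => l -> h; rewrite /densT h.
transitivity (L2sq (leb R) setT (fourier phi)); last by rewrite L2sqE // (FT_pair_nrm pphi) /nrm E1 E.
apply: ae_eq_integral => //.
- exact/measurable_EFinP.
- by apply/measurable_EFinP; exact: measurable_sqnormc.
- by apply: ae_mono fE => l -> _.
Qed.

(** The pointwise inequality [clipped_saddle] is integrated with [k = |c|^2]. The multiplier [k^-1]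
    of the power constraint drops out because [f] and [f1] have the same integral. *)
Lemma saddle_weight (c : R[i]) (phi1 : R -> R[i]) (f : R -> R) :
  L2on `[0, T] phi1 -> L2sq (leb R) `[0, T] phi1 = P0%:E ->
  canonical_factorization n (formF n tau T a v u c phi1) phi1 -> D f ->
  (\int[leb R]_l (sqnormc (r (Wop n tau phi1) l / fourier phi1 l) * f l)%:E <=
   L2sq (leb R) setT (r (Wop n tau phi1)))%E.
Proof.
move=> on E fc [[mf f0 fi] vfu fP]; set f1 := formF _ _ _ _ _ _ _ _ in fc *.
have [sd1 _ f1E _] := fc; have [mf1 f10 f1i] := sd1.
have [f1P _] := finite_power on E sd1 f1E.
have mq := cmeasurable_ratio htau hT hP0 ha ha2 fc f1P.
have [r2 _] := canonical_rch htau hT hP0 ha ha2 fc f1P; have [mr _] := r2.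
set w := fun l => sqnormc (r (Wop n tau phi1) l / fourier phi1 l).
have mw : measurable_fun (setT : set RR) w := measurable_sqnormc mq.
have w0 l : 0 <= w l := sqnormc_ge0 _.
(* For [c = 0] there is no multiplier, but then [f1 = v]; since [v <= f] and both have the same
   power, [f] equals [f1] almost everywhere. *)
have [c0|c0] := eqVneq c 0.
  have vE l : f1 l = v l.
    case: hv hu => _ v0 _ [_ u0 _].
    by rewrite /f1 /formF c0 mul0r sqnormc0 (min_r (u0 l)) (max_l (v0 l)).
  have df : (leb R).-integrable setT (fun l => (f l)%:E - (f1 l)%:E)%E by apply: integrableB.
  have : ae_eq (leb R) setT (fun l => (f l)%:E - (f1 l)%:E)%E (cst 0%E).
    apply/(ae_eq_integral_abs (leb R) measurableT); first by case/integrableP: df.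
    transitivity (\int[leb R]_l ((f l)%:E - (f1 l)%:E))%E.
      apply: ae_eq_integral => //.
      - by apply: measurableT_comp => //; case/integrableP: df.
      - by case/integrableP: df.
      - by apply: ae_mono vfu => l /andP[h _] _; rewrite -EFinB gee0_abs // lee_fin subr_ge0 vE.
    by rewrite integralB // fP f1P subee.
  move=> ff1; rewrite -(canonical_ratio_L2sq htau hT hP0 ha ha2 f1P fc).
  rewrite le_eqVlt; apply/orP; left; apply/eqP; apply: ae_eq_integral => //.
  - by apply/measurable_EFinP; exact: measurable_funM.
  - by apply/measurable_EFinP; exact: measurable_funM.
  - apply: ae_mono ff1 => l /(_ Logic.I); rewrite -EFinB /= => -[] /eqP.
    by rewrite subr_eq0 => /eqP -> _.
have k0 : 0 < sqnormc c by rewrite lt_neqAle sqnormc_ge0 andbT eq_sym sqnormc_eq0.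
set k := sqnormc c in k0 *; have ki : 0 <= k^-1 by rewrite invr_ge0 ltW.
have mI (g h : R -> R) : measurable_fun (setT : set RR) g -> measurable_fun (setT : set RR) h ->
    measurable_fun (setT : set RR) (fun l => (g l)%:E + (k^-1)%:E * (h l)%:E)%E.
  move=> mg mh; apply: emeasurable_funD; first exact/measurable_EFinP.
  by apply: measurable_funeM; exact/measurable_EFinP.
have split_int (g h : R -> R) : measurable_fun (setT : set RR) g -> measurable_fun (setT : set RR) h ->
    (forall l, 0 <= g l) -> (forall l, 0 <= h l) -> (\int[leb R]_l (h l)%:E = (2 * pi * P0)%:E)%E ->
    (\int[leb R]_l ((g l)%:E + (k^-1)%:E * (h l)%:E) =
     \int[leb R]_l (g l)%:E + (k^-1 * (2 * pi * P0))%:E)%E.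
  move=> mg mh g0 h0 hP; have mgE : measurable_fun (setT : set RR) (fun l => (g l)%:E) by exact/measurable_EFinP.
  have mhE : measurable_fun (setT : set RR) (fun l => (h l)%:E) by exact/measurable_EFinP.
  rewrite ge0_integralD //.
  - by rewrite (ge0_integralZl_EFin (leb R) measurableT (f1 := fun l => (h l)%:E) (fun l _ => h0 l) mhE ki) hP EFinM.
  - by move=> l _; rewrite lee_fin.
  - by move=> l _; rewrite -EFinM lee_fin mulr_ge0.
  - exact: measurable_funeM.
have mwf : measurable_fun (setT : set RR) (fun l => w l * f l) by exact: measurable_funM.
have mq2 : measurable_fun (setT : set RR) (fun l => sqnormc (r (Wop n tau phi1) l)) := measurable_sqnormc mr.
have wf0 l : 0 <= w l * f l by rewrite mulr_ge0.
have q0 l : 0 <= sqnormc (r (Wop n tau phi1) l) := sqnormc_ge0 _.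
(* The terms with [k^-1] are added on opposite sides rather than subtracted, which keeps both
   integrands nonnegative; their finite integrals coincide and cancel. *)
suff : (\int[leb R]_l ((w l * f l)%:E + (k^-1)%:E * (f1 l)%:E) <=
        \int[leb R]_l ((sqnormc (r (Wop n tau phi1) l))%:E + (k^-1)%:E * (f l)%:E))%E.
  rewrite (split_int _ _ mwf mf1 wf0 f10 f1P) (split_int _ _ mq2 mf q0 f0 fP).
  by rewrite leeD2rE.
apply: ae_ge0_le_integral => //.
- by move=> l _; rewrite -EFinM -EFinD lee_fin addr_ge0 // mulr_ge0.
- exact: (mI _ _ mwf mf1).
- by move=> l _; rewrite -EFinM -EFinD lee_fin addr_ge0 // mulr_ge0.
- exact: (mI _ _ mq2 mf).
- have nz := canonical_neq0 hP0 fc f1P.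
  apply: ae_mono2 (ae_mono2 (fun l p q => conj p q) vfu f1E) nz => l [h1 h2] p0 _.
  have f1p : 0 < f1 l by rewrite h2 lt_neqAle sqnormc_ge0 andbT eq_sym sqnormc_eq0.
  rewrite -!EFinM -!EFinD lee_fin /w sqnormcM sqnormcV -h2.
  by apply: (clipped_saddle k0 f1p h1); rewrite /f1 /formF sqnormcM.
Qed.

End Saddle.

(** * The hatted operator as a time reversal *)

Section Reflection.
Context {R : realType}.
Local Notation RR := (measurableTypeR R).
Variables (n : nat) (tau T : R) (a : R -> R[i]).
Hypothesis (htau : 0 < tau) (hT : 0 < T).
Hypothesis ha : cmeasurable (X := measurableTypeR R) `[0, T] a.
Hypothesis ha2 : (\int[leb R]_(t in `[0%R, T])
              (t * sqnormc (Dop n tau T a t))%:E < +oo)%E.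

Lemma DAhatop_reflect psi t : DAhatop n tau T a psi t = DAop n tau T a psi (T - t).
Proof.
rewrite /DAhatop /DAop subKr; apply: eq_bigr => k _; congr (_ * cintegral _ _ _).
by apply/funext => s; congr (a _ * _); rewrite (addrC s).
Qed.

Lemma Wop_causal phi : L2 (leb R) (Wop n tau phi) /\ forall t, t < 0 -> Wop n tau phi t = 0.
Proof.
have [[psi hpsi]|no] := pselect (exists psi, is_convolved n tau phi psi).
  have [h _] : is_convolved n tau phi (Wop n tau phi).
    by apply: (xgetPex (fun=> 0 : R[i]) (P := [set psi | is_convolved n tau phi psi])); exists psi.
  by split; [case: (L2on_L2 (measurable_itv _) h)|exact: L2on_causal].
rewrite (_ : Wop n tau phi = fun=> 0); first by split => //; exact: L20.
by apply: xgetPN => psi hpsi; apply: no; exists psi.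
Qed.

Lemma DAWnorm2_DAhatWnorm2 phi : DAWnorm2 n tau T a phi = DAhatWnorm2 n tau T a phi.
Proof.
have [W2 W0] := Wop_causal phi; set psi := Wop n tau phi in W2 W0.
have mrho := cmeasurable_trunc_DA htau hT ha ha2 W2 W0.
have E (g : R -> R[i]) : L2sq (leb R) `[0%R, T] g =
    L2sq (leb R) setT (fun t => cind (`[0, T]%classic : set R) t * g t).
  rewrite /L2sq [LHS]integral_mkcond; apply: eq_integral => t _; rewrite patchE /cind indicE.
  by case: (t \in _); rewrite ?mul1r ?mul0r ?sqnormc0.
rewrite /DAWnorm2 /DAhatWnorm2 -/psi !E -[LHS](L2sq_preserving (leb_preserving_reflect T) mrho).
congr L2sq; apply: funextR => t; rewrite /trunc_DA DAhatop_reflect; congr (_ * _).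
rewrite !cind_itvE !in_itv /= subr_ge0 lerBlDr lerDl andbC; reflexivity.
Qed.

End Reflection.

(** * Least favorable densities and minimax characteristics *)

Section Minimax.
Context {R : realType}.
Local Notation RR := (measurableTypeR R).
Variables (n : nat) (tau T P0 : R) (v u : R -> R) (a : R -> R[i]).
Hypothesis (htau : 0 < tau) (hT : 0 < T) (hP0 : 0 < P0).
Hypotheses (hv : spectral_density v) (hu : spectral_density u).
Hypothesis ha : cmeasurable (X := measurableTypeR R) `[0, T] a.
Hypothesis ha1 : (\int[leb R]_(t in `[0%R, T])
              (ComplexField.Normc.normc (Dop n tau T a t))%:E < +oo)%E.
Hypothesis ha2 : (\int[leb R]_(t in `[0%R, T])
              (t * sqnormc (Dop n tau T a t))%:E < +oo)%E.
Local Notation r psi := (rch n tau T a psi).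
Local Notation D := (Dvu v u P0).
Local Notation DAW := (DAWnorm2 n tau T a).

Section FixedDensity.
Variables (f0 : R -> R) (phi0 : R -> R[i]).
Hypotheses (fc : canonical_factorization n f0 phi0) (Df0 : D f0).

Let f0P : has_power P0 f0. Proof. by case: Df0. Qed.

Lemma least_favorable_of_bound :
  (forall f phi, D f -> canonical_factorization n f phi -> (DAW phi <= DAW phi0)%E) ->
  least_favorable n tau T a D f0.
Proof.
move=> H; split=> //; first by exists phi0.
move=> f Df [phi fcf]; have fP : has_power P0 f by case: Df.
have gen (x y z w : \bar R) : (x = y -> z = w -> y <= w -> x <= z)%E by move=> -> ->.
exact: (gen _ _ _ _ (mse_hopt_self htau hT hP0 ha ha1 ha2 fcf fP)
  (mse_hopt_self htau hT hP0 ha ha1 ha2 fc f0P) (H _ _ Df fcf)).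
Qed.

(** At the single density [f0] every competitor already has an error of at least [DAW phi0], which
    bounds the worst error of the proposed characteristic. *)
Lemma minimax_robust_of_saddle :
  (forall f, D f -> (mse n tau T a (hopt n tau T a f0) f <= DAW phi0)%E) ->
  Hclass n tau D (hopt n tau T a f0) -> minimax_robust n tau T a D (hopt n tau T a f0).
Proof.
move=> H hH; split=> // h hh; apply: (@le_trans _ _ (DAW phi0)).
  by apply: ge_ereal_sup => _ [f Df <-]; exact: H.
apply: le_trans (mse_ge htau hT hP0 ha ha1 ha2 fc f0P (hh _ Df0)) _.
by apply: ereal_sup_ubound; exists f0.
Qed.

End FixedDensity.

Section SaddlePoint.
Variables (c : R[i]) (phi1 : R -> R[i]).
Hypotheses (on : L2on `[0, T] phi1) (E : L2sq (leb R) `[0, T] phi1 = P0%:E).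
Local Notation f1 := (formF n tau T a v u c phi1).
Hypothesis fc : canonical_factorization n f1 phi1.

Let f1P : has_power P0 f1.
Proof. by case: fc => sd _ fE _; case: (finite_power hT on E sd fE). Qed.

Lemma saddle_mse f : D f -> (mse n tau T a (hopt n tau T a f1) f <= DAW phi1)%E.
Proof.
move=> Df; have [[mf f00 _] _ _] := Df.
have [r2 _] := canonical_rch htau hT hP0 ha ha2 fc f1P.
have c0 : 0 < (2 * pi)^-1 :> R by rewrite invr_gt0 mulr_gt0 ?pi_gt0.
rewrite (mse_hopt htau hT hP0 ha ha1 ha2 fc f1P mf f00) (DAWnorm2_nrm htau hT hP0 ha ha2 fc f1P).
rewrite EFinM -(L2sqE r2); apply: lee_wpmul2l; first by rewrite lee_fin ltW.
exact: (saddle_weight htau hT hP0 hv hu ha ha2 on E fc Df).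
Qed.

Lemma saddle_DAWnorm2 f phi : D f -> L2on `[0, +oo[ phi -> FT_pair phi (fourier phi) ->
  {ae leb R, forall l, f l = sqnormc (fourier phi l)} -> (DAW phi <= DAW phi1)%E.
Proof.
move=> Df phion pphi fE; have [[mf _ _] _ fP] := Df.
have S := saddle_weight htau hT hP0 hv hu ha ha2 on E fc Df.
by case: (competitor_DAWnorm2 htau hT hP0 ha ha1 ha2 fc f1P mf phion pphi fE (power_not_ae0 hP0 mf fE fP) S).
Qed.

Lemma saddle_canonical f phi : D f -> canonical_factorization n f phi -> (DAW phi <= DAW phi1)%E.
Proof.
move=> Df fcf; have [_ _ fP] := Df; have [_ phion fE _] := fcf.
exact: saddle_DAWnorm2 Df phion (canonical_FT_pair hP0 fcf fP) fE.
Qed.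

Lemma saddle_ratio_unique f phi : D f -> canonical_factorization n f phi -> (DAW phi1 <= DAW phi)%E ->
  {ae leb R, forall l, r (Wop n tau phi1) l / fourier phi1 l = r (Wop n tau phi) l / fourier phi l}.
Proof.
move=> Df fcf le1; have [[mf _ _] _ fP] := Df; have [_ phion fE _] := fcf.
have S := saddle_weight htau hT hP0 hv hu ha ha2 on E fc Df.
have pphi := canonical_FT_pair hP0 fcf fP; have [won pw] := canonical_Wop hP0 fcf fP htau.
have [le2 H] := competitor_DAWnorm2 htau hT hP0 ha ha1 ha2 fc f1P mf phion pphi fE
  (power_not_ae0 hP0 mf fE fP) S.
have anti (x y : \bar R) : (x <= y -> y <= x -> x = y)%E by move=> xy yx; apply/le_anti/andP.
have gen (x p y : R[i]) : p != 0 -> x * p = y -> x = y / p by move=> p0 <-; rewrite mulfK.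
apply: ae_mono2 (H won (anti _ _ le2 le1) pw) (canonical_neq0 hP0 fcf fP) => l e p0.
exact: (gen _ _ _ p0 e).
Qed.

(** Clipping stays below [u] only where [v <= u], hence the hypothesis. The two densities agree
    almost everywhere, and Plancherel's theorem gives their power. *)
Lemma densT_in_class : {ae leb R, forall l, v l <= u l} -> D (densT T phi1) /\ D f1.
Proof.
move=> vu; have [sd _ fE _] := fc; have [mf1 _ if1] := sd.
have [_ dE] := finite_power hT on E sd fE.
have f1vu : {ae leb R, forall l, v l <= f1 l <= u l}.
  by apply: ae_mono vu => l h; rewrite /formF le_max lexx /= ge_max h ge_min lexx.
split=> //.
have md : measurable_fun (setT : set RR) (densT T phi1).
  rewrite /densT (fourierT_fhat on); apply: measurable_sqnormc; apply: cmeasurable_fhat.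
  by case: on.
have mdE : measurable_fun (setT : set RR) (fun l => (densT T phi1 l)%:E) by exact/measurable_EFinP.
have mfE : measurable_fun (setT : set RR) (fun l => (f1 l)%:E) by exact/measurable_EFinP.
have d0 l : 0 <= densT T phi1 l by exact: sqnormc_ge0.
have dP : (\int[leb R]_l (densT T phi1 l)%:E = (2 * pi * P0)%:E)%E.
  by rewrite -[RHS]f1P; apply: ae_eq_integral => //; apply: ae_mono dE => l -> _.
split=> //; last by apply: ae_mono2 dE f1vu => l ->.
split=> //; apply/integrableP; split=> //.
by under eq_integral do rewrite gee0_abs ?lee_fin //; rewrite dP ltry.
Qed.

End SaddlePoint.

(** The rivals in the extremum problem are arbitrary factors of densities of the class, so the bound
    comes from [saddle_DAWnorm2], which holds for factors that need not be canonical. *)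
Lemma SFset_extremal c phi1 : L2on `[0, T] phi1 -> L2sq (leb R) `[0, T] phi1 = P0%:E ->
  canonical_factorization n (formF n tau T a v u c phi1) phi1 -> {ae leb R, forall l, v l <= u l} ->
  determined n tau T a v u P0 c phi1.
Proof.
move=> on E fc vu; split; [exact: fc| |exact: E].
split; [exact: on|exact: (proj1 (densT_in_class on E fc vu))|].
move=> phi phion Dphi; have [pphi aeE] := fourier_fourierT (ltW hT) phion.
apply: (saddle_DAWnorm2 on E fc Dphi (L2on_itv_halfline phion) pphi).
by apply: ae_mono aeE => l ->.
Qed.

Lemma ereal_sup_nup phi : SFset n tau T a v u P0 phi ->
  (DAW phi <= ereal_sup [set DAW psi | psi in SFset n tau T a v u P0])%E.
Proof. by move=> h; apply: ereal_sup_ubound; exists phi. Qed.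

(** The supremum of the empty set is [-oo], and multiplication by [P0^-1 > 0] preserves it. *)
Lemma SFset_nonempty : (-oo < nup n tau T a v u P0)%E -> exists phi, SFset n tau T a v u P0 phi.
Proof.
move=> h; have [//|no] := pselect (exists phi, SFset n tau T a v u P0 phi).
move: h; rewrite /nup (_ : [set _ | _ in _] = set0).
  by rewrite ereal_sup0 gt0_muleNy ?ltxx // lte_fin invr_gt0.
by apply/seteqP; split => // x [phi hphi _]; case: no; exists phi.
Qed.

End Minimax.


Theorem theorem10 (R : realType) (n : nat) (tau T P0 : R) (v u : R -> R)
    (a : R -> R[i])
    (hn : (1 <= n)%N) (htau : 0 < tau) (hT : 0 < T) (hP0 : 0 < P0)
    (hv : spectral_density v) (hu : spectral_density u)
    (ha : cmeasurable (X := measurableTypeR R) `[0, T] a)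
    (ha1 : (\int[leb R]_(t in `[0%R, T])
              (ComplexField.Normc.normc (Dop n tau T a t))%:E < +oo)%E)
    (ha2 : (\int[leb R]_(t in `[0%R, T])
              (t * sqnormc (Dop n tau T a t))%:E < +oo)%E) :
  [/\ (* the two expressions for the maximized norm agree *)
      forall phi, L2on `[0, T] phi ->
        DAWnorm2 n tau T a phi = DAhatWnorm2 n tau T a phi,
      (* (i) and (iii) *)
      forall phi0, Sset n tau T a v u P0 phi0 ->
        nu n tau T a v u P0 = nup n tau T a v u P0 ->
        (nu n tau T a v u P0 * P0%:E)%E = DAWnorm2 n tau T a phi0 ->
        [/\ least_favorable n tau T a (Dvu v u P0) (densT T phi0),
            one_sided_moving_average n (densT T phi0) phi0 &
            Hclass n tau (Dvu v u P0) (hopt n tau T a (densT T phi0)) ->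
            minimax_robust n tau T a (Dvu v u P0) (hopt n tau T a (densT T phi0))] &
      (* (ii) and (iii) *)
      (nu n tau T a v u P0 < nup n tau T a v u P0)%E ->
        (Dvu v u P0 !=set0 ->
         exists c phi0, determined n tau T a v u P0 c phi0) /\
        forall c phi0, determined n tau T a v u P0 c phi0 ->
          least_favorable n tau T a (Dvu v u P0) (formF n tau T a v u c phi0) /\
          (Hclass n tau (Dvu v u P0) (hopt n tau T a (formF n tau T a v u c phi0)) ->
           minimax_robust n tau T a (Dvu v u P0)
             (hopt n tau T a (formF n tau T a v u c phi0)))].

Proof.
set D := Dvu v u P0.
have pick phi1 : SFset n tau T a v u P0 phi1 -> exists2 c, L2on `[0, T] phi1 /\
    L2sq (leb R) `[0, T] phi1 = P0%:E & canonical_factorization n (formF n tau T a v u c phi1) phi1.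
  by move=> [on E [c fc]]; exists c.
split.
- by move=> phi _; exact: (DAWnorm2_DAhatWnorm2 htau hT ha ha2 phi).
- move=> phi0 [on0 _ E0 vu0 fc0] nuE nuP.
  have [sd0 phion0 fE0 oma] := fc0; have [f0P _] := finite_power hT on0 E0 sd0 fE0.
  have Df0 : D (densT T phi0) by split.
  set sF := ereal_sup [set DAWnorm2 n tau T a psi | psi in SFset n tau T a v u P0].
  have D0 : (0 <= DAWnorm2 n tau T a phi0)%E by exact: L2sq_ge0.
  have sFE : sF = DAWnorm2 n tau T a phi0.
    rewrite -nuP nuE /nup -/sF [RHS]muleC muleA -EFinM mulfV ?lt0r_neq0 // mul1e; reflexivity.
  (* The supremum equals a squared norm, so it is nonnegative and the set cannot be empty. *)
  have [phi1 hphi1] : exists phi1, SFset n tau T a v u P0 phi1.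
    apply: (SFset_nonempty hP0); apply: lt_le_trans (ltNyr 0) _.
    rewrite /nup -/sF sFE; apply: mule_ge0; last exact: D0.
    rewrite lee_fin; apply: ltW; rewrite invr_gt0; exact: hP0.
  have [c [on1 E1] fc1] := pick phi1 hphi1.
  (* [phi1] is an arbitrary element of [SFset], but every such element is a saddle point. So [le01]
     applies to all canonical rivals, [phi0] included, and with [le10] the two norms coincide. *)
  have le10 : (DAWnorm2 n tau T a phi1 <= DAWnorm2 n tau T a phi0)%E by rewrite -sFE; exact: ereal_sup_nup.
  have le01 := saddle_canonical htau hT hP0 hv hu ha ha1 ha2 on1 E1 fc1.
  have ratioE := saddle_ratio_unique htau hT hP0 hv hu ha ha1 ha2 on1 E1 fc1 Df0 fc0 le10.
  split.
  + apply: (least_favorable_of_bound htau hT hP0 ha ha1 ha2 fc0 Df0) => f phi Df fcf.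
    exact: le_trans (le01 f phi Df fcf) le10.
  + by move=> d X P xi hxi; have [eta [oe _ ma]] := oma d X P xi hxi; exists eta.
  (* The saddle inequality is available for the density of [phi1]. By [ratioE] the error weights of
     [phi0] and [phi1] agree almost everywhere, so it carries over to [phi0]. *)
  + apply: (minimax_robust_of_saddle htau hT hP0 ha ha1 ha2 fc0 Df0) => f Df.
    apply: le_trans le10.
    have [sd1 _ fE1 _] := fc1; have [f1P _] := finite_power hT on1 E1 sd1 fE1.
    have [[mf f00 _] _ _] := Df.
    have gen (x y z : \bar R) : (x = y -> y <= z -> x <= z)%E by move=> ->.
    apply: (gen _ _ _ _ (saddle_mse htau hT hP0 hv hu ha ha1 ha2 on1 E1 fc1 Df)).
    have gen2 (k x y i j : \bar R) : (x = k * i -> y = k * j -> i = j -> x = y)%E by move=> -> -> ->.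
    apply: (gen2 _ _ _ _ _ (mse_hopt htau hT hP0 ha ha1 ha2 fc0 f0P mf f00)
      (mse_hopt htau hT hP0 ha ha1 ha2 fc1 f1P mf f00)).
    have m0 := cmeasurable_ratio htau hT hP0 ha ha2 fc0 f0P.
    have m1 := cmeasurable_ratio htau hT hP0 ha ha2 fc1 f1P.
    have mw (q : R -> R[i]) : cmeasurable (setT : set (measurableTypeR R)) q ->
        measurable_fun (setT : set (measurableTypeR R)) (fun l => (sqnormc (q l) * f l)%:E).
      move=> mq; apply/measurable_EFinP; apply: measurable_funM; last exact: mf.
      exact: measurable_sqnormc.
    apply: ae_eq_integral; [exact: measurableT|exact: (mw _ m0)|exact: (mw _ m1)|].
    apply: ae_mono ratioE => l e _; exact: (congr1 (fun z => (sqnormc z * f l)%:E) (esym e)).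
(* The strict inequality puts [nup] above [-oo], so some [phi1] of the form (F) exists. A member of
   the class then yields [v <= u] almost everywhere, which makes [phi1] extremal. *)
- move=> lt_nu; have [phi1 hphi1] := SFset_nonempty hP0 (le_lt_trans (leNye _) lt_nu).
  split.
    move=> [f [_ vfu _]]; have [c [on1 E1] fc1] := pick phi1 hphi1; exists c, phi1.
    apply: (SFset_extremal htau hT hP0 hv hu ha ha1 ha2 on1 E1 fc1).
    by apply: ae_mono vfu => l /andP[]; exact: le_trans.
  move=> c phi0 [fc0 [on0 [_ vdu _] _] E0].
  have vu : {ae leb R, forall l, v l <= u l} by apply: ae_mono vdu => l /andP[]; exact: le_trans.
  have [_ Df0] := densT_in_class hT on0 E0 fc0 vu.
  split.
    apply: (least_favorable_of_bound htau hT hP0 ha ha1 ha2 fc0 Df0) => f phi.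
    exact: (saddle_canonical htau hT hP0 hv hu ha ha1 ha2 on0 E0 fc0).
  apply: (minimax_robust_of_saddle htau hT hP0 ha ha1 ha2 fc0 Df0) => f.
  exact: (saddle_mse htau hT hP0 hv hu ha ha1 ha2 on0 E0 fc0).
Qed.
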